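(* Let $k$ be a fixed field and let $n,a,b,c,m,p_1,p_2,q,r$ be nine integers. (a) Let $D(n,a,b,c)$ denote the set of all connected graded $k$-algebras $A$ with at most $n$ generators such that $m_1(A)\le a$, $m_2(A)\le b$, and $m_3(A)\le c$. Then the set of Hilbert series of algebras from $D(n,a,b,c)$ is finite. (b) Let $DM=DM(n,a,b,c,m,p_1,p_2,q,r)$ denote the set of all graded right modules $M$ over algebras from $D(n,a,b,c)$ with at most $m$ generators such that $M_i=0$ for $i<p_1$, $m_0(M)\le p_2$, $m_1(M)\le q$, and $m_2(M)\le r$. Then the set of Hilbert series of modules from $DM$ is finite.
   Context: A connected graded algebra over $k$ is an associative algebra $A=\bigoplus_{i\ge 0}A_i$ with $A_0=k$. For an algebra $A$, $m_i(A)=\sup\{j\mid \mathrm{Tor}_i^A(k,k)_j\ne0\}$ (with $m_i(A)=0$ if $\mathrm{Tor}_i^A(k,k)=0$), where $k$ is the trivial module. For a graded right $A$-module $M$, $m_i(M)=\sup\{j\mid \mathrm{Tor}_i^A(M,k)_j\ne0\}$ (with $m_i(M)=0$ if $\mathrm{Tor}_i^A(M,k)=0$). The Hilbert series of a locally finite graded vector space $V$ is $V(z)=\sum_{i\in\mathbb{Z}}(\dim_k V_i)z^i$. *)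

(* Defs.v *)
From HB Require Import structures.
From mathcomp Require Import all_boot all_order all_algebra.
From mathcomp Require Import finmap boolp classical_sets functions cardinality fsbigop.
From mathcomp Require Import constructive_ereal.

Set Implicit Arguments.
Unset Strict Implicit.
Unset Printing Implicit Defensive.

Import Order.TTheory GRing.Theory Num.Theory.
Local Open Scope ring_scope.

(* V is the (internal) direct sum of its additive subgroups G i. *)
Definition direct_sum (I : choiceType) (V : zmodType) (G : I -> {pred V}) :=
  (forall i, GRing.zmod_closed (G i)) /\
  forall v : V, exists! c : I -> V,
    [/\ forall i, c i \in G i,
        finite_set [set i | c i != 0]%classic
      & v = \sum_(i \in [set: I]%classic) c i].

(* The homogeneous components are k-subspaces by cg_mul and cg_conn, because
   c *: x = c%:A * x. *)
Record cgAlg (k : fieldType) := CGAlg {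
  cg_sort :> algType k;
  cg_comp : nat -> {pred cg_sort};
  cg_dec : direct_sum cg_comp;
  cg_mul : forall i j a b,
    a \in cg_comp i -> b \in cg_comp j -> a * b \in cg_comp (i + j)%N;
  cg_conn : forall a, a \in cg_comp 0 <-> exists c : k, a = c%:A }.

(* A right A-module is a left module over the converse ring A^c, so the
   product of x by a on the right is written (a : A^c) *: x.  It is a vector
   space over k through the scalars c%:A, and the homogeneous components are
   k-subspaces by gm_act with j = 0. *)
Record gMod (k : fieldType) (A : cgAlg k) := GMod {
  gm_sort :> lmodType A^c;
  gm_comp : int -> {pred gm_sort};
  gm_dec : direct_sum gm_comp;
  gm_act : forall (i : int) (j : nat) (x : gm_sort) (a : A),
    x \in gm_comp i -> a \in cg_comp j ->
    (a : A^c) *: x \in gm_comp (i + j%:Z) }.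

Section DirectSum.
Variables (I : choiceType) (V : zmodType) (G : I -> {pred V}).
Hypothesis dG : direct_sum G.

Definition hcomp (v : V) : I -> V := projT1 (cid (dG.2 v)).

Lemma hcompP v : [/\ forall i, hcomp v i \in G i,
  finite_set [set i | hcomp v i != 0]%classic
  & v = \sum_(i \in [set: I]%classic) hcomp v i].
Proof. by rewrite /hcomp; case: cid => c /= []. Qed.

Lemma hcomp_uniq v c : [/\ forall i, c i \in G i,
  finite_set [set i | c i != 0]%classic
  & v = \sum_(i \in [set: I]%classic) c i] -> hcomp v = c.
Proof. by rewrite /hcomp; case: cid => c' /= [_ +] cP; apply. Qed.

Lemma sum_finE (U : set I) (c : I -> V) : finite_set U ->
  ([set i | c i != 0] `<=` U)%classic ->
  \sum_(i \in [set: I]%classic) c i = \sum_(i <- fset_set U) c i.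
Proof.
move=> finU cU; apply: fsbigTE => i; rewrite in_fset_set// => /negP NUi.
by apply/eqP/negPn/negP => ci0; apply: NUi; apply/mem_set/cU.
Qed.

Lemma hcomp_hom i v : v \in G i ->
  hcomp v = fun j => if j == i then v else 0.
Proof.
move=> Gv; have ss : ([set j | (if j == i then v else 0) != 0] `<=` [set i])%classic.
  by move=> j /=; case: (eqVneq j i) => //= _; rewrite eqxx.
apply: hcomp_uniq; split.
- by move=> j; case: eqP => [->//|_]; case: (dG.1 j).
- exact: sub_finite_set ss _.
- by rewrite (sum_finE _ ss)// fset_set1 big_seq_fset1 eqxx.
Qed.

Lemma hcompD u v i : hcomp (u + v) i = hcomp u i + hcomp v i.
Proof.
have [uG fu eu] := hcompP u; have [vG fv ev] := hcompP v.
pose U := ([set j | hcomp u j != 0] `|` [set j | hcomp v j != 0])%classic.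
have finU : finite_set U by rewrite finite_setU.
have ss : ([set j | hcomp u j + hcomp v j != 0] `<=` U)%classic.
  move=> j /= uv0; case: (eqVneq (hcomp u j) 0) => [u0|]; [right|by left].
  by rewrite u0 add0r in uv0.
rewrite (@hcomp_uniq _ (fun j => hcomp u j + hcomp v j))//; split.
- by move=> j; have [_] := GRing.zmod_closedD (dG.1 j); apply.
- exact: sub_finite_set ss _.
- rewrite (sum_finE finU ss) big_split/= {1}eu {1}ev.
  by rewrite !(sum_finE finU)// => j ?; [right|left].
Qed.

Lemma hom_ind (P : V -> Prop) : P 0 -> (forall u v, P u -> P v -> P (u + v)) ->
  (forall i v, v \in G i -> P v) -> forall v, P v.
Proof.
move=> P0 PD PG v; have [vG fv ->] := hcompP v.
by rewrite (sum_finE fv)//; apply: big_ind => // i _; apply: PG (vG i).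
Qed.

End DirectSum.

Section Augmentation.
Variables (k : fieldType) (A : cgAlg k).

Lemma cg_comp0 (a : A) : exists c : k, hcomp (cg_dec A) a 0 = c%:A.
Proof. by apply/cg_conn; case: (hcompP (cg_dec A) a). Qed.

Definition aug (a : A) : k := projT1 (cid (cg_comp0 a)).

Lemma augP a : hcomp (cg_dec A) a 0 = (aug a)%:A.
Proof. by rewrite /aug; case: cid. Qed.

Lemma aug_uniq a c : hcomp (cg_dec A) a 0 = c%:A -> aug a = c.
Proof.
rewrite augP => /eqP; rewrite -subr_eq0 -scalerBl scaler_eq0 oner_eq0 orbF.
by rewrite subr_eq0 => /eqP.
Qed.

Lemma augD : {morph aug : a b / a + b}.
Proof. by move=> a b; apply: aug_uniq; rewrite hcompD !augP scalerDl. Qed.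

Lemma aug1 : aug 1 = 1.
Proof.
apply: aug_uniq; rewrite (@hcomp_hom _ _ _ _ 0%N) ?eqxx ?scale1r//.
by apply/cg_conn; exists 1; rewrite scale1r.
Qed.

Lemma augM : {morph aug : a b / a * b}.
Proof.
have aug0 : aug 0 = 0 by apply: (@addrI _ (aug 0)); rewrite -augD !addr0.
have augp i a : a \in @cg_comp _ A i.+1 -> aug a = 0.
  by move=> ai; apply: aug_uniq; rewrite (hcomp_hom _ ai) scale0r.
move=> + b; apply: (hom_ind (cg_dec A)); first by rewrite mul0r aug0 mul0r.
  by move=> a1 a2 e1 e2; rewrite mulrDl !augD e1 e2 mulrDl.
move=> i a ai; move: b; apply: (hom_ind (cg_dec A)).
- by rewrite mulr0 aug0 mulr0.
- by move=> b1 b2 e1 e2; rewrite mulrDr !augD e1 e2 mulrDr.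
move=> j b bj; have abij := cg_mul ai bj.
case: i j ai bj abij => [|i] [|j] ai bj abij;
  rewrite ?(augp _ _ abij) ?(augp _ _ ai) ?(augp _ _ bj) ?mul0r ?mulr0//.
apply: aug_uniq; rewrite (hcomp_hom _ abij) /=.
have := augP a; have := augP b; rewrite (hcomp_hom _ ai) (hcomp_hom _ bj) /=.
by move=> {1}-> {1}->; rewrite -scalerAl mul1r scalerA.
Qed.

End Augmentation.

(* The trivial right A-module k = A/A_+, concentrated in degree 0. *)
Definition triv (k : fieldType) (A : cgAlg k) : Type := k.

Section Trivial.
Variables (k : fieldType) (A : cgAlg k).

HB.instance Definition _ := GRing.Zmodule.copy (triv A) k.

Definition triv_act (a : A^c) (x : triv A) : triv A := (x : k) * aug (a : A).

Lemma triv_actA a b x : triv_act a (triv_act b x) = triv_act (a * b) x.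
Proof. by rewrite /triv_act [a * b]/(_ * _) /= augM mulrA. Qed.

Lemma triv_act1 : left_id 1 triv_act.
Proof. by move=> x; rewrite /triv_act aug1 mulr1. Qed.

Lemma triv_actDr : right_distributive triv_act +%R.
Proof. by move=> a x y; rewrite /triv_act mulrDl. Qed.

Lemma triv_actDl x : {morph triv_act^~ x : a b / a + b}.
Proof. by move=> a b; rewrite /triv_act augD mulrDr. Qed.

HB.instance Definition _ := GRing.Zmodule_isLmodule.Build A^c (triv A)
  triv_actA triv_act1 triv_actDr triv_actDl.

Definition triv_comp (i : int) : {pred triv A} :=
  fun x => (i == 0) || (x == 0).

Lemma triv_compE i x : (x \in triv_comp i) = (i == 0) || (x == 0).
Proof. by []. Qed.

Lemma triv_dec : direct_sum triv_comp.
Proof.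
split=> [i|v].
  split=> [|x y]; rewrite !triv_compE; case: (i == 0) => //=; rewrite ?eqxx//.
  by move=> /eqP-> /eqP->; rewrite subr0.
have sumE (c : int -> triv A) : (forall i, c i \in triv_comp i) ->
    \sum_(i \in [set: int]%classic) c i = c 0.
  move=> cP; rewrite (@sum_finE _ _ [set 0]%classic)//.
    by rewrite fset_set1 big_seq_fset1.
  by move=> i /= ci0; have := cP i; rewrite triv_compE (negPf ci0) orbF => /eqP.
exists (fun i => if i == 0 then v else 0); split; first split.
- by move=> i; rewrite triv_compE; case: eqP => //= _; rewrite eqxx.
- apply: (@sub_finite_set _ _ [set 0]%classic) => // i /=.
  by case: (i == 0) /eqP => //= _; rewrite eqxx.
- by rewrite sumE => [|i]; rewrite ?eqxx// triv_compE; case: eqP => //= _; rewrite eqxx.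
move=> c [cP _ ->]; rewrite sumE//; apply/funext => i.
by have := cP i; rewrite triv_compE; case: eqP => [->//|_ /= /eqP].
Qed.

Lemma triv_gr (i : int) (j : nat) (x : triv A) (a : A) :
  x \in triv_comp i -> a \in @cg_comp _ A j ->
  (a : A^c) *: x \in triv_comp (i + j%:Z).
Proof.
rewrite !triv_compE => /orP[/eqP-> | /eqP->] aj; last by rewrite scaler0 eqxx orbT.
case: j aj => [//|j] aj; apply/orP; right.
have -> : (a : A^c) *: x = triv_act a x by [].
rewrite /triv_act (_ : aug a = 0) ?mulr0//.
by apply: aug_uniq; rewrite (hcomp_hom _ aj) scale0r.
Qed.

Definition triv_mod : gMod A := GMod triv_dec triv_gr.

End Trivial.

(* The elements of M A_+, where A_+ is the augmentation ideal. *)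
Definition in_MAplus (k : fieldType) (A : cgAlg k) (M : gMod A) (x : M) :=
  exists (n : nat) (y : 'I_n -> M) (a : 'I_n -> A),
    (forall i, aug (a i) = 0) /\ x = \sum_(i < n) (a i : A^c) *: y i.

(* F has a homogeneous basis. *)
Definition graded_free (k : fieldType) (A : cgAlg k) (F : gMod A) :=
  exists (I : choiceType) (e : I -> F),
    (forall i, exists j, e i \in gm_comp j) /\
    forall x : F, exists! c : I -> A^c,
      finite_set [set i | c i != 0]%classic /\
      x = \sum_(i \in [set: I]%classic) c i *: e i.

Definition graded_map (k : fieldType) (A : cgAlg k) (M N : gMod A)
    (f : M -> N) :=
  forall j x, x \in gm_comp j -> f x \in gm_comp j.

Record resolution (k : fieldType) (A : cgAlg k) (M : gMod A) := Resolution {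
  res_mod :> nat -> gMod A;
  res_d : forall i, {linear res_mod i.+1 -> res_mod i};
  res_aug : {linear res_mod 0%N -> M};
  res_free : forall i, graded_free (res_mod i);
  res_d_graded : forall i, graded_map (res_d i);
  res_aug_graded : graded_map res_aug;
  res_aug_surj : forall x, exists y, res_aug y = x;
  res_exact0 : forall x, res_aug x = 0 <-> exists y, res_d 0 y = x;
  res_exactS : forall i x,
    res_d i x = 0 <-> exists y, res_d i.+1 y = x }.

(* Tor_i(M, k) is the i-th homology of the complex P (x)_A k, for any graded
   free resolution P of M.  Since k = A/A_+, the term P_i (x)_A k is
   P_i / P_i A_+; its elements are given below by representatives in P_i. *)
Definition tor_cycle (k : fieldType) (A : cgAlg k) (M : gMod A)
    (P : resolution M) (i : nat) : P i -> Prop :=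
  match i return P i -> Prop with
  | 0 => fun _ => True
  | i'.+1 => fun z => in_MAplus (res_d P i' z)
  end.

Definition tor_boundary (k : fieldType) (A : cgAlg k) (M : gMod A)
    (P : resolution M) (i : nat) (z : P i) :=
  exists y : P i.+1, in_MAplus (z - res_d P i y).

(* Tor_i(M, k)_j <> 0.  The resolution is arbitrary: Tor does not depend on
   it. *)
Definition tor_neq0 (k : fieldType) (A : cgAlg k) (M : gMod A) (i : nat)
    (j : int) :=
  exists (P : resolution M) (z : P i),
    [/\ z \in gm_comp j, tor_cycle z & ~ tor_boundary z].

(* The value is in \bar int, so that the supremum always exists; supremum 0
   sends the empty set to 0. *)
Definition m_mod (k : fieldType) (A : cgAlg k) (M : gMod A) (i : nat) :
    \bar int :=
  supremum 0%:E [set j%:E | j in [set j | tor_neq0 M i j]]%classic.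

Definition m_alg (k : fieldType) (A : cgAlg k) (i : nat) : \bar int :=
  m_mod (triv_mod A) i.

Definition at_most_gens_alg (k : fieldType) (A : cgAlg k) (n : int) :=
  exists s : seq A, (size s)%:Z <= n /\
    forall B : {pred A}, GRing.subalg_closed B -> {subset s <= B} ->
      forall a, a \in B.

Definition at_most_gens_mod (k : fieldType) (A : cgAlg k) (M : gMod A)
    (m : int) :=
  exists s : seq M, (size s)%:Z <= m /\
    forall N : {pred M}, GRing.submod_closed N -> {subset s <= N} ->
      forall x, x \in N.

(* The k-subspace W of V, whose scalar multiplication is sc, has dimension d. *)
Definition has_dim (k : fieldType) (V : zmodType) (sc : k -> V -> V)
    (W : {pred V}) (d : nat) :=
  exists b : 'I_d -> V, (forall i, b i \in W) /\
    forall v, v \in W -> exists! c : 'I_d -> k, v = \sum_(i < d) sc (c i) (b i).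

Definition is_hilb_alg (k : fieldType) (A : cgAlg k) (h : nat -> nat) :=
  forall i, has_dim (fun (c : k) (a : A) => c *: a) (@cg_comp k A i) (h i).

Definition is_hilb_mod (k : fieldType) (A : cgAlg k) (M : gMod A)
    (h : int -> nat) :=
  forall i, has_dim (fun (c : k) (x : M) => (c%:A : A^c) *: x)
    (@gm_comp k A M i) (h i).

Definition D (k : fieldType) (n a b c : int) (A : cgAlg k) :=
  [/\ at_most_gens_alg A n,
      (m_alg A 1 <= a%:E)%E, (m_alg A 2 <= b%:E)%E & (m_alg A 3 <= c%:E)%E].

Definition DM (k : fieldType) (n a b c m p1 p2 q r : int) (A : cgAlg k)
    (M : gMod A) :=
  [/\ D n a b c A,
      at_most_gens_mod M m,
      forall i x, i < p1 -> x \in @gm_comp k A M i -> x = 0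
    & [/\ (m_mod M 0 <= p2%:E)%E, (m_mod M 1 <= q%:E)%E
        & (m_mod M 2 <= r%:E)%E]].

(* Main.v *)
(* An algebra of D(n,a,b,c) has a presentation by generators and relations of
   bounded degrees, hence is a point of an affine space whose coordinates are the
   coefficients of the relations; the bound on Tor_3 says that the syzygies
   between the relations are generated in bounded degrees.

   If there were infinitely many Hilbert series, Hilbert's basis theorem would
   give an irreducible set T of points with infinitely many Hilbert series, each
   proper closed subset of T having only finitely many.  Hence one may discard
   the points of T at which the space of relations does not have its generic
   (maximal) dimension in each of the finitely many degrees in which syzygies are
   needed.  At a remaining point w these syzygies extend to polynomial families
   of syzygies around w.  As they generate all syzygies at w, in every degree the
   space of syzygies has at w a dimension at most the generic one, so that the
   space of relations has at least, and hence exactly, the generic dimension: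
   all the remaining points have the same Hilbert series.

   For the algebra itself, this is applied to the right module A_+, by induction
   on the degree; for modules, over algebras which are themselves generic. *)
Require Import Defs.
From HB Require Import structures.
From mathcomp Require Import all_boot all_order all_algebra.
From mathcomp Require Import finmap boolp classical_sets functions cardinality fsbigop.
From mathcomp Require Import constructive_ereal zify.

Set Implicit Arguments.
Unset Strict Implicit.
Unset Printing Implicit Defensive.

Import Order.TTheory GRing.Theory Num.Theory.
Local Open Scope ring_scope.
Local Open Scope classical_set_scope.

(** * Hilbert's basis theorem and polynomial functions *)

(** The points are the algebras and modules themselves: [y] attaches coordinates to them, and only
    polynomial functions of [y] on the points are considered, so the image of [y] is never
    described. All relations of degree at most [q], redundant ones included, serve as generators, so
    that the index sets are the same at every point; presentations need not be minimal because a
    bound on Tor is used only above the degrees of all generators.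

    The obstacle is that the base algebra varies too: the trivial relations of a module, [slots],
    are made of relations of the algebra and move with the point. Two properties therefore travel
    together: [liftable], which bounds dimensions from below nearby, and [max_at]. Relations lift at
    every point, being generated by regular families; syzygies are lifted only where the rank is
    maximal. The formula dim relations + dim syzygies = #terms + dim slots turns the bound on
    syzygies into an upper bound on relations, and is evaluated at a common point of two open sets,
    which is where irreducibility enters. *)

Section Noetherian.
Variable R : comNzRingType.

Definition in_ideal (s : seq R) (x : R) :=
  exists c : nat -> R, x = \sum_(i < size s) c i * s`_i.

Definition is_ideal (J : R -> Prop) :=
  J 0 /\ forall a x y, J x -> J y -> J (a * x + y).

Definition noetherian := forall J, is_ideal J ->
  exists s, (forall i, (i < size s)%N -> J s`_i) /\ forall x, J x -> in_ideal s x.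

Lemma ideal_sum (J : R -> Prop) (n : nat) (F : 'I_n -> R) :
  is_ideal J -> (forall i, J (F i)) -> J (\sum_i F i).
Proof.
move=> [J0 JD] JF; apply: big_ind => // x y Jx Jy.
by rewrite -[x]mul1r; apply: JD.
Qed.

Lemma idealM (J : R -> Prop) a x : is_ideal J -> J x -> J (a * x).
Proof. by move=> [J0 JD] Jx; rewrite -[_ * _]addr0; apply: JD. Qed.

Lemma in_ideal_min (J : R -> Prop) s x : is_ideal J ->
  (forall i, (i < size s)%N -> J s`_i) -> in_ideal s x -> J x.
Proof.
move=> iJ Js [c ->]; apply: ideal_sum => // i; apply: idealM => //.
exact: Js.
Qed.

Lemma in_ideal_ideal s : is_ideal (in_ideal s).
Proof.
split.
  by exists (fun=> 0); rewrite big1// => i _; rewrite mul0r.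
move=> a _ _ [c ->] [d ->]; exists (fun i => a * c i + d i).
rewrite mulr_sumr -big_split/=; apply: eq_bigr => i _.
by rewrite mulrDl mulrA.
Qed.

Lemma in_ideal_nth s i : (i < size s)%N -> in_ideal s s`_i.
Proof.
move=> si; exists (fun j => (j == i)%:R).
rewrite (bigD1 (Ordinal si))//= eqxx mul1r big1 ?addr0// => j /eqP ji.
by case: eqP => [e|]; rewrite ?mul0r//; case: ji; apply: val_inj.
Qed.

(** The ascending chain condition in the form used below: the union [J] of the ideals of the initial
    segments has finitely many generators, all present at some stage [N], so that [f N] brings
    nothing new. *)
Lemma noetherian_seq (f : nat -> R) : noetherian ->
  exists n, in_ideal (mkseq f n) (f n).
Proof.
move=> noR.
have sub m n x : (m <= n)%N -> in_ideal (mkseq f m) x -> in_ideal (mkseq f n) x.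
  move=> mn; apply: in_ideal_min (in_ideal_ideal _) _ => i.
  rewrite size_mkseq => im; rewrite nth_mkseq// -(nth_mkseq 0 f (leq_trans im mn)).
  by apply: in_ideal_nth; rewrite size_mkseq (leq_trans im mn).
pose J x := exists n, in_ideal (mkseq f n) x.
have iJ : is_ideal J.
  split; first by exists 0%N; have [] := in_ideal_ideal (mkseq f 0).
  move=> a x y [m xm] [n yn]; exists (maxn m n).
  by apply: (in_ideal_ideal _).2; [apply: sub xm|apply: sub yn];
    rewrite ?leq_maxl ?leq_maxr.
have [s [Js sJ]] := noR J iJ.
have [N HN] : exists N, forall i, (i < size s)%N -> in_ideal (mkseq f N) s`_i.
  have /choice[h hP] : forall i : 'I_(size s), exists n, in_ideal (mkseq f n) s`_i.
    by move=> i; apply: Js.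
  exists (\max_i h i) => i si; apply: sub (hP (Ordinal si)).
  exact: (leq_bigmax (F := h) (Ordinal si)).
exists N; apply: (@in_ideal_min (in_ideal (mkseq f N)) s) => //.
  exact: in_ideal_ideal.
apply: sJ; exists N.+1.
by rewrite -(nth_mkseq 0 f (ltnSn N)); apply: in_ideal_nth; rewrite size_mkseq.
Qed.

End Noetherian.

Lemma noetherian_field (k : fieldType) : noetherian k.
Proof.
move=> J iJ; case: (pselect (exists x, J x /\ x != 0)) => [[x [Jx x0]]|nJ].
  exists [:: x]; split=> [[]//|y Jy]; exists (fun=> y / x).
  by rewrite big_ord1/= divfK.
exists [::]; split=> // y Jy; exists (fun=> 0); rewrite big_ord0.
by apply/eqP/negPn/negP => y0; apply: nJ; exists y.
Qed.

(** Hilbert's argument: if [J] were not finitely generated, choose each [g n] of least degree in [J]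
    outside the ideal of the previous ones. Some leading coefficient is a combination of the earlier
    ones; cancelling it gives an element of smaller degree still outside that ideal. *)
Theorem hilbert_basis (R : comNzRingType) : noetherian R -> noetherian {poly R}.
Proof.
move=> noR J iJ; apply: contrapT => nfg.
have ex (s : seq {poly R}) : exists p : {poly R},
    (forall i, (i < size s)%N -> J s`_i) -> [/\ J p, ~ in_ideal s p &
      forall q, J q -> ~ in_ideal s q -> (size p <= size q)%N].
  case: (pselect (forall i, (i < size s)%N -> J s`_i)) => Js; last by exists 0.
  have /existsNP[p0 /not_implyP[Jp0 sp0]] : ~ forall x, J x -> in_ideal s x.
    by move=> H; apply: nfg; exists s.
  pose Q n := `[< exists p : {poly R}, [/\ J p, ~ in_ideal s p & size p = n] >].
  have exQ : exists n, Q n by exists (size p0); apply/asboolP; exists p0.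
  case: (ex_minnP exQ) => n /asboolP[p [Jp sp <-]] pmin.
  by exists p => _; split=> // q Jq sq; apply: pmin; apply/asboolP; exists q.
have {ex}[next nextP] := choice ex.
pose s n := iter n (fun s => rcons s (next s)) [::].
pose g n := next (s n).
have sE n : s n = mkseq g n.
  by elim: n => // n IH; rewrite mkseqS -IH.
have Jg n : J (g n).
  elim/ltn_ind: n => n IH; have [] // := nextP (s n).
  by move=> i; rewrite sE size_mkseq => ni; rewrite nth_mkseq//; apply: IH.
have Js n i : (i < size (s n))%N -> J (s n)`_i.
  by rewrite sE size_mkseq => ni; rewrite nth_mkseq.
have gmin n q : J q -> ~ in_ideal (s n) q -> (size (g n) <= size q)%N.
  by have [_ _] := nextP (s n) (@Js n); apply.
have gN n : ~ in_ideal (s n) (g n) by have [] := nextP (s n) (@Js n).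
have szg i n : (i <= n)%N -> (size (g i) <= size (g n))%N.
  move=> le_in; apply: gmin => // gi; apply: (gN n).
  apply: in_ideal_min (in_ideal_ideal _) _ gi => j.
  rewrite sE size_mkseq => ji; have jn := leq_trans ji le_in.
  rewrite nth_mkseq// -(nth_mkseq 0 g jn) -sE.
  by apply: in_ideal_nth; rewrite sE size_mkseq.
have [n [c]] := noetherian_seq (fun n => lead_coef (g n)) noR.
rewrite size_mkseq => lcE.
(* Each [g i] is raised to the degree of [g n]; by [szg] the subtraction of sizes is not
   truncated. *)
pose q := \sum_(i < n) ((c i)%:P * 'X^(size (g n) - size (g i))) * g i.
have sq : in_ideal (s n) q.
  exists (fun i => (c i)%:P * 'X^(size (g n) - size (g i))).
  rewrite /q [in RHS]sE size_mkseq; apply: eq_bigr => i _.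
  by rewrite nth_mkseq.
have Jq : J q by exact: in_ideal_min iJ (@Js n) sq.
have JD := iJ.2.
have gn0 : g n != 0.
  by apply/eqP => g0; apply: (gN n); rewrite g0; case: (in_ideal_ideal (s n)).
have /gmin : J (g n - q).
  by rewrite addrC -mulN1r; apply: JD.
have nq : ~ in_ideal (s n) (g n - q).
  move=> H; apply: (gN n); rewrite -(subrK q (g n)) -[g n - q]mul1r.
  by apply: (in_ideal_ideal _).2.
move=> /(_ n nq); apply/negP; rewrite -ltnNge.
have sz0 : (0 < size (g n))%N by rewrite size_poly_gt0.
have gi0 i : (0 < size (g i))%N.
  rewrite size_poly_gt0; apply/eqP => g0; apply: (gN i).
  by rewrite g0; case: (in_ideal_ideal (s i)).
rewrite -(prednK sz0) ltnS; apply/leq_sizeP => j; rewrite leq_eqVlt => /orP[/eqP<-|].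
  rewrite coefB -lead_coefE lcE coef_sum; apply/eqP; rewrite subr_eq0; apply/eqP.
  apply: eq_bigr => i _; rewrite nth_mkseq// -mulrA coefCM.
  rewrite coefXnM lead_coefE; congr (_ * _).
  have := szg i n (ltnW (ltn_ord i)); have := gi0 i; move: sz0.
  move: (size (g n)) (size (g i)) => a b a0 b0 ba.
  case: ifP => [|_]; first by lia. congr (_`_ _); lia.
rewrite prednK// => gj; rewrite coefB nth_default// sub0r coef_sum big1 ?oppr0// => i _.
rewrite -mulrA coefCM coefXnM; case: ifP => [_|/negbT]; rewrite ?mulr0//.
rewrite -leqNgt => le_j; rewrite nth_default ?mulr0//.
have := szg i n (ltnW (ltn_ord i)); move: gj; move: (size (g n)) (size (g i)) => a b; lia.
Qed.

(** [R] is the ring of polynomials in [n] variables, built by iterating [{poly _}], and [phi e] is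
    evaluation at the point [e]. *)
Lemma polynomial_functions (k : fieldType) (n : nat) :
  exists (R : comNzRingType) (phi : (nat -> k) -> {rmorphism R -> k}),
    [/\ noetherian R, forall c, exists r, forall e, phi e r = c &
        forall j, (j < n)%N -> exists r, forall e, phi e r = e j].
Proof.
elim: n => [|n [R [phi [noR phiC phiX]]]].
  exists k, (fun=> idfun); split=> //; first exact: noetherian_field.
  by move=> c; exists c.
exists {poly R}, (fun e => horner_eval (e n) \o map_poly (phi e)); split.
- exact: hilbert_basis.
- move=> c; have [r rE] := phiC c; exists r%:P => e.
  by rewrite /= map_polyC/= /horner_eval hornerC rE.
- move=> j; rewrite ltnS leq_eqVlt => /orP[/eqP->|/phiX[r rE]].
    by exists 'X => e; rewrite /= map_polyX /horner_eval hornerX.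
  by exists r%:P => e; rewrite /= map_polyC/= /horner_eval hornerC rE.
Qed.

(** * Regular functions and generic subsets *)

Section Regular.
Variables (k : fieldType) (Omega : Type) (C : finType) (y : Omega -> C -> k).

(** Polynomial functions of the coordinates, taken as functions on [Omega]; representing polynomials
    are chosen only in [regular_chain]. *)
Inductive regular : (Omega -> k) -> Prop :=
| regular_cst c : regular (fun=> c)
| regular_coord i : regular (fun w => y w i)
| regularD f g : regular f -> regular g -> regular (fun w => f w + g w)
| regularM f g : regular f -> regular g -> regular (fun w => f w * g w).

Lemma regular_sum (I : Type) (r : seq I) (P : pred I) (F : I -> Omega -> k) :
  (forall i, regular (F i)) -> regular (fun w => \sum_(i <- r | P i) F i w).
Proof.
move=> rF; elim: r => [|i r IH].
  by under eq_fun do rewrite big_nil; apply: regular_cst.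
under eq_fun do rewrite big_cons; case: (P i) => //.
exact: regularD.
Qed.

Lemma regular_prod (I : Type) (r : seq I) (P : pred I) (F : I -> Omega -> k) :
  (forall i, regular (F i)) -> regular (fun w => \prod_(i <- r | P i) F i w).
Proof.
move=> rF; elim: r => [|i r IH].
  by under eq_fun do rewrite big_nil; apply: regular_cst.
under eq_fun do rewrite big_cons; case: (P i) => //.
exact: regularM.
Qed.

Definition regular_mx m n (B : Omega -> 'M[k]_(m, n)) :=
  forall i j, regular (fun w => B w i j).

Lemma regular_mx_cst m n (B : 'M[k]_(m, n)) : regular_mx (fun=> B).
Proof. by move=> i j; apply: regular_cst. Qed.

Lemma regular_mxM m n p (B : Omega -> 'M[k]_(m, n)) (B' : Omega -> 'M[k]_(n, p)) :
  regular_mx B -> regular_mx B' -> regular_mx (fun w => B w *m B' w).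
Proof.
move=> rB rB' i j; under eq_fun do rewrite mxE.
by apply: regular_sum => l; apply: regularM.
Qed.

Lemma regular_det n (B : Omega -> 'M[k]_n) :
  regular_mx B -> regular (fun w => \det (B w)).
Proof.
move=> rB; apply: regular_sum => s; apply: regularM; first exact: regular_cst.
exact: regular_prod.
Qed.

Lemma regular_adj n (B : Omega -> 'M[k]_n) :
  regular_mx B -> regular_mx (fun w => \adj (B w)).
Proof.
move=> rB i j; under eq_fun do rewrite mxE.
apply: regularM; first exact: regular_cst.
apply: regular_det => i' j'; under eq_fun do rewrite !mxE.
exact: rB.
Qed.

(** Polynomials representing the [f n] live in a Noetherian ring, so one of them is a combination of
    the previous ones and vanishes wherever they do. *)
Lemma regular_chain (f : nat -> Omega -> k) : (forall n, regular (f n)) ->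
  exists n, forall w, (forall i, (i < n)%N -> f i w = 0) -> f n w = 0.
Proof.
move=> rf; have [R [phi [noR phiC phiX]]] := polynomial_functions k #|C|.
pose e w j := nth 0 [seq y w c | c : C] j.
have eE w c : e w (enum_rank c) = y w c.
  by rewrite /e (nth_map c) ?nth_enum_rank// -cardE ltn_ord.
have /choice[p pE] n : exists p, forall w, phi (e w) p = f n w.
  elim: {n}(f n) / (rf n) => [c|c|f1 f2 _ [p1 h1] _ [p2 h2]|f1 f2 _ [p1 h1] _ [p2 h2]].
  - by have [r rE] := phiC c; exists r.
  - by have [r rE] := phiX _ (ltn_ord (enum_rank c)); exists r => w; rewrite rE eE.
  - by exists (p1 + p2) => w; rewrite rmorphD /= h1 h2.
  - by exists (p1 * p2) => w; rewrite rmorphM /= h1 h2.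
have [n [c cE]] := noetherian_seq p noR.
exists n => w fw; rewrite -pE cE rmorph_sum/= big1// => i _.
have ni : (i < n)%N by have := ltn_ord i; rewrite {2}size_mkseq.
by rewrite rmorphM /= nth_mkseq// pE fw// mulr0.
Qed.

(* Subsets of [Omega] are predicates rather than [set Omega], because [Omega]
   will be a type of algebras, whose universe is too large for [set]. *)
Definition values (H : Type) (hs : Omega -> H) (T : Omega -> Prop) : set H :=
  fun h => exists2 w, T w & hs w = h.

(* Otherwise one could go on cutting down T by equations f_0 = 0, f_1 = 0, ...
   with f_n not in the ideal of f_0, ..., f_(n-1). *)
Theorem generic_infinite (H : Type) (hs : Omega -> H) (S : Omega -> Prop) :
  ~ finite_set (values hs S) ->
  exists T : Omega -> Prop, [/\ forall w, T w -> S w, ~ finite_set (values hs T) &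
    forall f, regular f -> (exists2 w, T w & f w != 0) ->
      finite_set (values hs (fun w => T w /\ f w = 0))].
Proof.
move=> infS; apply: contrapT => nT.
have step (T : Omega -> Prop) : exists f : Omega -> k,
    (forall w, T w -> S w) -> ~ finite_set (values hs T) ->
    [/\ regular f, exists2 w, T w & f w != 0 &
     ~ finite_set (values hs (fun w => T w /\ f w = 0))].
  case: (pselect ((forall w, T w -> S w) /\ ~ finite_set (values hs T))) => [[TS infT]|nn].
    have /existsNP[f /not_implyP[rf /not_implyP[fw inf]]] : ~ forall f, regular f ->
        (exists2 w, T w & f w != 0) -> finite_set (values hs (fun w => T w /\ f w = 0)).
      by move=> HT; apply: nT; exists T.
    by exists f.
  by exists (fun=> 0) => TS infT; case: nn.
have [next nextP] := choice step.
pose T n := iter n (fun (T : Omega -> Prop) w => T w /\ next T w = 0) S.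
have TP n : (forall w, T n w -> S w) /\ ~ finite_set (values hs (T n)).
  elim: n => [|n [TS infT]]; first by split.
  by have [_ _ ?] := nextP _ TS infT; split=> // w [/TS].
have T0 n w : T n w -> forall i, (i < n)%N -> next (T i) w = 0.
  elim: n => // n IH [Tw fw] i; rewrite ltnS leq_eqVlt => /orP[/eqP->//|].
  exact: IH.
have [n nP] : exists n, forall w, (forall i, (i < n)%N -> next (T i) w = 0) ->
    next (T n) w = 0.
  by apply: (@regular_chain (fun n => next (T n))) => n; case: (TP n) => TS /(nextP _ TS)[].
(* On [T n] the earlier functions vanish, hence so does [next (T n)], although it was chosen nonzero
   at the point [w] of [T n]. *)
have [TS infT] := TP n; have [_ [w Tw /eqP fw] _] := nextP _ TS infT.
by apply: fw; apply: nP; apply: T0.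
Qed.

End Regular.

(** * Generic behaviour of regular families of matrices *)

Section MatrixFacts.
Variable k : fieldType.

(** [L] and [R] undo Gaussian elimination and cut out an invertible block. Kept constant in a family
    [B w], they make the determinant of [L *m B w *m R] a single polynomial certifying a lower bound
    on the rank. *)
Lemma rank_factor m n (B : 'M[k]_(m, n)) :
  exists (L : 'M_(\rank B, m)) (R : 'M_(n, \rank B)), L *m B *m R = 1%:M.
Proof.
exists (pid_mx (\rank B) *m invmx (col_ebase B)), (invmx (row_ebase B) *m pid_mx (\rank B)).
rewrite -[X in _ *m X *m _](mulmx_ebase B) !mulmxA mulmxKV ?col_ebase_unit//.
rewrite -!mulmxA (mulmxA (row_ebase B)) mulmxV ?row_ebase_unit// mul1mx.
rewrite (pid_mx_id _ _ _ (rank_leq_col B)) (pid_mx_id _ _ _ (rank_leq_row B)) pid_mx_1//.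
Qed.

Definition subspace (V : lmodType k) (U : V -> Prop) :=
  U 0 /\ forall a u v, U u -> U v -> U (a *: u + v).

Lemma subspaceD (V : lmodType k) (U : V -> Prop) u v :
  subspace U -> U u -> U v -> U (u + v).
Proof. by move=> [_ UD] ? ?; rewrite -[u]scale1r; apply: UD. Qed.

Lemma subspaceZ (V : lmodType k) (U : V -> Prop) a u : subspace U -> U u -> U (a *: u).
Proof. by move=> [U0 UD] ?; rewrite -[_ *: _]addr0; apply: UD. Qed.

Lemma subspaceB (V : lmodType k) (U : V -> Prop) u v :
  subspace U -> U u -> U v -> U (u - v).
Proof. by move=> [_ UD] ? ?; rewrite addrC -scaleN1r; apply: UD. Qed.

Lemma subspace_sum (V : lmodType k) (U : V -> Prop) (I : Type) (r : seq I)
  (P : pred I) (F : I -> V) :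
  subspace U -> (forall i, P i -> U (F i)) -> U (\sum_(i <- r | P i) F i).
Proof.
by move=> sU UF; apply: big_ind => //; [case: sU|move=> *; apply: subspaceD].
Qed.

(** Take [B] of maximal rank among the matrices whose row space lies in [U]; adjoining a further
    vector of [U] would raise the rank. *)
Lemma subspace_mx n (U : 'rV[k]_n -> Prop) : subspace U ->
  exists B : 'M[k]_n, forall u, (u <= B)%MS <-> U u.
Proof.
move=> sU.
pose Q r := `[< exists B : 'M[k]_n, (forall u, (u <= B)%MS -> U u) /\ \rank B = r >].
have Q0 : exists r, Q r.
  exists 0%N; apply/asboolP; exists 0; rewrite mxrank0; split=> // u.
  by rewrite submx0 => /eqP->; case: sU.
have Qn r : Q r -> (r <= n)%N by move=> /asboolP[B [_ <-]]; apply: rank_leq_col.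
case: (ex_maxnP Q0 Qn) => r /asboolP[B [BU <-]] Bmax; exists B => u; split; first exact: BU.
move=> Uu; apply: contrapT => /negP uB.
have : Q (\rank (B + u)%MS).
  apply/asboolP; exists (B + u)%MS; split=> // v /sub_addsmxP[[v1 v2] /= ->].
  apply: subspaceD => //; first by apply: BU; apply: submxMl.
  by rewrite [v2]mx11_scalar mul_scalar_mx; apply: subspaceZ.
move=> /Bmax; apply/negP; rewrite -ltnNge; apply: rank_ltmx.
by rewrite ltmxE addsmxSl /= addsmx_sub submx_refl.
Qed.

End MatrixFacts.

Lemma fun_linE (k : fieldType) (X : Type) a (c d : X -> k^o) p :
  (a *: c + d) p = a * c p + d p.
Proof. by []. Qed.

(** * Dimensions of spaces of functions supported on a finite list *)

Section Vec.
Variables (k : fieldType) (X : choiceType) (s : seq X).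
Hypothesis us : uniq s.

(** Elements of a free module will be functions on all terms, those of one degree being supported on
    a finite list [s]; [vec] and [unvec] make matrix ranks available for them. *)
Definition vec (c : X -> k^o) : 'rV[k]_(size s) := \row_j c (tnth (in_tuple s) j).
Definition unvec (u : 'rV[k]_(size s)) : X -> k^o :=
  fun p => \sum_(j < size s) u 0 j * (tnth (in_tuple s) j == p)%:R.

Definition supp (c : X -> k^o) := forall p, p \notin s -> c p = 0.

Lemma supp_subspace : subspace supp.
Proof.
split=> [p _//|a u v su sv p ps].
by rewrite fun_linE su// sv// mulr0 addr0.
Qed.

Lemma vecD a c d : vec (a *: c + d) = a *: vec c + vec d.
Proof. by apply/rowP => j; rewrite !mxE. Qed.

Lemma vec0 : vec 0 = 0.
Proof. by apply/rowP => j; rewrite !mxE. Qed.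

Lemma unvecD a c d : unvec (a *: c + d) = a *: unvec c + unvec d.
Proof.
apply/funext => p; rewrite fun_linE /unvec mulr_sumr -big_split/=.
by apply: eq_bigr => j _; rewrite !mxE mulrDl mulrA.
Qed.

Lemma unvec0 : unvec 0 = 0.
Proof. by apply/funext => p; rewrite /unvec big1// => j _; rewrite mxE mul0r. Qed.

Lemma unvec_supp u : supp (unvec u).
Proof.
move=> p ps; rewrite /unvec big1// => j _; case: eqP => [e|]; rewrite ?mulr0//.
by rewrite -e mem_tnth in ps.
Qed.

Lemma unvecK u : vec (unvec u) = u.
Proof.
apply/rowP => j; rewrite mxE /unvec (bigD1 j)//= eqxx mulr1 big1 ?addr0// => i ij.
case: eqP => [/tuple_uniqP e|]; rewrite ?mulr0//.
by rewrite (e us) eqxx in ij.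
Qed.

Lemma vecK c : supp c -> unvec (vec c) = c.
Proof.
move=> sc; apply/funext => p; rewrite /unvec.
case: (boolP (p \in s)) => [/(tnthP (in_tuple s))[i ->]|ps].
  have := unvecK (vec c) => /rowP/(_ i); rewrite !mxE /unvec => e.
  by rewrite e.
rewrite (sc _ ps) big1// => j _; case: eqP => [e|]; rewrite ?mulr0//.
by rewrite -e mem_tnth in ps.
Qed.

Lemma mx_of_ex (U : (X -> k^o) -> Prop) : exists B : 'M[k]_(size s),
  subspace U -> forall u, (u <= B)%MS <-> U (unvec u).
Proof.
case: (pselect (subspace U)) => [[U0 UD]|nU]; last by exists 0.
have /subspace_mx[B BP] : subspace (fun u => U (unvec u)).
  by split=> [|a u v Uu Uv]; rewrite ?unvec0// unvecD; apply: UD.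
by exists B.
Qed.

(* Meaningless unless [U] is a subspace. *)
Definition mx_of U := projT1 (cid (mx_of_ex U)).
Definition pdim U := \rank (mx_of U).

Lemma mx_ofP U : subspace U -> forall u, (u <= mx_of U)%MS <-> U (unvec u).
Proof. by rewrite /mx_of; case: cid. Qed.

Lemma mx_of_vec U c : subspace U -> supp c -> U c <-> (vec c <= mx_of U)%MS.
Proof. by move=> sU sc; rewrite mx_ofP// vecK. Qed.

Lemma mx_of_row U i : subspace U -> U (unvec (row i (mx_of U))).
Proof. by move=> sU; apply/mx_ofP/row_sub. Qed.

Lemma mx_of_span U c : subspace U -> supp c -> U c ->
  exists a : 'I_(size s) -> k, c = \sum_i a i *: unvec (row i (mx_of U)).
Proof.
move=> sU sc /mx_of_vec-/(_ sU sc)/submxP[a aE]; exists (fun i => a 0 i).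
rewrite -[LHS]vecK// aE mulmx_sum_row.
apply: (big_rec2 (fun u c => unvec u = c)); first exact: unvec0.
by move=> i u v _ <-; rewrite unvecD.
Qed.

End Vec.

Section VecDim.
Variable k : fieldType.

Lemma pdim_rank (X : choiceType) (s : seq X) (U : (X -> k^o) -> Prop) m
    (B : 'M[k]_(m, size s)) : subspace U ->
  (forall u, (u <= B)%MS <-> U (unvec u)) -> \rank B = pdim s U.
Proof.
move=> sU BP; apply/eqP; rewrite eqn_leq; apply/andP; split; apply: mxrankS; apply/row_subP
    => i.
  by apply/mx_ofP => //; apply/BP; apply: row_sub.
by apply/BP/mx_ofP => //; apply: row_sub.
Qed.

Lemma pdim_le_inj (X X' : choiceType) (s : seq X) (s' : seq X')
    (us : uniq s) (us' : uniq s') (U : (X -> k^o) -> Prop) (U' : (X' -> k^o) -> Prop)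
    (h : (X -> k^o) -> (X' -> k^o)) : subspace U -> subspace U' ->
  (forall c, U c -> supp s c) -> (forall c, U' c -> supp s' c) ->
  (forall a u v, h (a *: u + v) = a *: h u + h v) ->
  (forall c, U c -> U' (h c)) -> (forall c, U c -> h c = 0 -> c = 0) ->
  (pdim s U <= pdim s' U')%N.
Proof.
move=> sU sU' Us Us' hL hU hI.
have h0 : h 0 = 0.
  have /eqP := hL 1 0 0; rewrite !scale1r addr0 -subr_eq subrr => /eqP<-//.
set B := row_base (mx_of s U).
pose G := \matrix_(i < \rank (mx_of s U)) vec s' (h (unvec (row i B))).
have UB u : U (unvec (u *m B)).
  by apply/mx_ofP => //; rewrite (submx_trans (submxMl _ _))// eq_row_base.
have GE u : vec s' (h (unvec (u *m B))) = u *m G.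
  rewrite !mulmx_sum_row.
  apply: (big_rec2 (fun (a : 'rV_(size s)) (b : 'rV_(size s')) => vec s' (h (unvec a)) = b)).
    by rewrite unvec0 h0 vec0.
  by move=> i a b _ <-; rewrite unvecD hL vecD rowK.
have fG : row_free G.
  apply: inj_row_free => v; rewrite -GE => v0.
  have /hI : h (unvec (v *m B)) = 0.
    by rewrite -[LHS](vecK us')//; [rewrite v0 unvec0|apply/Us'/hU].
  move=> /(_ (UB v)) /(congr1 (vec s)); rewrite unvecK// vec0 => vB.
  by apply: (row_free_inj (row_base_free _)); rewrite vB mul0mx.
rewrite /pdim -(eqnP fG); apply: mxrankS; apply/row_subP => i.
rewrite rowE -GE; apply/mx_ofP => //; rewrite vecK//.
  exact: hU.
by apply: Us'; apply: hU.
Qed.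

(** A basis of [U] is sent to part of a basis of [U']. Having a map rather than an inequality of
    numbers lets a bound for a direct sum be assembled from its summands, in [max_slots]. *)
Lemma pdim_le_ex (X X' : choiceType) (s : seq X) (s' : seq X')
    (us : uniq s) (us' : uniq s') (U : (X -> k^o) -> Prop) (U' : (X' -> k^o) -> Prop) :
  subspace U -> subspace U' -> (forall c, U c -> supp s c) ->
  (pdim s U <= pdim s' U')%N ->
  exists h : (X -> k^o) -> (X' -> k^o),
    [/\ forall a u v, h (a *: u + v) = a *: h u + h v,
       forall c, U c -> U' (h c) & forall c, U c -> h c = 0 -> c = 0].
Proof.
move=> sU sU' Us le_dim; set A := row_base (mx_of s U).
set B := row_base (mx_of s' U'); have /row_freeP[R AR] := row_base_free (mx_of s U).
(* [R] reads off coordinates in the basis [A] of [U]; [pid_mx] turns them into the first coordinates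
   in the basis [B] of [U']. *)
pose P := R *m pid_mx (\rank (mx_of s U)) *m B.
have UA c : U c -> exists v, vec s c = v *m A.
  by move=> Uc; apply/submxP; rewrite eq_row_base; apply/(mx_of_vec us sU (Us _ Uc)).
have PE : A *m P = pid_mx (\rank (mx_of s U)) *m B by rewrite /P !mulmxA AR mul1mx.
exists (fun c => unvec (vec s c *m P)); split.
- by move=> a u v; rewrite vecD mulmxDl -scalemxAl unvecD.
- move=> c /UA[v ->]; apply/mx_ofP => //; rewrite -mulmxA PE mulmxA.
  by rewrite (submx_trans (submxMl _ _))// eq_row_base.
move=> c Uc /(congr1 (vec s')); rewrite unvecK// vec0; have [v vE] := UA c Uc.
rewrite vE -mulmxA PE mulmxA => vB; rewrite -[c](vecK us (Us _ Uc)) vE.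
suff -> : v = 0 by rewrite mul0mx unvec0.
have v0 : v *m pid_mx (\rank (mx_of s U)) = 0 :> 'rV_(\rank (mx_of s' U')).
  by apply: (row_free_inj (row_base_free (mx_of s' U'))); rewrite vB mul0mx.
have := congr1 (mulmx^~ (pid_mx (\rank (mx_of s U)) : 'M_(_, \rank (mx_of s U)))) v0.
by rewrite mul0mx -mulmxA pid_mx_id// pid_mx_1 mulmx1.
Qed.

End VecDim.

Section Near.
Variables (k : fieldType) (Omega : Type) (C : finType) (y : Omega -> C -> k).
Variable T : Omega -> Prop.

Local Notation regular := (regular y).
Local Notation regular_mx := (regular_mx y).

(** Irreducibility in the Zariski topology: two nonempty principal open subsets of [T] meet. *)
Definition irreducible := forall f g, regular f -> regular g ->
  (exists2 w, T w & f w != 0) -> (exists2 w, T w & g w != 0) ->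
  exists2 w, T w & f w != 0 /\ g w != 0.

(* [P] holds on a principal Zariski neighbourhood of [w0] in [T]. *)
Definition near (w0 : Omega) (P : Omega -> Prop) :=
  exists f, [/\ regular f, f w0 != 0 & forall w, T w -> f w != 0 -> P w].

Lemma nearT w0 (P : Omega -> Prop) : (forall w, T w -> P w) -> near w0 P.
Proof. by move=> HP; exists (fun=> 1); split=> [||w Tw _]; rewrite ?oner_eq0//; [apply:
    regular_cst|apply: HP]. Qed.

Lemma near_sub w0 (P Q : Omega -> Prop) :
  (forall w, T w -> P w -> Q w) -> near w0 P -> near w0 Q.
Proof. by move=> PQ [f [rf f0 fP]]; exists f; split=> // w Tw /(fP _ Tw)/(PQ _ Tw). Qed.

Lemma nearI w0 (P Q : Omega -> Prop) : near w0 P -> near w0 Q ->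
  near w0 (fun w => P w /\ Q w).
Proof.
move=> [f [rf f0 fP]] [g [rg g0 gQ]]; exists (fun w => f w * g w); split.
- exact: regularM.
- by rewrite mulf_neq0.
- by move=> w Tw; rewrite mulf_eq0 => /norP[/(fP _ Tw)? /(gQ _ Tw)?].
Qed.

Lemma near_forall w0 (I : finType) (P : I -> Omega -> Prop) :
  (forall i, near w0 (P i)) -> near w0 (fun w => forall i, P i w).
Proof.
move=> nP; have : near w0 (fun w => forall i, i \in enum I -> P i w).
  elim: (enum I) => [|j r IH]; first exact: nearT.
  apply: near_sub (nearI (nP j) IH) => w _ [Pj Pr] i.
  by rewrite inE => /orP[/eqP->//|/Pr].
by apply: near_sub => w _ Pw i; apply: Pw; rewrite mem_enum.
Qed.

Lemma near_meet w0 w1 (P Q : Omega -> Prop) : irreducible -> T w0 -> T w1 ->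
  near w0 P -> near w1 Q -> exists w, [/\ T w, P w & Q w].
Proof.
move=> irr T0 T1 [f [rf f0 fP]] [g [rg g0 gQ]].
have [||w Tw [fw gw]] := irr f g rf rg; [by exists w0|by exists w1|].
by exists w; split=> //; [apply: fP|apply: gQ].
Qed.

(** Where its determinant does not vanish, [L *m B w *m R] is invertible of size [\rank (B w0)], and
    its rank is at most that of [B w]. *)
Lemma near_rank w0 m n (B : Omega -> 'M[k]_(m, n)) : regular_mx B ->
  near w0 (fun w => (\rank (B w0) <= \rank (B w))%N).
Proof.
move=> rB; have [L [R LR]] := rank_factor (B w0).
exists (fun w => \det (L *m B w *m R)); split.
- by apply: regular_det; do !apply: regular_mxM => //; apply: regular_mx_cst.
- by rewrite LR det1 oner_eq0.
move=> w Tw dw; have : L *m B w *m R \in unitmx by rewrite unitmxE unitfE.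
rewrite -row_free_unit => /eqnP <-.
by rewrite (leq_trans (mxrankM_maxl _ _))// mxrankM_maxr.
Qed.

(* With L *m B w0 *m R = 1, the rank bound forces the row space of B w to be
   that of L *m B w wherever det (L *m B w *m R) does not vanish, and Cramer's
   rule then corrects the constant vector u into a kernel vector. *)
Lemma near_kernel w0 m n (B : Omega -> 'M[k]_(m, n)) (u : 'rV[k]_m) :
  regular_mx B -> near w0 (fun w => (\rank (B w) <= \rank (B w0))%N) ->
  u *m B w0 = 0 ->
  exists s : Omega -> 'rV[k]_m,
    [/\ regular_mx s, s w0 = u & near w0 (fun w => s w *m B w = 0)].
Proof.
move=> rB rkB uB; have [L [R LR]] := rank_factor (B w0).
pose Q w := L *m B w *m R.
have rQ : regular_mx Q.
  by do !apply: regular_mxM => //; apply: regular_mx_cst.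
exists (fun w => (\det (Q w))%:M *m u - u *m B w *m R *m \adj (Q w) *m L); split.
- move=> i j; under eq_fun do rewrite mxE; apply: regularD.
    under eq_fun do rewrite mul_scalar_mx mxE.
    apply: regularM; [exact: regular_det|exact: regular_cst].
  under eq_fun do rewrite mxE -mulN1r; apply: regularM; first exact: regular_cst.
  have : regular_mx (fun w => u *m B w *m R *m \adj (Q w) *m L); last exact.
  do !apply: regular_mxM => //; try exact: regular_mx_cst.
  exact: regular_adj.
- by rewrite uB !mul0mx subr0 /Q LR det1 mul1mx.
have [f [rf f0 fP]] := rkB.
exists (fun w => f w * \det (Q w)); split.
- by apply: regularM => //; apply: regular_det.
- by rewrite /Q LR det1 mulr1.
move=> w Tw; rewrite mulf_eq0 => /norP[/(fP _ Tw) le_rk dw].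
have : Q w \in unitmx by rewrite unitmxE unitfE.
rewrite -row_free_unit => /eqnP rkQ.
have BL : (B w <= L *m B w)%MS.
  rewrite -(geq_leqif (mxrank_leqif_sup (submxMl _ _))) (leq_trans le_rk)//.
  by rewrite -[leqLHS]rkQ mxrankM_maxl.
have /submxP[v vE] : (u *m B w <= L *m B w)%MS by apply: submx_trans BL; apply: submxMl.
rewrite mulmxBl mul_scalar_mx -scalemxAl.
have -> : u *m B w *m R *m \adj (Q w) *m L *m B w
    = v *m (Q w *m \adj (Q w)) *m (L *m B w) by rewrite vE /Q !mulmxA.
by rewrite mul_mx_adj mul_mx_scalar -scalemxAl -vE subrr.
Qed.

End Near.

(** * Regular sections of families of subspaces, and syzygies *)

Section Lifts.
Variables (k : fieldType) (Omega : Type) (C : finType) (y : Omega -> C -> k).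
Variables (T : Omega -> Prop) (w0 : Omega).
Hypothesis Tw0 : T w0.

Local Notation regular := (regular y).
Local Notation near := (near y T w0).

Definition regular_fun (X : choiceType) (v : Omega -> X -> k^o) :=
  forall p, regular (fun w => v w p).

(** The section [v] is polynomial on all of [Omega] but lies in the family only near [w0], like the
    denominator-free sections of [near_kernel]. *)
Definition lifts (X : choiceType) (U : Omega -> (X -> k^o) -> Prop) (c : X -> k^o) :=
  exists v, [/\ regular_fun v, v w0 = c & near (fun w => U w (v w))].

Definition liftable (X : choiceType) (U : Omega -> (X -> k^o) -> Prop) :=
  forall c, U w0 c -> lifts U c.

Lemma regular_fun_lin (X : choiceType) a (u v : Omega -> X -> k^o) :
  regular_fun u -> regular_fun v -> regular_fun (fun w => a *: u w + v w).
Proof.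
move=> ru rv p; apply: (regularD (f := fun w => a * u w p)) => //.
by apply: regularM => //; apply: regular_cst.
Qed.

Lemma regular_fun_cst (X : choiceType) (c : X -> k^o) : regular_fun (fun=> c).
Proof. by move=> p; apply: regular_cst. Qed.

Lemma lifts_subspace (X : choiceType) (U : Omega -> (X -> k^o) -> Prop) :
  (forall w, T w -> subspace (U w)) -> subspace (lifts U).
Proof.
move=> sU; split.
  exists (fun=> 0); split=> //; first exact: regular_fun_cst.
  by apply: nearT => w Tw; case: (sU w Tw).
move=> a _ _ [u [ru <- nu]] [v [rv <- nv]].
exists (fun w => a *: u w + v w); split=> //; first exact: regular_fun_lin.
by apply: near_sub (nearI nu nv) => w Tw [Uu Uv]; apply: (sU w Tw).2.
Qed.

Lemma lifts_map (X X' : choiceType) (U : Omega -> (X -> k^o) -> Prop)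
    (U' : Omega -> (X' -> k^o) -> Prop) (h : (X -> k^o) -> X' -> k^o) c :
  (forall v, regular_fun v -> regular_fun (fun w => h (v w))) ->
  (forall w c, T w -> U w c -> U' w (h c)) ->
  lifts U c -> lifts U' (h c).
Proof.
move=> rh hU [v [rv <- nv]]; exists (fun w => h (v w)); split=> //; first exact: rh.
by apply: near_sub nv => w Tw; apply: hU.
Qed.

(** Liftability makes a dimension lower semicontinuous: lifts of a basis at [w0] stay independent
    nearby, by [near_rank]. *)
Lemma near_dim (X : choiceType) (s : seq X) (us : uniq s)
    (U : Omega -> (X -> k^o) -> Prop) :
  (forall w, T w -> subspace (U w)) -> (forall w c, T w -> U w c -> supp s c) ->
  liftable U -> near (fun w => (pdim s (U w0) <= pdim s (U w))%N).
Proof.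
move=> sU Us lU; pose B := row_base (mx_of s (U w0)).
have /choice[v vP] i : exists v, [/\ regular_fun v, v w0 = unvec (row i B) &
    near (fun w => U w (v w))].
  apply: lU; apply/mx_ofP => //; first exact: sU.
  by rewrite (submx_trans (row_sub _ _))// eq_row_base.
pose V w := \matrix_i vec s (v i w).
have rV : regular_mx y V.
  by move=> i j; under eq_fun do rewrite !mxE; case: (vP i).
have V0 : V w0 = B.
  by apply/row_matrixP => i; rewrite rowK; have [_ -> _] := vP i; rewrite unvecK.
have nV : near (fun w => forall i, U w (v i w)).
  by apply: near_forall => i; case: (vP i).
apply: near_sub (nearI (near_rank T w0 rV) nV) => w Tw [rk Uv] /=.
rewrite /pdim; apply: leq_trans (leq_trans rk _); first by rewrite V0 eq_row_base.
apply: mxrankS; apply/row_subP => i; rewrite rowK.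
exact: ((mx_of_vec us (sU w Tw) (Us _ _ Tw (Uv i))).1 (Uv i)).
Qed.

(* [N] and [Rel] are the trivial and the actual relations among generators;
   modulo [N], the family [r] spans [Rel], and [syz] is made of the relations
   among the [r q]. *)
Section Syzygies.
Variables (X1 X2 : choiceType) (s1 : seq X1) (s2 : seq X2).
Hypotheses (us1 : uniq s1) (us2 : uniq s2).
Variable r : X2 -> Omega -> X1 -> k^o.
Hypotheses (rr : forall q, regular_fun (r q)).
Hypothesis sr : forall q w, q \in s2 -> supp s1 (r q w).
Variables N Rel : Omega -> (X1 -> k^o) -> Prop.
Hypothesis sN : forall w, T w -> subspace (N w).
Hypothesis Ns : forall w c, T w -> N w c -> supp s1 c.

Definition comb w (a : X2 -> k^o) : X1 -> k^o := \sum_(q <- s2) a q *: r q w.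

Definition syz w a := supp s2 a /\ N w (comb w a).

Hypothesis RelP : forall w c, T w -> Rel w c <->
  exists a n, [/\ supp s2 a, N w n & c = comb w a + n].

Lemma comb_lin w b u v : comb w (b *: u + v) = b *: comb w u + comb w v.
Proof.
rewrite /comb scaler_sumr -big_split/=; apply: eq_bigr => q _.
by rewrite fun_linE scalerDl scalerA.
Qed.

Lemma comb0 w : comb w 0 = 0.
Proof. by rewrite /comb big1// => q _; rewrite scale0r. Qed.

Lemma syz_subspace w : T w -> subspace (syz w).
Proof.
move=> Tw; split; first by split; [case: (supp_subspace k s2)|rewrite comb0; case: (sN Tw)].
move=> a u v [su Nu] [sv Nv]; split; first exact: (supp_subspace k s2).2.
by rewrite comb_lin; apply: (sN Tw).2.
Qed.

Lemma Rel_subspace w : T w -> subspace (Rel w).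
Proof.
move=> Tw; split.
  apply/RelP => //; exists 0, 0; split; rewrite ?comb0 ?addr0//.
  by case: (sN Tw).
move=> a _ _ /(RelP _ Tw)[b [n [sb Nn ->]]] /(RelP _ Tw)[b' [n' [sb' Nn' ->]]].
apply/RelP => //; exists (a *: b + b'), (a *: n + n'); split.
- exact: (supp_subspace k s2).2.
- exact: (sN Tw).2.
- by rewrite comb_lin scalerDr addrACA.
Qed.

Let Phi w := \matrix_(i < size s2) vec s1 (r (tnth (in_tuple s2) i) w).

Let supp_comb w a : supp s1 (comb w a).
Proof.
rewrite /comb big_seq; apply: subspace_sum; first exact: supp_subspace.
by move=> q qs; apply: subspaceZ (supp_subspace _ _) _; apply: sr.
Qed.

Let vec_comb w a : vec s1 (comb w a) = vec s2 a *m Phi w.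
Proof.
rewrite mulmx_sum_row /comb (big_tnth _ _ s2).
apply: (big_rec2 (fun c u => vec s1 c = u)); first exact: vec0.
by move=> i u v _ <-; rewrite vecD rowK mxE.
Qed.

Lemma Rel_mx w (u : 'rV_(size s1)) : T w ->
  (u <= Phi w + mx_of s1 (N w))%MS <-> Rel w (unvec u).
Proof.
move=> Tw; split=> [/sub_addsmxP[[u1 u2] /= ->]|/(RelP _ Tw)[a [n [sa Nn e]]]].
  apply/RelP => //; exists (unvec u1), (unvec (u2 *m mx_of s1 (N w))); split.
  - exact: unvec_supp.
  - by apply/(mx_ofP (sN Tw)); exact: submxMl.
  - rewrite -[in LHS](unvecK us2 u1) -vec_comb.
    by rewrite -[vec s1 _]scale1r unvecD scale1r vecK.
rewrite -[u](unvecK us1) e -[comb w a]scale1r vecD scale1r addmx_sub_adds//.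
  by rewrite vec_comb submxMl.
exact: ((mx_of_vec us1 (sN Tw) (Ns Tw Nn)).1 Nn).
Qed.

(** Rank-nullity for the map sending [a] to [comb w a] modulo [N w]: its kernel is [syz w] and its
    image is [Rel w] modulo [N w]. *)
Lemma pdim_syz w : T w ->
  (pdim s2 (syz w) + pdim s1 (Rel w) = size s2 + pdim s1 (N w))%N.
Proof.
move=> Tw; set B := mx_of s1 (N w).
rewrite -(pdim_rank (Rel_subspace Tw) (fun u => @Rel_mx w u Tw)) -/B.
have <- : \rank (kermx (Phi w *m cokermx B)) = pdim s2 (syz w).
  apply: pdim_rank => //; first exact: syz_subspace.
  move=> u; rewrite sub_kermx mulmxA -submxE -{1}(unvecK us2 u) -vec_comb.
  have [NB BN] := mx_of_vec us1 (sN Tw) (@supp_comb w (unvec u)).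
  by split=> [/BN ?|[_ /NB]//]; split=> //; apply: unvec_supp.
(* The kernel of multiplication by [cokermx B] is the row space of [B], so this product computes
   ranks modulo [N w]. *)
have -> : (\rank (Phi w + B) = \rank (Phi w *m cokermx B) + \rank B)%N.
  rewrite -[LHS](mxrank_mul_ker _ (cokermx B)); congr (_ + _)%N.
    rewrite (eqmxMr _ (addsmxE _ _)) mul_col_mx (_ : B *m _ = 0); last first.
      by apply/eqP; rewrite -submxE.
    by rewrite -addsmxE addsmx0.
  apply/eqP; rewrite eqn_leq; apply/andP; split; apply: mxrankS.
    by rewrite submxE -sub_kermx capmxSr.
  by rewrite sub_capmx addsmxSr sub_kermx -submxE submx_refl.
rewrite mxrank_ker /pdim -/B; have := rank_leq_row (Phi w *m cokermx B); lia.
Qed.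

(* A syzygy at w0 is a kernel vector of the matrix whose rows span [Rel]; it
   lifts because the rank of this matrix is maximal at w0. *)
Lemma liftable_syz : liftable N ->
  (forall w, T w -> (pdim s1 (Rel w) <= pdim s1 (Rel w0))%N) -> liftable syz.
Proof.
move=> lN maxR a [sa Na]; set B := mx_of s1 (N w0).
have /choice[v vP] i : exists v, [/\ regular_fun v, v w0 = unvec (row i B) &
    near (fun w => N w (v w))].
  by apply: lN; apply: mx_of_row => //; apply: sN.
pose V w := \matrix_i vec s1 (v i w).
have V0 : V w0 = B.
  by apply/row_matrixP => i; rewrite rowK; have [_ -> _] := vP i; rewrite unvecK.
have nV : near (fun w => (V w <= mx_of s1 (N w))%MS).
  have : near (fun w => forall i, N w (v i w)).
    by apply: near_forall => i; case: (vP i).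
  apply: near_sub => w Tw Nv; apply/row_subP => i; rewrite rowK.
  exact: ((mx_of_vec us1 (sN Tw) (Ns Tw (Nv i))).1 (Nv i)).
pose G w := col_mx (Phi w) (V w).
have rG : regular_mx y G.
  move=> i j; under eq_fun do rewrite mxE; case: (fintype.split i) => i'.
    by under eq_fun do rewrite !mxE; apply: rr.
  by under eq_fun do rewrite !mxE; case: (vP i').
(* Near [w0] the rows of [G w] lie in [Rel w], and at [w0] they span [Rel w0], whose dimension is
   maximal. *)
have rkG : near (fun w => (\rank (G w) <= \rank (G w0))%N).
  apply: near_sub nV => w Tw VN; rewrite /G -!addsmxE V0.
  rewrite (pdim_rank (Rel_subspace Tw0) (fun u => @Rel_mx w0 u Tw0)).
  apply: leq_trans (maxR w Tw).
  rewrite -(pdim_rank (Rel_subspace Tw) (fun u => @Rel_mx w u Tw)).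
  by apply: mxrankS; apply: addsmxS.
have /submxP[b bE] : (vec s1 (comb w0 a) <= B)%MS.
  exact: ((mx_of_vec us1 (sN Tw0) (@supp_comb _ _)).1 Na).
(* Since [comb w0 a] is the combination of the rows of [V w0] with coefficients [b], the pair of [a]
   and [- b] is in the kernel of [G w0]; the left half of its lift is the required syzygy. *)
have [|S [rS S0 nS]] := near_kernel rG rkG (u := row_mx (vec s2 a) (- b)).
  by rewrite mul_row_col -vec_comb V0 mulNmx -bE subrr.
exists (fun w => unvec (lsubmx (S w))); split.
- move=> p; apply: regular_sum => j; apply: regularM; last exact: regular_cst.
  by under eq_fun do rewrite mxE; apply: rS.
- by rewrite S0 row_mxKl vecK.
apply: near_sub (nearI nV nS) => w Tw [VN SG]; split; first exact: unvec_supp.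
apply: (mx_of_vec us1 (sN Tw) (@supp_comb w _)).2.
rewrite vec_comb unvecK//; move: SG; rewrite -[S w]hsubmxK mul_row_col row_mxKl.
move/eqP; rewrite addr_eq0 => /eqP->; rewrite -mulNmx.
by rewrite (submx_trans (submxMl _ _)).
Qed.

End Syzygies.
End Lifts.

(** * Relations over a free algebra *)

Section Words.
Variables (L : finType) (deg : L -> nat).
Hypothesis deg_gt0 : forall l, (0 < deg l)%N.

Definition weight (w : seq L) := (\sum_(l <- w) deg l)%N.

Lemma weight_cons l w : weight (l :: w) = (deg l + weight w)%N.
Proof. by rewrite /weight big_cons. Qed.

Lemma weight_rcons w l : weight (rcons w l) = (weight w + deg l)%N.
Proof. by rewrite /weight big_rcons/= addnC. Qed.

Lemma weight_nil : weight [::] = 0%N.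
Proof. by rewrite /weight big_nil. Qed.

Lemma size_weight w : (size w <= weight w)%N.
Proof.
elim: w => // l w IH; rewrite weight_cons /=; have := deg_gt0 l; lia.
Qed.

Lemma weight_eq0 w : weight w = 0%N -> w = [::].
Proof. by move=> e; apply: size0nil; have := size_weight w; rewrite e; case: size. Qed.

(** Letters have positive degree, so enumerating the lengths up to [d] misses no word of weight
    [d]. *)
Definition words (d : nat) : seq (seq L) := undup [seq w <-
  flatten [seq [seq val t | t : n.-tuple L] | n <- iota 0 d.+1] | weight w == d].

Lemma mem_words (d : nat) w : (w \in words d) = (weight w == d).
Proof.
rewrite mem_undup mem_filter; case: eqP => // wd; rewrite andTb; apply/flatten_mapP.
exists (size w); first by rewrite mem_iota add0n ltnS -wd size_weight.
by apply/mapP; exists (in_tuple w); rewrite ?mem_enum.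
Qed.

Section Pairs.
Variables (G : finType) (f : G -> nat).

(* The pair (i, u) stands for the basis element e_i u of the free module over
   the free algebra. *)
Definition terms (d : nat) : seq (G * seq L) := undup [seq p <-
  [seq (i, w) | i <- enum G, w <- flatten [seq words e | e <- iota 0 d.+1]]
  | (f p.1 + weight p.2 == d)%N].

Lemma terms_uniq d : uniq (terms d).
Proof. exact: undup_uniq. Qed.

Lemma mem_terms (d : nat) p : (p \in terms d) = (f p.1 + weight p.2 == d)%N.
Proof.
rewrite mem_undup mem_filter; case: eqP => // pd; rewrite andTb.
case: p pd => i w pd; have {}pd : (f i + weight w = d)%N := pd.
apply: allpairs_f; first by rewrite mem_enum.
apply/flatten_mapP; exists (weight w); last by rewrite mem_words.
by rewrite mem_iota; lia.
Qed.

End Pairs.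

(** The free algebra is treated as a free module of rank one on a generator of degree 0. *)
Definition wterms (d : nat) := @terms unit (fun=> 0%N) d.

Section Shift.
Variables (k : fieldType) (G : Type).

(* Words are stored from right to left, so that right multiplication by a
   letter is a cons. *)
Definition shift l (c : G * seq L -> k^o) : G * seq L -> k^o :=
  fun p => if p.2 is l' :: u then if l' == l then c (p.1, u) else 0 else 0.

Definition shiftw (u : seq L) c := foldr shift c u.

Lemma shift_lin l a (u v : G * seq L -> k^o) :
  shift l (a *: u + v) = a *: shift l u + shift l v.
Proof.
apply/funext => p; rewrite [RHS]fun_linE /shift.
by case: p.2 => [|l' w]; last case: eqP => _; rewrite ?mulr0 ?addr0.
Qed.

Lemma shift0 l : shift l 0 = 0.
Proof. by apply/funext => -[i [|l' w]] //; rewrite /shift/=; case: eqP. Qed.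

Lemma shiftZ l a u : shift l (a *: u) = a *: shift l u.
Proof. by rewrite -[a *: u]addr0 shift_lin shift0 addr0. Qed.

Lemma shiftD l u v : shift l (u + v) = shift l u + shift l v.
Proof. by rewrite -{1}[u]scale1r shift_lin scale1r. Qed.

Lemma shift_sum l (I : Type) (r : seq I) (P : pred I) (F : I -> G * seq L -> k^o) :
  shift l (\sum_(i <- r | P i) F i) = \sum_(i <- r | P i) shift l (F i).
Proof. by apply: big_morph; [apply: shiftD|apply: shift0]. Qed.

End Shift.

Section Slot.
Variables (k : fieldType) (G : eqType).

Definition slot i (c : unit * seq L -> k^o) : G * seq L -> k^o :=
  fun p => if p.1 == i then c (tt, p.2) else 0.

Definition coef i (c : G * seq L -> k^o) : unit * seq L -> k^o := fun p => c (i, p.2).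

Lemma slot_lin i a (u v : unit * seq L -> k^o) :
  slot i (a *: u + v) = a *: slot i u + slot i v.
Proof.
apply/funext => p; rewrite [RHS]fun_linE /slot.
by case: eqP => _; rewrite ?mulr0 ?addr0.
Qed.

Lemma slot0 i : slot i 0 = 0.
Proof. by apply/funext => p; rewrite /slot; case: eqP. Qed.

Lemma coef_slot i c : coef i (slot i c) = c.
Proof. by apply/funext => -[[] u]; rewrite /coef /slot /= eqxx. Qed.

Lemma coef_slotN i j c : i != j -> coef i (slot j c) = 0.
Proof. by move=> /negPf ij; apply/funext => -[[] u]; rewrite /coef /slot /= ij. Qed.

End Slot.

Lemma slot_sum (k : fieldType) (G : finType) (c : G * seq L -> k^o) :
  c = \sum_i slot i (coef i c).
Proof.
apply/funext => -[i w]; rewrite fct_sumE (bigD1 i)//= /slot /= eqxx big1 ?addr0//.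
by move=> j ij; rewrite /slot; case: eqP => //= e; rewrite e eqxx in ij.
Qed.

Lemma supp_shift (k : fieldType) (G : finType) (f : G -> nat) (d : nat) l
    (c : G * seq L -> k^o) :
  supp (terms f d) c -> supp (terms f (d + deg l)) (shift l c).
Proof.
move=> sc [i [|l' w]] //=; rewrite mem_terms /shift /= weight_cons.
case: (eqVneq l' l) => // -> H; apply: sc; rewrite mem_terms /=; apply: contraNneq H => <-.
by apply/eqP; lia.
Qed.

(** [shift l c] vanishes off the terms whose list starts with [l], and prefixing [l] matches these
    with the terms of degree [d]. *)
Lemma sum_shift_terms (k : fieldType) (V : zmodType) (G : finType) (f : G -> nat) (d : nat) l
    (c : G * seq L -> k^o) (F : k -> G * seq L -> V) : (forall p, F 0 p = 0) ->
  \sum_(p <- terms f (d + deg l)) F (shift l c p) p =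
  \sum_(p <- terms f d) F (c p) (p.1, l :: p.2).
Proof.
move=> F0; pose g (p : G * seq L) := (p.1, l :: p.2).
rewrite (bigID (fun p => p \in [seq g p | p <- terms f d]))/= addrC big1_seq ?add0r.
  rewrite -big_filter (perm_big [seq g p | p <- terms f d]).
    by rewrite big_map; apply: eq_bigr => -[t u] _; rewrite {1}/shift /= eqxx.
  apply: uniq_perm; first by rewrite filter_uniq// terms_uniq.
    by rewrite map_inj_uniq ?terms_uniq// => -[t u] [t' u'] [-> ->].
  move=> p; rewrite mem_filter; case: (boolP (p \in map _ _)) => //= /mapP[[t u] pd ->].
  move: pd; rewrite !mem_terms /= weight_cons => /eqP <-.
  by apply/eqP; lia.
move=> [t u] /andP[pN]; rewrite mem_terms /= => pd.
rewrite /shift /=; case: u pN pd => [|l' u] pN pd; first by rewrite F0.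
case: (eqVneq l' l) => [e|]; last by rewrite F0.
rewrite e in pN pd; case/negP: pN; apply/mapP; exists (t, u) => //.
by rewrite mem_terms /=; move: pd; rewrite weight_cons => /eqP ?; apply/eqP; lia.
Qed.

End Words.

(** * Lifting and maximality of relations in a family *)

Section Family.
Variables (k : fieldType) (Omega : Type) (C : finType) (y : Omega -> C -> k).
Variable T : Omega -> Prop.
Hypothesis irr : irreducible y T.
Variables (L : finType) (deg : L -> nat).
Hypothesis deg_gt0 : forall l, (0 < deg l)%N.

Local Notation terms := (terms deg).
Local Notation liftable := (liftable y T).
Local Notation lifts := (lifts y T).
Local Notation words := (wterms deg).

Variable I : nat -> Omega -> (unit * seq L -> k^o) -> Prop.
Hypothesis sI : forall d w, T w -> subspace (I d w).
Hypothesis Is : forall d w c, T w -> I d w c -> supp (words d) c.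

Definition max_at (X : choiceType) (s : seq X) (U : Omega -> (X -> k^o) -> Prop) w0 :=
  forall w, T w -> (pdim s (U w) <= pdim s (U w0))%N.

Section Slots.
Variables (G : finType) (f : G -> nat).

(* The direct sum of the e_i I, where I is the ideal of relations of the
   algebra. *)
Definition slots d w (c : G * seq L -> k^o) :=
  supp (terms f d) c /\ forall i, (f i <= d)%N -> I (d - f i) w (coef i c).

Lemma slots_subspace d w : T w -> subspace (slots d w).
Proof.
move=> Tw; split.
  by split=> [|i _]; [case: (supp_subspace k (terms f d))|case: (sI (d - f i) Tw)].
move=> a u v [su Iu] [sv Iv]; split; first exact: (supp_subspace k (terms f d)).2.
by move=> i fd; apply: (sI (d - f i) Tw).2; [apply: Iu|apply: Iv].
Qed.

Lemma slots_slot d w i c : T w -> (f i <= d)%N -> I (d - f i) w c -> slots d w (slot i c).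
Proof.
move=> Tw fd Ic; split=> [[j u]|j _].
  rewrite (mem_terms deg_gt0) /slot /=; case: (eqVneq j i) => // -> H; apply: (Is Tw Ic).
  by rewrite (mem_terms deg_gt0) /=; lia.
case: (eqVneq j i) => [->|ji]; first by rewrite coef_slot.
by rewrite coef_slotN//; case: (sI (d - f j) Tw).
Qed.

Lemma coef_gt d i (c : G * seq L -> k^o) : supp (terms f d) c -> (d < f i)%N -> coef i c = 0.
Proof.
by move=> sc fd; apply/funext => -[[] u]; apply: sc; rewrite (mem_terms deg_gt0) /=; lia.
Qed.

Lemma liftable_slots d w0 : T w0 ->
  (forall i, (f i <= d)%N -> liftable w0 (I (d - f i))) -> liftable w0 (slots d).
Proof.
move=> Tw0 lI c [sc Ic].
have sL : subspace (lifts w0 (slots d)).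
  by apply: lifts_subspace => w; apply: slots_subspace.
rewrite (slot_sum c); apply: subspace_sum => //.
move=> i _; have [fd|fd] := leqP (f i) d; last first.
  by rewrite (coef_gt sc fd) slot0; case: sL.
apply: (lifts_map (h := slot i)) (lI i fd _ (Ic i fd)).
  move=> v rv [j u]; rewrite /slot /=; case: eqP => _; first exact: rv.
  exact: regular_cst.
by move=> w u Tw; apply: slots_slot.
Qed.

(** Injections of the pieces [I (d - f i)] at [w] into those at [w0] are glued, slot by slot, into
    an injection of the direct sums. *)
Lemma max_slots d w0 : T w0 ->
  (forall i, (f i <= d)%N -> max_at (words (d - f i)%N) (I (d - f i)) w0) ->
  max_at (terms f d) (slots d) w0.
Proof.
move=> Tw0 mI w Tw.
have /choice[h hP] i : exists h : (unit * seq L -> k^o) -> (unit * seq L -> k^o),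
    (f i <= d)%N -> [/\ forall a u v, h (a *: u + v) = a *: h u + h v,
       forall c, I (d - f i) w c -> I (d - f i) w0 (h c) &
       forall c, I (d - f i) w c -> h c = 0 -> c = 0].
  have [fd|fd] := leqP (f i) d; last by exists id => e; lia.
  have [|||h hP] := pdim_le_ex (terms_uniq _ _ _) (terms_uniq _ _ _) _ _ _ (mI i fd w Tw).
  - exact: sI.
  - exact: sI.
  - by move=> c; apply: Is.
  by exists h.
pose H c : G * seq L -> k^o := \sum_(i | (f i <= d)%N) slot i (h i (coef i c)).
have coefH j c : (f j <= d)%N -> coef j (H c) = h j (coef j c).
  move=> fd; apply/funext => -[[] u]; rewrite /coef /H fct_sumE (bigD1 j)//=.
  rewrite {1}/slot /= eqxx big1 ?addr0// => i /andP[_ /negPf ij].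
  by rewrite /slot /= eq_sym ij.
apply: (pdim_le_inj (terms_uniq _ _ _) (terms_uniq _ _ _) (h := H)).
- exact: slots_subspace.
- exact: slots_subspace.
- by move=> c [].
- by move=> c [].
- move=> a u v; rewrite /H scaler_sumr -big_split/=; apply: eq_bigr => i fd.
  have [hL _ _] := hP i fd.
  by rewrite (_ : coef i _ = a *: coef i u + coef i v)// hL slot_lin.
- move=> c [sc Ic]; apply: subspace_sum; first exact: slots_subspace.
  move=> i fd; apply: slots_slot => //; have [_ hI _] := hP i fd.
  by apply: hI; apply: Ic.
- move=> c [sc Ic] H0; rewrite (slot_sum c) big1// => i _.
  have [fd|fd] := leqP (f i) d; last by rewrite (coef_gt sc fd) slot0.
  have [_ _ hinj] := hP i fd; rewrite (hinj (coef i c)) ?slot0//; first exact: Ic.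
  by rewrite -coefH// H0; apply/funext.
Qed.

Hypothesis shiftI : forall d w l c, T w -> I d w c -> I (d + deg l) w (shift l c).

Lemma slots_shift d w l c : T w -> slots d w c -> slots (d + deg l) w (shift l c).
Proof.
move=> Tw [sc Ic]; split; first exact: supp_shift.
move=> i _; have -> : coef i (shift l c) = shift l (coef i c) by [].
have [fd|fd] := leqP (f i) d; last first.
  by rewrite (coef_gt sc fd) shift0; case: (sI (d + deg l - f i) Tw).
by rewrite -addnBAC//; apply: shiftI => //; apply: Ic.
Qed.

End Slots.

(** Subtraction is truncated, so a letter of degree larger than [d] would wrongly refer to degree 0;
    its coefficient is required to be zero instead. *)
Definition lower (X : Type) (U : nat -> (X -> k^o) -> Prop) d l c :=
  c = 0 \/ (deg l <= d)%N /\ U (d - deg l)%N c.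

(* Relations above degree [q] and syzygies above degree [s] come from lower
   degrees; this is all that is used of the bounds on Tor. *)
Section Relations.
Variables (G : finType) (f : G -> nat).
Variable Rel : nat -> Omega -> (G * seq L -> k^o) -> Prop.
Hypothesis sR : forall d w, T w -> subspace (Rel d w).
Hypothesis Rs : forall d w c, T w -> Rel d w c -> supp (terms f d) c.
Variables (G2 : finType) (f2 : G2 -> nat) (rho : G2 -> Omega -> G * seq L -> k^o).
Hypothesis rrho : forall t, regular_fun y (rho t).
Hypothesis srho : forall t w, supp (terms f (f2 t)) (rho t w).

Definition wrho (q : G2 * seq L) w := shiftw q.2 (rho q.1 w).
Local Notation combd d := (comb (terms f2 d) wrho).
Local Notation syzd d := (syz (terms f2 d) wrho (slots f d)).

(** With all generator degrees at least [m0], [slots] in degree [d] involves [I] only up to degree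
    [d - m0]. The value 1, used for the augmentation ideal, makes an induction on the degree
    possible; modules use 0. *)
Variables m0 q s : nat.
Hypothesis f_ge : forall i, (m0 <= f i)%N.
Hypothesis f2_ge : forall t, (m0 <= f2 t)%N.
Hypothesis shiftI : forall d w l c, T w -> I d w c -> I (d + deg l) w (shift l c).
Hypothesis Rel_rho : forall t w, T w -> Rel (f2 t) w (rho t w).
Hypothesis Rel_gen : forall d w c, T w -> (d <= q)%N -> Rel d w c ->
  exists a : G2 -> k, c = \sum_(t | f2 t == d) a t *: rho t w.
Hypothesis Rel_dec : forall d w c, T w -> (q < d)%N -> Rel d w c ->
  exists cl n, [/\ forall l, lower (fun e => Rel e w) d l (cl l), slots f d w n &
    c = \sum_l shift l (cl l) + n].
Hypothesis Rel_shift : forall d w l c, T w -> Rel d w c -> Rel (d + deg l) w (shift l c).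
Hypothesis Rel_slots : forall d w n, T w -> slots f d w n -> Rel d w n.
Hypothesis syz_dec : forall d w a, T w -> (s < d)%N -> syzd d w a ->
  exists al n, [/\ forall l, lower (fun e => syzd e w) d l (al l), slots f2 d w n &
    a = \sum_l shift l (al l) + n].
Hypothesis syz_slots : forall d w n, T w -> slots f2 d w n -> syzd d w n.

Lemma regular_shift (H : Type) l (v : Omega -> H * seq L -> k^o) :
  (forall p, regular y (fun w => v w p)) -> forall p, regular y (fun w => shift l (v w) p).
Proof.
move=> rv [i [|l' u]]; rewrite /shift /=; first exact: regular_cst.
by case: eqP => _; [apply: rv|apply: regular_cst].
Qed.

Lemma regular_wrho p : regular_fun y (wrho p).
Proof.
case: p => t u; rewrite /wrho /=; elim: u => [|l u IH]; first exact: rrho.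
exact: regular_shift.
Qed.

Lemma supp_wrho d p w : p \in terms f2 d -> supp (terms f d) (wrho p w).
Proof.
rewrite (mem_terms deg_gt0) => /eqP <-; case: p => t u; rewrite /wrho /=.
elim: u => [|l u IH]; first by rewrite weight_nil addn0; apply: srho.
by rewrite weight_cons addnCA addnC; apply: supp_shift.
Qed.

Lemma Rel_wrho d p w : T w -> p \in terms f2 d -> Rel d w (wrho p w).
Proof.
move=> Tw; rewrite (mem_terms deg_gt0) => /eqP <-; case: p => t u; rewrite /wrho /=.
elim: u => [|l u IH]; first by rewrite weight_nil addn0; apply: Rel_rho.
by rewrite weight_cons addnCA addnC; apply: Rel_shift.
Qed.

Lemma comb_shift d w l a : combd (d + deg l) w (shift l a) = shift l (combd d w a).
Proof.
rewrite [in RHS]/comb shift_sum [LHS]/comb.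
rewrite (@sum_shift_terms _ _ deg_gt0 _ _ _ f2 d l a (fun (b : k) p => b *: wrho p w)) => [|p].
  by apply: eq_bigr => p _; rewrite shiftZ.
exact: scale0r.
Qed.

Lemma syz_shift d w l a : T w -> syzd d w a -> syzd (d + deg l) w (shift l a).
Proof.
move=> Tw [sa Na]; split; first exact: supp_shift.
by rewrite comb_shift; apply: slots_shift.
Qed.

Lemma sub_syz d w : T w -> subspace (syzd d w).
Proof. by move=> Tw; apply: syz_subspace Tw => w'; apply: slots_subspace. Qed.

Definition gen_Rel d w c :=
  exists a n, [/\ supp (terms f2 d) a, slots f d w n & c = combd d w a + n].

Lemma gen_Rel_subspace d w : T w -> subspace (gen_Rel d w).
Proof.
move=> Tw; apply: (@Rel_subspace _ _ T _ _ (terms f2 d) wrho (slots f d)) => //.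
by move=> w'; apply: slots_subspace.
Qed.

Lemma comb_delta d w p : p \in terms f2 d ->
  combd d w (fun p' => (p' == p)%:R) = wrho p w.
Proof.
move=> pd; rewrite /comb (bigD1_seq p)//= ?terms_uniq// eqxx scale1r big1 ?addr0//.
by move=> p' /negPf->; rewrite scale0r.
Qed.

(** Induction on the degree: up to [q] the [rho] span, and above [q] a relation comes from lower
    degrees by [Rel_dec]. *)
Lemma RelP d w c : T w -> Rel d w c <-> gen_Rel d w c.
Proof.
move=> Tw; split; last first.
  move=> [a [n [sa Nn ->]]]; apply: subspaceD; [exact: sR| |exact: Rel_slots].
  rewrite /comb big_seq; apply: subspace_sum => [|p pd]; first exact: sR.
  by apply: subspaceZ; [exact: sR|exact: Rel_wrho].
elim/ltn_ind: d c => d IH c Rc; have sG := gen_Rel_subspace d Tw.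
have [dq|dq] := leqP d q.
  have [a ->] := Rel_gen Tw dq Rc; apply: subspace_sum => // t /eqP td.
  apply: subspaceZ => //; have td' : (t, [::]) \in terms f2 d.
    by rewrite (mem_terms deg_gt0) /= weight_nil addn0 td.
  exists (fun p => (p == (t, [::]))%:R), 0; split.
  - move=> p; case: eqP => [->|//]; by rewrite td'.
  - by case: (slots_subspace f d Tw).
  - by rewrite comb_delta// addr0.
have [cl [n [clR Nn ->]]] := Rel_dec Tw dq Rc.
apply: subspaceD => //; last first.
  by exists 0, n; split=> //; rewrite comb0 add0r.
apply: subspace_sum => // l _; case: (clR l) => [->|[ld]].
  by rewrite shift0; case: sG.
have ld' : (d - deg l < d)%N by have := deg_gt0 l; lia.
move=> /(IH _ ld')[a [n' [sa Nn' ->]]].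
rewrite -{1}(subnK ld); exists (shift l a), (shift l n'); split.
- exact: supp_shift.
- exact: slots_shift.
- by rewrite shiftD comb_shift.
Qed.

(** Each [rho t] is a regular family of relations through its own value at [w0], and lifts are
    inherited by shifts and by slots; hence this applies at every point of [T]. *)
Lemma liftable_Rel w0 d : T w0 ->
  (forall e, (e + m0 <= d)%N -> liftable w0 (I e)) -> liftable w0 (Rel d).
Proof.
move=> Tw0; elim/ltn_ind: d => d IH lI c Rc.
have sL : subspace (lifts w0 (Rel d)).
  by apply: lifts_subspace => w; apply: sR.
have [dq|dq] := leqP d q.
  have [a ->] := Rel_gen Tw0 dq Rc; apply: subspace_sum => // t /eqP td.
  apply: subspaceZ => //; exists (rho t); split=> //.
  by rewrite -td; apply: nearT => w; apply: Rel_rho.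
have [cl [n [clR Nn ->]]] := Rel_dec Tw0 dq Rc.
apply: subspaceD => //.
  apply: subspace_sum => // l _; case: (clR l) => [->|[ld Rl]].
    by rewrite shift0; case: sL.
  have ld' : (d - deg l < d)%N by have := deg_gt0 l; lia.
  have lR := IH _ ld' (fun e H => lI e (leq_trans H (leq_subr _ _))) _ Rl.
  apply: (lifts_map (h := shift l)) lR.
    by move=> v rv; apply: regular_shift.
  by move=> w u Tw Ru; rewrite -(subnK ld); apply: Rel_shift.
have lS : liftable w0 (slots f d).
  by apply: liftable_slots => // i fd; apply: lI; have := f_ge i; lia.
apply: (lifts_map (h := id)) (lS _ Nn) => // w u Tw.
exact: Rel_slots.
Qed.

(** Up to degree [s], a syzygy is lifted by maximality of the rank, through [liftable_syz]; above
    [s] it comes from lower syzygies, whose lifts are shifted. *)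
Lemma liftable_syz_Rel w0 d : T w0 ->
  (forall e, (e <= s)%N -> max_at (terms f e) (Rel e) w0) ->
  (forall e, (e + m0 <= d)%N -> liftable w0 (I e)) -> liftable w0 (syzd d).
Proof.
move=> Tw0 maxR; elim/ltn_ind: d => d IH lI.
have [ds|ds] := leqP d s.
  apply: (@liftable_syz _ _ _ _ _ _ Tw0 _ _ _ _ _ _ wrho _ _ (slots f d) (Rel d)).
  - exact: terms_uniq.
  - exact: terms_uniq.
  - by move=> p; apply: regular_wrho.
  - by move=> p w; apply: supp_wrho.
  - by move=> w; apply: slots_subspace.
  - by move=> w c _ [].
  - by move=> w c Tw; apply: RelP.
  - by apply: liftable_slots => // i fd; apply: lI; have := f_ge i; lia.
  - by move=> w; apply: maxR.
move=> a Za.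
have sL : subspace (lifts w0 (fun w => syzd d w)).
  by apply: lifts_subspace => w; apply: sub_syz.
have [al [n [alR Nn ->]]] := syz_dec Tw0 ds Za.
apply: subspaceD => //.
  apply: subspace_sum => // l _; case: (alR l) => [->|[ld Rl]].
    by rewrite shift0; case: sL.
  have ld' : (d - deg l < d)%N by have := deg_gt0 l; lia.
  have lR := IH _ ld' (fun e H => lI e (leq_trans H (leq_subr _ _))) _ Rl.
  apply: (lifts_map (h := shift l)) lR.
    by move=> v rv; apply: regular_shift.
  by move=> w u Tw Ru; rewrite -(subnK ld); apply: syz_shift.
have lS : liftable w0 (slots f2 d).
  by apply: liftable_slots => // i fd; apply: lI; have := f2_ge i; lia.
apply: (lifts_map (h := id)) (lS _ Nn) => // w u Tw.
exact: syz_slots.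
Qed.

(* dim Rel = #terms + dim slots - dim syz, where dim slots is maximal at w0 and
   dim syz is lower semicontinuous at w0. *)
Theorem max_Rel w0 d : T w0 ->
  (forall e, (e <= s)%N -> max_at (terms f e) (Rel e) w0) ->
  (forall e w, T w -> (e + m0 <= d)%N -> liftable w (I e)) ->
  (forall e, (e + m0 <= d)%N -> max_at (words e) (I e) w0) ->
  max_at (terms f d) (Rel d) w0.
Proof.
move=> Tw0 maxR lI maxI w1 Tw1.
have nR : near y T w1 (fun w => (pdim (terms f d) (Rel d w1) <= pdim (terms f d) (Rel d w))%N).
  apply: near_dim => //; first exact: terms_uniq.
  - by move=> w; apply: sR.
  - by move=> w c; apply: Rs.
  - by apply: liftable_Rel => // e; apply: lI.
have nZ : near y T w0 (fun w => (pdim (terms f2 d) (syzd d w0) <= pdim (terms f2 d) (syzd d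
    w))%N).
  apply: near_dim => //; first exact: terms_uniq.
  - by move=> w; apply: sub_syz.
  - by move=> w c _ [].
  - by apply: liftable_syz_Rel => // e; apply: lI.
(* At this common point there are at least as many relations as at [w1] and at least as many
   syzygies as at [w0]; the dimension formula at [w] and at [w0] then compares [w1] with [w0]. *)
have [w [Tw le_R le_Z]] := near_meet irr Tw1 Tw0 nR nZ.
have maxN : (pdim (terms f d) (slots f d w) <= pdim (terms f d) (slots f d w0))%N.
  by apply: max_slots => // i fd; apply: maxI; have := f_ge i; lia.
have dimE w' : T w' ->
    (pdim (terms f2 d) (syzd d w') + pdim (terms f d) (Rel d w') =
     size (terms f2 d) + pdim (terms f d) (slots f d w'))%N.
  apply: pdim_syz; rewrite ?terms_uniq//.
  - by move=> p w''; apply: supp_wrho.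
  - by move=> w''; apply: slots_subspace.
  - by move=> w'' c _ [].
  - by move=> w'' c; apply: RelP.
by have := dimE w Tw; have := dimE w0 Tw0; lia.
Qed.

End Relations.
End Family.

(** * Graded modules, free modules and resolutions *)

Section DirectSumFacts.
Variables (I : choiceType) (V : zmodType) (G : I -> {pred V}).

(** Free modules and kernels come with explicit projections onto their components, from which the
    grading is recovered here. *)
Lemma direct_sum_proj (pi : I -> V -> V) :
  (forall i, GRing.zmod_closed (G i)) -> (forall i v, pi i v \in G i) ->
  (forall i u v, pi i (u + v) = pi i u + pi i v) ->
  (forall i v, v \in G i -> pi i v = v) ->
  (forall i j v, v \in G i -> j != i -> pi j v = 0) ->
  (forall v, finite_set [set i | pi i v != 0]) ->
  (forall v, (forall i, pi i v = 0) -> v = 0) -> direct_sum G.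
Proof.
move=> G0 piG piD pi_id pi_0 pi_fin pi_inj; split=> // v.
have pi00 i : pi i 0 = 0 by apply: pi_id; case: (G0 i).
have pi_sum i (r : seq I) (c : I -> V) : uniq r -> (forall j, c j \in G j) ->
    pi i (\sum_(j <- r) c j) = if i \in r then c i else 0.
  move=> ur Gc; rewrite (big_morph _ (piD i) (pi00 i)).
  case: ifPn => ir; last first.
    rewrite big1_seq// => j /andP[_ jr]; apply: pi_0 (Gc j) _.
    by apply: contraNneq ir => ->.
  rewrite (bigD1_seq i)//= pi_id// big1 ?addr0// => j ji.
  by apply: pi_0 (Gc j) _; rewrite eq_sym.
have piE c : (forall i, c i \in G i) -> finite_set [set i | c i != 0] ->
    forall i, pi i (\sum_(i \in [set: I]) c i) = c i.
  move=> Gc fc i; rewrite (sum_finE fc)// pi_sum ?fset_uniq//.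
  rewrite in_fset_set//; case: ifPn => // /negP ic; apply/esym/eqP/negPn/negP => ci.
  by apply: ic; apply/mem_set.
exists (fun i => pi i v); split; last by move=> c [Gc fc ->]; apply/funext => i; apply: piE.
split=> //; apply/eqP; rewrite -subr_eq0; apply/eqP/pi_inj => i.
have piN u : pi i (- u) = - pi i u.
  by apply/eqP; rewrite -subr_eq0 opprK -piD addNr pi00.
by rewrite piD piN piE// subrr.
Qed.

Hypothesis dG : direct_sum G.

Lemma hcomp_in v i : hcomp dG v i \in G i.
Proof. by case: (hcompP dG v). Qed.

Lemma hcomp0 i : hcomp dG 0 i = 0.
Proof. by apply: (addrI (hcomp dG 0 i)); rewrite -hcompD !addr0. Qed.

Lemma hcomp_sum (J : Type) (r : seq J) (P : pred J) (F : J -> V) i :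
  hcomp dG (\sum_(j <- r | P j) F j) i = \sum_(j <- r | P j) hcomp dG (F j) i.
Proof. by apply: (big_morph (fun v => hcomp dG v i)) => [u v|]; rewrite ?hcompD ?hcomp0. Qed.

Lemma hcomp_fin v : finite_set [set i | hcomp dG v i != 0].
Proof. by case: (hcompP dG v). Qed.

Lemma hcomp_seq v : v = \sum_(i <- fset_set [set i | hcomp dG v i != 0]) hcomp dG v i.
Proof. by have [_ fv e] := hcompP dG v; rewrite {1}e (sum_finE fv). Qed.

Lemma hcomp_inj v : (forall i, hcomp dG v i = 0) -> v = 0.
Proof. by move=> v0; rewrite (hcomp_seq v) big1. Qed.

End DirectSumFacts.

Section FreeModule.
Variables (k : fieldType) (A : cgAlg k).

(** The grading of [A] is extended by zero to negative degrees: in a free module, the coordinate at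
    [i] of an element of degree [j] has degree [j - dg i], which may be negative. *)
Definition acomp (z : int) : {pred A} :=
  if z is Posz n then @cg_comp _ A n else pred1 0.

Definition ahcomp (z : int) (a : A) : A :=
  if z is Posz n then hcomp (cg_dec A) a n else 0.

Lemma acomp_zmod z : GRing.zmod_closed (acomp z).
Proof.
case: z => n; first exact: (cg_dec A).1.
by split=> [|x y]; rewrite !inE// => /eqP-> /eqP->; rewrite subr0.
Qed.

Lemma acomp_mul z j a b : a \in acomp z -> b \in @cg_comp _ A j -> a * b \in acomp (z + j%:Z).
Proof.
case: z => n; first exact: cg_mul.
by rewrite inE => /eqP-> _; rewrite mul0r; case: (acomp_zmod (Negz n + j)).
Qed.

Lemma ahcomp_in z a : ahcomp z a \in acomp z.
Proof. by case: z => n; rewrite /= ?inE//; apply: hcomp_in. Qed.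

Lemma ahcompD z a b : ahcomp z (a + b) = ahcomp z a + ahcomp z b.
Proof. by case: z => n /=; rewrite ?addr0//; apply: hcompD. Qed.

Lemma ahcomp_id z a : a \in acomp z -> ahcomp z a = a.
Proof.
case: z => n /=; last by rewrite inE => /eqP.
by move=> an; rewrite (hcomp_hom _ an) eqxx.
Qed.

Lemma ahcomp_neq z z' a : a \in acomp z -> z' != z -> ahcomp z' a = 0.
Proof.
case: z z' => n [] n' //=; last by rewrite inE => /eqP-> _; apply: hcomp0.
by move=> an; rewrite eqz_nat (hcomp_hom _ an) => /negPf->.
Qed.

Variables (I : choiceType) (dg : I -> int).

Local Notation fn := (I -> (A^c)^o).

Definition fin_supp : {pred fn} := fun f => `[< finite_set [set i | f i != 0] >].

Lemma fin_suppP (f : fn) : reflect (finite_set [set i | f i != 0]) (f \in fin_supp).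
Proof. exact: asboolP. Qed.

Lemma fin_supp_submod : GRing.submod_closed fin_supp.
Proof.
split.
  by apply/fin_suppP; rewrite (_ : [set _ | _] = set0)//; apply/seteqP; split=> i //=;
      rewrite eqxx.
move=> a f g /fin_suppP ff /fin_suppP fg; apply/fin_suppP.
apply: (@sub_finite_set _ _ ([set i | f i != 0] `|` [set i | g i != 0])).
  move=> i /= fgi; case: (eqVneq (f i) 0) => [f0|]; [right|by left].
  by move: fgi; rewrite -[(a *: f + g) i]/(a * f i + g i) f0 mulr0 add0r.
by rewrite finite_setU.
Qed.

HB.instance Definition _ := GRing.isSubmodClosed.Build _ fn fin_supp fin_supp_submod.

End FreeModule.

Record free (k : fieldType) (A : cgAlg k) (I : choiceType) (dg : I -> int) : Type :=
  Free { fval :> I -> (A^c)^o; fvalP : fval \in @fin_supp k A I }.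

Section FreeStruct.
Variables (k : fieldType) (A : cgAlg k) (I : choiceType) (dg : I -> int).
Local Notation free := (free A dg).

HB.instance Definition _ := [isSub of free for @fval k A I dg].
HB.instance Definition _ := [Choice of free by <:].
HB.instance Definition _ := [SubChoice_isSubLmodule of free by <:].

Lemma fvalD (x z : free) i : fval (x + z) i = fval x i + fval z i :> A.
Proof. by []. Qed.

Lemma fvalB (x z : free) i : fval (x - z) i = fval x i - fval z i :> A.
Proof. by []. Qed.

Lemma fvalZ (a : A^c) (x : free) i : fval (a *: x) i = (fval x i : A) * (a : A) :> A.
Proof. by []. Qed.

Lemma fval0 i : fval (0 : free) i = 0 :> A.
Proof. by []. Qed.

Lemma fval_fin (x : free) : finite_set [set i | x i != 0].
Proof. exact/fin_suppP/fvalP. Qed.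

Lemma free_ext (x z : free) : (forall i, fval x i = fval z i :> A) -> x = z.
Proof. by move=> e; apply: val_inj; apply/funext. Qed.

Definition free_comp (j : int) : {pred free} :=
  fun x => `[< forall i, x i \in @acomp _ A (j - dg i) >].

Lemma free_compP j (x : free) :
  reflect (forall i, x i \in @acomp _ A (j - dg i)) (x \in free_comp j).
Proof. exact: asboolP. Qed.

Lemma free_proj_fin (j : int) (x : free) :
  (fun i => ahcomp (j - dg i) (x i)) \in @fin_supp k A I.
Proof.
apply/fin_suppP; apply: sub_finite_set (fval_fin x) => i /=.
apply: contraNneq => ->; have := ahcompD (j - dg i) (0 : A) 0; rewrite addr0 => /eqP.
by rewrite -subr_eq0 opprD addNKr oppr_eq0.
Qed.

Definition free_proj j x : free := Free dg (free_proj_fin j x).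

Lemma free_projE j x i :
  fval (free_proj j x) i = ahcomp (j - dg i) (fval x i : A) :> A.
Proof. by []. Qed.

Lemma free_dec : direct_sum free_comp.
Proof.
apply: (direct_sum_proj (pi := free_proj)).
- move=> j; split=> [|x z /free_compP xj /free_compP zj]; apply/free_compP => i.
    by case: (acomp_zmod A (j - dg i)).
  by rewrite fvalB; apply: (acomp_zmod A (j - dg i)).2; [apply: xj|apply: zj].
- by move=> j x; apply/free_compP => i; rewrite free_projE; apply: ahcomp_in.
- by move=> j x z; apply: free_ext => i; rewrite fvalD !free_projE fvalD ahcompD.
- by move=> j x /free_compP xj; apply: free_ext => i; rewrite free_projE ahcomp_id.
- move=> j j' x /free_compP xj jj'; apply: free_ext => i.
  rewrite free_projE fval0; apply: ahcomp_neq (xj i) _.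
  by rewrite (inj_eq (addIr _)).
- move=> x.
  (* Only degrees [n + dg i] occur, with [i] in the support of [x] and [n] a degree of the
     coordinate [x i]. *)
  apply: (@sub_finite_set _ _ (\bigcup_(i in [set i | x i != 0])
      [set n%:Z + dg i | n in [set n | hcomp (cg_dec A) (x i) n != 0]])); last first.
    apply: bigcup_finite => [|i _]; first exact: fval_fin.
    by apply: finite_image; apply: hcomp_fin.
  move=> j /= /eqP pj; apply: contrapT => nU; apply: pj; apply: free_ext => i.
  rewrite free_projE fval0; case e: (j - dg i) => [n|//] /=.
  apply: contrapT => /eqP xn; apply: nU; exists i => /=.
    by apply: contraNneq xn => ->; rewrite hcomp0.
  by exists n => //; rewrite -e subrK.
- move=> x x0; apply: free_ext => i; apply: (hcomp_inj (dG := cg_dec A)) => n.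
  have := congr1 (fun z : free => z i) (x0 (n%:Z + dg i)).
  by rewrite /= /free_proj /= addrK.
Qed.

Lemma free_act (i : int) (j : nat) (x : free) (a : A) :
  x \in free_comp i -> a \in @cg_comp _ A j -> (a : A^c) *: x \in free_comp (i + j%:Z).
Proof.
move=> /free_compP xi aj; apply/free_compP => l.
by rewrite fvalZ addrAC; apply: acomp_mul.
Qed.

Definition free_mod : gMod A := GMod free_dec free_act.

Lemma free_basis_fin (i : I) : (fun j => (j == i)%:R) \in @fin_supp k A I.
Proof.
apply/fin_suppP; apply: (@sub_finite_set _ _ [set i]) => // j /=.
by case: (eqVneq j i) => //= _; rewrite eqxx.
Qed.

Definition free_basis i : free := Free dg (free_basis_fin i).

Lemma free_basisE i j : fval (free_basis i) j = (if j == i then 1 else 0) :> A.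
Proof. by rewrite /free_basis /=; case: eqP. Qed.

Lemma free_basis_hom i : free_basis i \in free_comp (dg i).
Proof.
apply/free_compP => j; rewrite free_basisE; case: eqP => [->|_].
  by rewrite subrr; apply/cg_conn; exists 1; rewrite scale1r.
by case: (acomp_zmod A (dg i - dg j)).
Qed.

Lemma free_sumE (c : I -> A^c) i : finite_set [set j | c j != 0] ->
  fval (\sum_(j \in [set: I]) c j *: free_basis j : free) i = c i :> A.
Proof.
move=> fc; rewrite (sum_finE fc) => [|j /=]; last first.
  by apply: contraNneq => ->; rewrite scale0r.
rewrite (big_morph (fun x : free => fval x i : A) (id1 := 0) (op1 := +%R))//.
have termE j : fval (c j *: free_basis j) i = if i == j then c j else 0 :> A.
  by rewrite fvalZ free_basisE; case: eqP; rewrite ?mul1r ?mul0r.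
under eq_bigr do rewrite termE.
rewrite -big_mkcond/=; case: (eqVneq (c i) 0) => [ci|ci].
  by rewrite big1 ?ci// => j /eqP <-.
rewrite -big_filter (_ : [seq j <- _ | i == j] = [:: i]) ?big_seq1//.
have ui := fset_uniq (fset_set [set j | c j != 0]).
rewrite (eq_filter (a2 := pred1 i)); last by move=> j /=; rewrite eq_sym.
by apply: filter_pred1_uniq => //; rewrite in_fset_set// inE.
Qed.

Lemma free_graded_free : graded_free free_mod.
Proof.
exists I, free_basis; split=> [i|x]; first by exists (dg i); apply: free_basis_hom.
exists (fval x); split.
  split; first exact: fval_fin.
  by apply: free_ext => i; rewrite free_sumE//; apply: fval_fin.
by move=> c [fc ->]; apply/funext => i; rewrite free_sumE.
Qed.

Section Lift.
Variables (M : gMod A) (g : I -> M).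

Definition free_map (x : free) : M := \sum_(i \in [set: I]) (x i : A^c) *: g i.

Lemma free_mapE (U : set I) (x : free) : finite_set U ->
  [set i | x i != 0] `<=` U -> free_map x = \sum_(i <- fset_set U) (x i : A^c) *: g i.
Proof.
move=> fU xU; apply: sum_finE => // i /= xi; apply: xU => /=.
by apply: contraNneq xi => ->; rewrite scale0r.
Qed.

Lemma free_map_linear : linear free_map.
Proof.
move=> a x z.
pose U := [set i | x i != 0] `|` [set i | z i != 0].
have fU : finite_set U by rewrite finite_setU; split; apply: fval_fin.
rewrite !(free_mapE fU) => [||i|i] /=; [|by right|by left|].
  rewrite scaler_sumr -big_split/=; apply: eq_bigr => i _.
  by rewrite scalerA -scalerDl; congr (_ *: _).
move=> axz; case: (eqVneq (x i) 0) => [xi|]; [right|by left].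
apply: contraNneq axz => zi; apply/eqP.
by transitivity (a * (fval x i : A^c) + (fval z i : A^c)); rewrite // xi zi mulr0 add0r.
Qed.

HB.instance Definition _ := GRing.isLinear.Build A^c free_mod M _ free_map free_map_linear.

Definition free_lin : {linear free_mod -> M} := free_map.

Lemma free_lin_basis i : free_lin (free_basis i) = g i.
Proof.
rewrite /free_lin /= (@free_mapE [set i])//.
  by rewrite fset_set1 big_seq_fset1 /= eqxx scale1r.
by move=> j /=; case: (eqVneq j i) => //= _; rewrite eqxx.
Qed.

Hypothesis gh : forall i, g i \in gm_comp (dg i).

Lemma free_lin_graded : graded_map free_lin.
Proof.
move=> j x /free_compP xj; rewrite /free_lin /= (free_mapE (fval_fin x))//.
have [M0 MB] := (gm_dec M).1 j.
have MD u v : u \in gm_comp j -> v \in gm_comp j -> u + v \in @gm_comp _ _ M j.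
  by have [_ H] := GRing.zmod_closedD ((gm_dec M).1 j); apply: H.
apply: (big_ind (fun u => u \in gm_comp j)) => // i _; have := xj i; case e: (j - dg i) =>
    [n|n] /=.
  move=> /(gm_act (gh i)); rewrite -e addrC subrK; exact.
by rewrite inE => /eqP->; rewrite scale0r.
Qed.

End Lift.

End FreeStruct.

Section Kernel.
Variables (k : fieldType) (A : cgAlg k) (M N : gMod A) (phi : {linear M -> N}).
Hypothesis gphi : graded_map phi.

Definition ker_pred : {pred M} := fun x => phi x == 0.

Lemma ker_submod : GRing.submod_closed ker_pred.
Proof.
split; rewrite /ker_pred; first by rewrite unfold_in linear0.
by move=> a x z; rewrite !unfold_in linearP => /eqP-> /eqP->; rewrite scaler0 addr0.
Qed.

HB.instance Definition _ := GRing.isSubmodClosed.Build _ M ker_pred ker_submod.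

Record ker : Type := Ker { kval :> M; kvalP : kval \in ker_pred }.

HB.instance Definition _ := [isSub of ker for kval].
HB.instance Definition _ := [Choice of ker by <:].
HB.instance Definition _ := [SubChoice_isSubLmodule of ker by <:].

(** The images of the components of [x] decompose [phi x], and such a decomposition is unique; hence
    kernels are graded. *)
Lemma graded_hcomp x j : phi (hcomp (gm_dec M) x j) = hcomp (gm_dec N) (phi x) j.
Proof.
apply/esym; move: j; apply/funeqP/hcomp_uniq; split.
- by move=> j; apply: gphi; apply: hcomp_in.
- apply: sub_finite_set (hcomp_fin (gm_dec M) x) => j /=.
  by apply: contraNneq => ->; rewrite linear0.
- rewrite (sum_finE (hcomp_fin (gm_dec M) x)) => [|j /=]; last first.
    by apply: contraNneq => ->; rewrite linear0.
  by rewrite -raddf_sum -hcomp_seq.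
Qed.

Lemma ker_proj_in (j : int) (x : ker) : hcomp (gm_dec M) (kval x) j \in ker_pred.
Proof.
by rewrite unfold_in graded_hcomp; have /eqP-> := kvalP x; rewrite hcomp0.
Qed.

Definition ker_comp (j : int) : {pred ker} := fun x => kval x \in gm_comp j.

Lemma ker_dec : direct_sum ker_comp.
Proof.
apply: (direct_sum_proj (pi := fun j x => Ker (ker_proj_in j x))).
- move=> j; have [M0 MB] := (gm_dec M).1 j; split; first exact: M0.
  by move=> x z; apply: MB.
- by move=> j x; apply: hcomp_in.
- by move=> j x z; apply: val_inj; apply: hcompD.
- by move=> j x xj; apply: val_inj; rewrite /= (@hcomp_hom _ _ _ (gm_dec M) j (kval x) xj)
    eqxx.
- by move=> j j' x xj /negPf jj'; apply: val_inj; rewrite /= (@hcomp_hom _ _ _ (gm_dec M) j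
    (kval x) xj) jj'.
- move=> x; apply: sub_finite_set (hcomp_fin (gm_dec M) (kval x)) => j /=.
  by apply: contraNneq => e; apply/eqP/val_inj.
- move=> x x0; apply: val_inj; apply: (hcomp_inj (dG := gm_dec M)) => j.
  by have := congr1 (@kval) (x0 j).
Qed.

Lemma ker_act (i : int) (j : nat) (x : ker) (a : A) :
  x \in ker_comp i -> a \in @cg_comp _ A j -> (a : A^c) *: x \in ker_comp (i + j%:Z).
Proof. exact: gm_act. Qed.

Definition ker_mod : gMod A := GMod ker_dec ker_act.

Lemma kval_linear : linear (kval : ker_mod -> M).
Proof. by []. Qed.

HB.instance Definition _ := GRing.isLinear.Build A^c ker_mod M _ kval kval_linear.

Definition kinc : {linear ker_mod -> M} := kval.

Lemma ker_phi (x : ker_mod) : phi (kinc x) = 0.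
Proof. exact/eqP/(kvalP x). Qed.

Lemma ker_ex x : phi x = 0 -> exists z : ker_mod, kinc z = x.
Proof. by move=> /eqP x0; exists (Ker x0). Qed.

Lemma kinc_inj : injective kinc.
Proof. exact: val_inj. Qed.

End Kernel.

Section Resolutions.
Variables (k : fieldType) (A : cgAlg k).

Section Cover.
Variable M : gMod A.

(** There is a basis element for every pair of a degree and an element; sending the ill-matched
    pairs to 0 keeps the cover graded without a dependent index type. *)
Definition cover_gen (p : int * M) : M := if p.2 \in gm_comp p.1 then p.2 else 0.

Definition cover_mod : gMod A := free_mod A (fun p : int * M => p.1).
Definition std_cover : {linear cover_mod -> M} := free_lin (fun p : int * M => p.1) cover_gen.

Lemma cover_graded : graded_map std_cover.
Proof.
apply: free_lin_graded => p; rewrite /cover_gen; case: ifP => // _.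
by case: ((gm_dec M).1 p.1).
Qed.

Lemma cover_hom j x : x \in gm_comp j -> exists2 z : cover_mod, z \in gm_comp j & std_cover
    z = x.
Proof.
move=> xj; exists (@free_basis _ A _ (fun p : int * M => p.1) (j, x)).
  exact: (@free_basis_hom _ A _ (fun p : int * M => p.1) (j, x)).
by rewrite free_lin_basis /cover_gen xj.
Qed.

Lemma cover_surj x : exists z, std_cover z = x.
Proof.
move: x; apply: (Defs.hom_ind (gm_dec M)).
- by exists 0; rewrite linear0.
- by move=> u v [z <-] [z' <-]; exists (z + z'); rewrite linearD.
- by move=> j x /cover_hom[z _ <-]; exists z.
Qed.

Definition syzygy : gMod A := ker_mod cover_graded.

End Cover.

Fixpoint iter_syzygy (M : gMod A) n := if n is n'.+1 then syzygy (iter_syzygy M n') else M.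

Definition canonical_d (M : gMod A) n :
  {linear cover_mod (iter_syzygy M n.+1) -> cover_mod (iter_syzygy M n)} :=
  kinc (@cover_graded (iter_syzygy M n)) \o std_cover (iter_syzygy M n.+1).

(** [tor_neq0] quantifies existentially over resolutions, so its negation carries information only
    once some resolution is exhibited. *)
Definition canonical_resolution (M : gMod A) : resolution M.
Proof.
apply: (@Resolution _ _ M (fun n => cover_mod (iter_syzygy M n)) (canonical_d M) (std_cover
    M)).
- by move=> i; apply: free_graded_free.
- by move=> i j x xj; apply: (cover_graded xj).
- exact: cover_graded.
- exact: cover_surj.
- move=> x; split=> [/(ker_ex (@cover_graded M))[z <-]|[z <-]].
    have [z' <-] := cover_surj (M := iter_syzygy M 1) z; by exists z'.
  exact: ker_phi.
- move=> i x; split=> [|[z <-]].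
    move=> xz; have /(ker_ex (@cover_graded _))[z <-] : std_cover (iter_syzygy M i.+1) x = 0.
      apply: (@kinc_inj _ _ _ _ _ (@cover_graded (iter_syzygy M i))).
      by rewrite linear0; apply: xz.
    by have [z' <-] := cover_surj (M := iter_syzygy M i.+2) z; exists z'.
  have e : std_cover (iter_syzygy M i.+1) (canonical_d M i.+1 z) = 0 by apply: ker_phi.
  transitivity (kinc (@cover_graded (iter_syzygy M i)) 0); last exact: linear0.
  by rewrite -e.
Defined.

End Resolutions.

Section Aug.
Variables (k : fieldType) (A : cgAlg k).

Lemma aug0 : aug (0 : A) = 0.
Proof. by apply: (@addrI _ (aug (0 : A))); rewrite -augD !addr0. Qed.

Lemma aug_pos n (a : A) : a \in @cg_comp _ A n -> (0 < n)%N -> aug a = 0.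
Proof.
by case: n => // n an _; apply: aug_uniq; rewrite (hcomp_hom _ an) scale0r.
Qed.

Variable M : gMod A.

Lemma in_MAplus0 : in_MAplus (0 : M).
Proof. by exists 0%N, (fun=> 0), (fun=> 0); rewrite big_ord0; split=> // -[]. Qed.

Lemma in_MAplusD (x z : M) : in_MAplus x -> in_MAplus z -> in_MAplus (x + z).
Proof.
move=> [n [y [a [a0 ->]]]] [n' [y' [a' [a'0 ->]]]].
exists (n + n')%N, (fun i => match fintype.split i with inl j => y j | inr j => y' j end),
  (fun i => match fintype.split i with inl j => a j | inr j => a' j end); split.
  by move=> i; case: (fintype.split i).
rewrite big_split_ord /=; congr (_ + _); apply: eq_bigr => i _.
  by rewrite (unsplitK (inl i)).
by rewrite (unsplitK (inr i)).
Qed.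

Lemma in_MAplusZ (a : A) (x : M) : aug a = 0 -> in_MAplus ((a : A^c) *: x).
Proof.
by move=> a0; exists 1%N, (fun=> x), (fun=> a); split=> //; rewrite big_ord1.
Qed.

Lemma in_MAplus_sum (I : Type) (r : seq I) (P : pred I) (F : I -> M) :
  (forall i, P i -> in_MAplus (F i)) -> in_MAplus (\sum_(i <- r | P i) F i).
Proof.
move=> PF; apply: (big_ind (@in_MAplus _ _ M)) => //; first exact: in_MAplus0.
exact: in_MAplusD.
Qed.

Lemma in_MAplus_map (N : gMod A) (phi : {linear M -> N}) x :
  in_MAplus x -> in_MAplus (phi x).
Proof.
move=> [n [y [a [a0 ->]]]]; exists n, (phi \o y), a; split=> //.
by rewrite raddf_sum; apply: eq_bigr => i _; apply: (linearZZ phi).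
Qed.

End Aug.

(** * Consequences of the vanishing of Tor *)

Section Tor.
Variables (k : fieldType) (A : cgAlg k).

Lemma free_decomp (I : choiceType) (dg : I -> int) (x : free_mod A dg) :
  x = \sum_(i \in [set: I]) (fval x i : A^c) *: (free_basis A dg i : free_mod A dg).
Proof. by apply: free_ext => i; rewrite free_sumE//; apply: fval_fin. Qed.

(** The coordinates of [x] have the positive degrees [j - dg i], hence augmentation 0. *)
Lemma free_MAplus (I : choiceType) (dg : I -> int) j (x : free_mod A dg) :
  (forall i, dg i < j) -> x \in gm_comp j -> in_MAplus x.
Proof.
move=> dgj /free_compP xj; rewrite [x]free_decomp (sum_finE (fval_fin x)); last first.
  by move=> i /=; apply: contraNneq => ->; rewrite scale0r.
apply: in_MAplus_sum => i _; apply: in_MAplusZ; have := xj i; have := dgj i.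
case e: (j - dg i) => [n|n] ij /=; last by rewrite inE => /eqP->; apply: aug0.
by move=> /aug_pos; apply; lia.
Qed.

(* A free cover [F] of [M] followed by a resolution of its kernel resolves [M]. *)
Section Splice.
Variables (F M : gMod A) (phi : {linear F -> M}).
Hypothesis gphi : graded_map phi.
Hypothesis phi_surj : forall x, exists y, phi y = x.
Hypothesis freeF : graded_free F.
Variable Q : resolution (ker_mod gphi).

Definition splice_mod n : gMod A := if n is n'.+1 then Q n' else F.

Definition splice_d n : {linear splice_mod n.+1 -> splice_mod n} :=
  match n return {linear splice_mod n.+1 -> splice_mod n} with
  | 0 => kinc gphi \o res_aug Q
  | n'.+1 => res_d Q n'
  end.

Definition splice : resolution M.
Proof.
apply: (@Resolution _ _ M splice_mod splice_d phi).
- by case=> [|i] //; apply: res_free.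
- case=> [|i] j x xj; last exact: res_d_graded xj.
  exact: (res_aug_graded (r := Q) xj).
- exact: gphi.
- exact: phi_surj.
- move=> x; split=> [/(ker_ex gphi)[z <-]|[z <-]]; last exact: (ker_phi (gphi := gphi)).
  by have [y <-] := res_aug_surj Q z; exists y.
- case=> [|i] x; last exact: res_exactS.
  split=> [|[y <-]] /=; last first.
    by rewrite (_ : res_aug Q _ = 0) ?linear0//; apply/res_exact0; exists y.
  move=> x0; have /res_exact0[y <-] : res_aug Q x = 0.
    by apply: (@kinc_inj _ _ _ _ _ gphi); rewrite [LHS]x0 linear0.
  by exists y.
Defined.

End Splice.

(** Dimension shifting: the same [z] represents a class one step higher in the spliced resolution,
    where its cycle and boundary conditions are unchanged. *)
Lemma tor_shift (F M : gMod A) (phi : {linear F -> M}) (gphi : graded_map phi) i j :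
  (forall x, exists y, phi y = x) -> graded_free F ->
  tor_neq0 (ker_mod gphi) i.+1 j -> tor_neq0 M i.+2 j.
Proof.
move=> phi_surj freeF [Q [z [zj zc zb]]].
by exists (splice phi_surj freeF Q), z.
Qed.

(** In homological degree 0 every element is a cycle, while one step higher its image must lie in
    [F A_+]; the hypothesis on degree [j] supplies this. *)
Lemma tor_shift0 (F M : gMod A) (phi : {linear F -> M}) (gphi : graded_map phi) j :
  (forall x, exists y, phi y = x) -> graded_free F ->
  (forall x : F, x \in gm_comp j -> in_MAplus x) ->
  tor_neq0 (ker_mod gphi) 0 j -> tor_neq0 M 1 j.
Proof.
move=> phi_surj freeF Fj [Q [z [zj zc zb]]].
exists (splice phi_surj freeF Q), z; split=> //.
by apply: Fj; apply: (res_aug_graded (r := Q) zj).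
Qed.

(** A homogeneous lift [z] of [x] to the cover is a boundary modulo the cover times [A_+]; the map
    to [M] kills the boundary. *)
Lemma tor0_MAplus (M : gMod A) j (x : M) :
  ~ tor_neq0 M 0 j -> x \in gm_comp j -> in_MAplus x.
Proof.
move=> nT xj; have [z zj <-] := cover_hom xj.
have [[y yz]|nb] := pselect (tor_boundary (P := canonical_resolution M) (i := 0) z).
  have := in_MAplus_map (std_cover M) yz; rewrite linearB.
  have -> : std_cover M (res_d (canonical_resolution M) 0 y) = 0; last by rewrite subr0.
  by apply: (res_exact0 (r := canonical_resolution M) _).2; exists y.
by case: nT; exists (canonical_resolution M), z.
Qed.

(** [supremum] is an upper bound only if a least upper bound is known to exist; it is the largest
    degree when the degrees are bounded above, and [+oo] otherwise. *)
Lemma m_modP (M : gMod A) i (b j : int) :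
  (m_mod M i <= b%:E)%E -> b < j -> ~ tor_neq0 M i j.
Proof.
rewrite /m_mod; set S := [set _ | _ in _] => mb bj tj.
have Sj : S j%:E by exists j.
suff : (j%:E <= supremum 0%:E S)%E.
  by move=> /le_trans/(_ mb); rewrite lee_fin leNgt bj.
apply: ge_supremum_Nmem => //.
case: (pselect (exists u : int, forall e, tor_neq0 M i e -> e <= u)) => [[u uP]|nu].
  pose Q n := `[< tor_neq0 M i (u - n%:Z) >].
  have exQ : exists n, Q n.
    exists `|u - j|%N; apply/asboolP; rewrite gez0_abs ?subr_ge0 ?uP//.
    by rewrite opprB addrC subrK.
  case: (ex_minnP exQ) => n /asboolP tn nmin; exists (u - n%:Z)%:E; split.
    move=> _ [e te <-]; rewrite lee_fin.
    have ue := uP e te; have : Q `|u - e|%N.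
      by apply/asboolP; rewrite gez0_abs ?subr_ge0// opprB addrC subrK.
    by move=> /nmin; lia.
  by move=> e; apply; exists (u - n%:Z).
exists +oo%E; split; first by move=> e _; rewrite leey.
move=> [e|//|] ub; last by have := ub _ Sj.
by case: nu; exists e => e' te'; rewrite -lee_fin; apply: ub; exists e'.
Qed.

End Tor.

(** * Presentations *)

Section HcompAct.
Variables (k : fieldType) (A : cgAlg k) (M : gMod A).

Lemma act0 (v : M) : ((0 : A) : A^c) *: v = 0.
Proof. exact: scale0r. Qed.

Lemma actDl (a b : A) (v : M) : ((a + b : A) : A^c) *: v = (a : A^c) *: v + (b : A^c) *: v.
Proof. exact: scalerDl. Qed.

Lemma actM (a b : A) (v : M) : ((a * b : A) : A^c) *: v = (b : A^c) *: ((a : A^c) *: v).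
Proof. by rewrite scalerA. Qed.

Lemma act_sum (I : Type) (r : seq I) (P : pred I) (F : I -> A) (v : M) :
  ((\sum_(i <- r | P i) F i : A) : A^c) *: v = \sum_(i <- r | P i) (F i : A^c) *: v.
Proof.
by apply: (big_morph (fun a : A => (a : A^c) *: v)) => [a b|]; rewrite ?actDl ?act0.
Qed.

Lemma gm_comp0 j : (0 : M) \in gm_comp j.
Proof. by case: ((gm_dec M).1 j). Qed.

Lemma gm_compD j (u v : M) : u \in gm_comp j -> v \in gm_comp j -> u + v \in gm_comp j.
Proof. by have [_] := GRing.zmod_closedD ((gm_dec M).1 j); apply. Qed.

Lemma gm_comp_sum j (I : Type) (r : seq I) (P : pred I) (F : I -> M) :
  (forall i, P i -> F i \in gm_comp j) -> \sum_(i <- r | P i) F i \in gm_comp j.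
Proof.
move=> PF; apply: (big_ind (fun u => u \in gm_comp j)) => //; first exact: gm_comp0.
by move=> *; apply: gm_compD.
Qed.

Lemma hcomp_act (a : A) n (v : M) i : a \in @cg_comp _ A n ->
  hcomp (gm_dec M) ((a : A^c) *: v) (i + n%:Z) = (a : A^c) *: hcomp (gm_dec M) v i.
Proof.
move=> an; move: v; apply: (Defs.hom_ind (gm_dec M)).
- by rewrite scaler0 !hcomp0 scaler0.
- by move=> u v eu ev; rewrite scalerDr !hcompD eu ev scalerDr.
move=> m v vm; rewrite (hcomp_hom _ vm) (hcomp_hom _ (gm_act vm an)).
by rewrite (inj_eq (addIr _)); case: eqP => // _; rewrite scaler0.
Qed.

End HcompAct.

Section Presentation.
Variables (k : fieldType) (A : cgAlg k) (L : finType) (deg : L -> nat) (x : L -> A).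
Hypothesis deg_gt0 : forall l, (0 < deg l)%N.
Hypothesis xh : forall l, x l \in cg_comp (deg l).

Definition monom (u : seq L) : A := foldr (fun l a => a * x l) 1 u.

Lemma monom_hom u : monom u \in cg_comp (weight deg u).
Proof.
elim: u => [|l u IH]; first by rewrite weight_nil; apply/cg_conn; exists 1; rewrite scale1r.
by rewrite weight_cons addnC /=; apply: cg_mul.
Qed.

Definition evA d (c : unit * seq L -> k^o) : A :=
  \sum_(p <- wterms deg d) (c p : k) *: monom p.2.

Definition word_rel d c := supp (wterms deg d) c /\ evA d c = 0.

Lemma evA_lin d a u v : evA d (a *: u + v) = (a : k) *: evA d u + evA d v.
Proof.
rewrite /evA scaler_sumr -big_split; apply: eq_bigr => p _ /=.
by rewrite fun_linE scalerDl scalerA.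
Qed.

Lemma evA_shift d l c : evA (d + deg l) (shift l c) = evA d c * x l.
Proof.
rewrite /evA mulr_suml /wterms.
rewrite (@sum_shift_terms _ _ deg_gt0 _ _ _ _ d l c (fun (b : k) p => b *: monom p.2)).
  by apply: eq_bigr => p _; rewrite scalerAl.
by move=> p; rewrite scale0r.
Qed.

Lemma evA_in d c : evA d c \in cg_comp d.
Proof.
have sc (b : k) a n : a \in @cg_comp _ A n -> b *: a \in @cg_comp _ A n.
  move=> an; rewrite -[b *: a](mul1r) -scalerAr -[n]add0n scalerAl; apply: cg_mul => //.
  by apply/cg_conn; exists b.
rewrite /evA big_seq; apply: (big_ind (fun a => a \in @cg_comp _ A d)).
- by case: ((cg_dec A).1 d).
- by have [_ H] := GRing.zmod_closedD ((cg_dec A).1 d); apply: H.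
move=> p; rewrite (mem_terms deg_gt0) => /eqP <-; apply: sc.
exact: monom_hom.
Qed.

Lemma word_rel_subspace d : subspace (word_rel d).
Proof.
split; first by split=> //; rewrite /evA big1// => p _; rewrite scale0r.
move=> a u v [su u0] [sv v0]; split; first exact: (supp_subspace k _).2.
by rewrite evA_lin u0 v0 scaler0 addr0.
Qed.

Lemma word_rel_shift d l c : word_rel d c -> word_rel (d + deg l) (shift l c).
Proof.
by move=> [sc c0]; split; [exact: supp_shift|rewrite evA_shift c0 mul0r].
Qed.

Hypothesis Aspan : forall d a, a \in @cg_comp _ A d -> exists c, a = evA d c.

Lemma evA_supp d c : exists2 c', supp (wterms deg d) c' & evA d c' = evA d c.
Proof.
exists (fun p => if p \in wterms deg d then c p else 0).
  by move=> p /negPf->.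
by rewrite /evA !big_seq; apply: eq_bigr => p ->.
Qed.

Lemma aug_ind (P : A -> Prop) : P 0 -> (forall a b, P a -> P b -> P (a + b)) ->
  (forall (c : k) l u, P (c *: monom (rcons u l))) -> forall a, aug a = 0 -> P a.
Proof.
move=> P0 PD PX a a0; rewrite (hcomp_seq (cg_dec A) a).
apply: (big_ind P) => // -[|d] _; first by rewrite augP a0 scale0r.
have [c ->] := Aspan (hcomp_in (cg_dec A) a d.+1).
rewrite /evA big_seq; apply: (big_ind P) => // -[[] w].
by rewrite (mem_terms deg_gt0) /=; case/lastP: w => [|u l]; rewrite ?weight_nil.
Qed.

Lemma monom_rcons u l : monom (rcons u l) = x l * monom u.
Proof. by elim: u => [|l' u IH] /=; rewrite ?mul1r ?mulr1// IH mulrA. Qed.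

(** Pulling off the rightmost letter shows that [K A_+] is the sum of the [K x_l] for every right
    module [K]. *)
Lemma aug_letters (a : A) : aug a = 0 -> exists b : L -> A, a = \sum_l b l * x l.
Proof.
move: a; apply: aug_ind.
- by exists (fun=> 0); rewrite big1// => l _; rewrite mul0r.
- move=> _ _ [b ->] [b' ->]; exists (fun l => b l + b' l).
  by rewrite -big_split; apply: eq_bigr => l _; rewrite mulrDl.
move=> c l0 u0; case: (rcons u0 l0) (size_rcons u0 l0) => // l u _.
exists (fun l' => if l' == l then c *: monom u else 0).
rewrite (bigD1 l)//= eqxx big1 ?addr0 ?scalerAl// => l' /negPf->.
by rewrite mul0r.
Qed.

(** Pulling off the leftmost letter instead shows that the letters generate [A_+] as a right
    module. *)
Lemma aug_letters_l (a : A) : aug a = 0 -> exists b : L -> A, a = \sum_l x l * b l.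
Proof.
move: a; apply: aug_ind.
- by exists (fun=> 0); rewrite big1// => l _; rewrite mulr0.
- move=> _ _ [b ->] [b' ->]; exists (fun l => b l + b' l).
  by rewrite -big_split; apply: eq_bigr => l _; rewrite mulrDr.
move=> c l u; exists (fun l' => if l' == l then c *: monom u else 0).
rewrite (bigD1 l)//= eqxx big1 ?addr0 ?monom_rcons ?scalerAr// => l' /negPf->.
by rewrite mulr0.
Qed.

Section Module.
Variables (p1 : int) (G : finType) (f : G -> nat).

Definition shifted_deg (i : G) : int := p1 + (f i)%:Z.

Local Notation FG := (free_mod A shifted_deg).
Local Notation eb := (free_basis A shifted_deg).

(** The projection from the free module over the free algebra to the one over [A], in one degree;
    [d] counts degrees from [p1]. *)
Definition evF d (c : G * seq L -> k^o) : FG :=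
  \sum_(p <- terms deg f d) (((c p : k) *: monom p.2 : A) : A^c) *: (eb p.1 : FG).

Lemma fval_sum (I : Type) (r : seq I) (F : I -> FG) i :
  fval (\sum_(j <- r) F j) i = \sum_(j <- r) fval (F j) i :> A.
Proof. exact: (big_morph (fun z : FG => fval z i : A) (id1 := 0) (op1 := +%R)). Qed.

Lemma fval_basis (a : A) i j : fval ((a : A^c) *: (eb i : FG)) j = if j == i then a else 0
    :> A.
Proof. by rewrite fvalZ free_basisE; case: eqP; rewrite ?mul1r ?mul0r. Qed.

Lemma evF_coord d c i : supp (terms deg f d) c ->
  fval (evF d c) i = (if (f i <= d)%N then evA (d - f i) (coef i c) else 0) :> A.
Proof.
move=> sc; rewrite /evF fval_sum; under eq_bigr do rewrite fval_basis.
rewrite -big_mkcond /=; case: ifPn => [fd|fd]; last first.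
  rewrite big1_seq// => -[j u] /= /andP[/eqP <-]; rewrite (mem_terms deg_gt0) /=.
  by move=> H; lia.
pose g (p : unit * seq L) := (i, p.2).
rewrite -big_filter (perm_big [seq g p | p <- wterms deg (d - f i)]) ?big_map//.
apply: uniq_perm; first by rewrite filter_uniq// terms_uniq.
  by rewrite map_inj_uniq ?terms_uniq// => -[[] u] [[] u'] [->].
move=> [j u]; rewrite mem_filter (mem_terms deg_gt0) /=; apply/andP/mapP => [[/eqP <- ud]|].
  by exists (tt, u) => //; rewrite (mem_terms deg_gt0) /=; move: ud => /eqP <-; rewrite addKn.
move=> [[[] u'] + [-> ->]]; rewrite (mem_terms deg_gt0) /= => /eqP e; split=> //.
by apply/eqP; lia.
Qed.

(** The target is free over [A], so vanishing is tested on coordinates: the kernel of [evF] consists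
    of the trivial relations. *)
Lemma slotsP d c : supp (terms deg f d) c ->
  (forall i, (f i <= d)%N -> word_rel (d - f i) (coef i c)) <-> evF d c = 0.
Proof.
move=> sc; split=> [H|e i fd].
  apply: free_ext => i; rewrite evF_coord// fval0.
  by case: ifP => // fd; have [] := H i fd.
split; last by have := evF_coord i sc; rewrite fd e => <-.
move=> [[] u]; rewrite (mem_terms deg_gt0) /= => ud; apply: sc.
by rewrite (mem_terms deg_gt0) /=; lia.
Qed.

Lemma evF_lin d a u v : evF d (a *: u + v) = (a%:A : A^c) *: evF d u + evF d v.
Proof.
rewrite /evF scaler_sumr -big_split; apply: eq_bigr => p _ /=.
rewrite scalerA -scalerDl; congr (_ *: _).
rewrite fun_linE scalerDl -scalerA; congr (_ + _).
by rewrite -[RHS]/((u p *: monom p.2) * a%:A) -scalerAr mulr1.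
Qed.

Lemma evF0 d : evF d 0 = 0.
Proof. by rewrite /evF big1// => p _; rewrite scale0r act0. Qed.

Lemma evFD d u v : evF d (u + v) = evF d u + evF d v.
Proof. by rewrite -{1}[u]scale1r evF_lin !scale1r. Qed.

Lemma evF_sum d (I : Type) (r : seq I) (F : I -> G * seq L -> k^o) :
  evF d (\sum_(j <- r) F j) = \sum_(j <- r) evF d (F j).
Proof. exact: (big_morph (evF d) (evFD d) (evF0 d)). Qed.

Lemma evFB d u v : evF d (u - v) = evF d u - evF d v.
Proof.
apply/eqP; rewrite -subr_eq0 opprB addrA -evFD subrK subrr; exact/eqP.
Qed.

Lemma evF_shift d l c : evF (d + deg l) (shift l c) = (x l : A^c) *: evF d c.
Proof.
rewrite /evF scaler_sumr.
rewrite (@sum_shift_terms _ _ deg_gt0 _ _ _ _ d l c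
  (fun (b : k) p => ((b *: monom p.2 : A) : A^c) *: (eb p.1 : FG))).
  by apply: eq_bigr => p _; rewrite -actM -scalerAl.
by move=> p; rewrite scale0r act0.
Qed.

Lemma evF_in d c : evF d c \in gm_comp (p1 + d%:Z).
Proof.
rewrite /evF big_seq; apply: gm_comp_sum => p; rewrite (mem_terms deg_gt0) => /eqP <-.
have -> : p1 + (f p.1 + weight deg p.2)%:Z = shifted_deg p.1 + (weight deg p.2)%:Z.
  by rewrite /shifted_deg PoszD addrA.
apply: gm_act; first exact: free_basis_hom.
rewrite -[_ *: _]mul1r -scalerAr -[weight _ _]add0n scalerAl; apply: cg_mul; last exact:
    monom_hom.
by apply/cg_conn; exists (c p).
Qed.

Lemma evF_span d (v : FG) : v \in gm_comp (p1 + d%:Z) ->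
  exists2 c, supp (terms deg f d) c & v = evF d c.
Proof.
move=> /free_compP vd.
have /choice[h hP] i : exists c, (f i <= d)%N ->
    supp (wterms deg (d - f i)) c /\ fval v i = evA (d - f i) c :> A.
  have [fd|fd] := leqP (f i) d; last by exists 0 => e; lia.
  have : fval v i \in @cg_comp _ A (d - f i).
    have := vd i; rewrite (_ : p1 + d%:Z - shifted_deg i = (d - f i)%:Z)//.
    by rewrite /shifted_deg; lia.
  by move=> /Aspan[c0 ->]; have [c sc <-] := evA_supp (d - f i) c0; exists c.
pose c : G * seq L -> k^o := \sum_(i | (f i <= d)%N) slot i (h i).
have sc : supp (terms deg f d) c.
  apply: subspace_sum; first exact: supp_subspace.
  move=> i fd [j u]; rewrite (mem_terms deg_gt0) /slot /=.
  case: (eqVneq j i) => // -> H; have [+ _] := hP i fd; apply.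
  by rewrite (mem_terms deg_gt0) /=; lia.
exists c => //; apply: free_ext => i; rewrite evF_coord//; case: ifPn => fd.
  have [_ ->] := hP i fd; congr evA; apply/funext => -[[] u].
  rewrite /coef /c fct_sumE (bigD1 i)//= /slot /= eqxx big1 ?addr0// => j /andP[_ ji].
  by rewrite eq_sym (negPf ji).
have := vd i; rewrite (_ : p1 + d%:Z - shifted_deg i = Negz (f i - d).-1); last first.
  by rewrite /shifted_deg; lia.
by rewrite inE => /eqP.
Qed.

Lemma free_low (v : FG) j : v \in gm_comp j -> j < p1 -> v = 0.
Proof.
move=> /free_compP vj jp; apply: free_ext => i; have := vj i.
case e: (j - shifted_deg i) => [n|n]; last by rewrite inE => /eqP.
by move: e; rewrite /shifted_deg; lia.
Qed.

Definition free_rel d c := supp (terms deg f d) c /\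
  forall i, (f i <= d)%N -> word_rel (d - f i) (coef i c).

Lemma free_relP d c : free_rel d c <-> supp (terms deg f d) c /\ evF d c = 0.
Proof. by split=> -[sc H]; split=> //; apply/slotsP. Qed.

Variables (M : gMod A) (g : G -> M).
Hypothesis gh : forall i, g i \in gm_comp (shifted_deg i).

Local Notation pres := (free_lin shifted_deg g).

Definition mod_rel d c := supp (terms deg f d) c /\ pres (evF d c) = 0.

Lemma mod_rel_subspace d : subspace (mod_rel d).
Proof.
split; first by split=> //; rewrite evF0 linear0.
move=> a u v [su u0] [sv v0]; split; first exact: (supp_subspace k _).2.
by rewrite evF_lin linearD (linearZZ pres) u0 v0 scaler0 addr0.
Qed.

Lemma mod_rel_shift d l c : mod_rel d c -> mod_rel (d + deg l) (shift l c).
Proof.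
move=> [sc c0]; split; first exact: supp_shift.
by rewrite evF_shift (linearZZ pres) c0 scaler0.
Qed.

Lemma mod_rel_free d c : free_rel d c -> mod_rel d c.
Proof. by move=> /free_relP[sc c0]; split=> //; rewrite c0 linear0. Qed.

Hypothesis pres_surj : forall v, exists z, pres z = v.

(* A relation of degree d > B lies in the kernel K of the free cover, whose
   component of degree d is contained in K A_+ since Tor_1(M, k)_(p1 + d) = 0. *)
Lemma mod_rel_dec (B : nat) : (forall i, (f i <= B)%N) ->
  (forall j, p1 + B%:Z < j -> ~ tor_neq0 M 1 j) ->
  forall d c, (B < d)%N -> mod_rel d c ->
  exists cl n, [/\ forall l, lower deg mod_rel d l (cl l), free_rel d n &
    c = \sum_l shift l (cl l) + n].
Proof.
move=> fB tor d c Bd [sc c0].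
pose gr := free_lin_graded gh.
have [z zE] := ker_ex gr c0.
have zd : z \in @gm_comp _ _ (ker_mod gr) (p1 + d%:Z).
  by rewrite -[_ \in _]/(kinc gr z \in _) zE; apply: evF_in.
have /tor0_MAplus/(_ zd) : ~ tor_neq0 (ker_mod gr) 0 (p1 + d%:Z).
  move=> /tor_shift0 H; apply: (tor (p1 + d%:Z)); first by lia.
  apply: H => // [|v]; first exact: free_graded_free.
  (* The degree exceeds those of all generators of the cover. *)
  by apply: free_MAplus => i; rewrite /shifted_deg; have := fB i; lia.
move=> [n [v [a [a0 zs]]]].
have /choice[b bE] i : exists b : L -> A, a i = \sum_l b l * x l by apply: aug_letters.
pose y l : ker_mod gr := \sum_(i < n) (b i l : A^c) *: v i.
have {}zs : z = \sum_l (x l : A^c) *: y l.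
  rewrite zs /y; under [RHS]eq_bigr do rewrite scaler_sumr.
  rewrite exchange_big /=; apply: eq_bigr => i _; rewrite bE (@act_sum _ _ (ker_mod gr)).
  by apply: eq_bigr => l _; rewrite actM.
(* Only this component of [y l] contributes to degree [p1 + d]. *)
pose w l := hcomp (gm_dec (ker_mod gr)) (y l) (p1 + d%:Z - (deg l)%:Z).
have {}zs : z = \sum_l (x l : A^c) *: w l.
  have := congr1 (fun u => hcomp (gm_dec (ker_mod gr)) u (p1 + d%:Z)) zs.
  rewrite /= (hcomp_hom _ zd) eqxx hcomp_sum => ->; apply: eq_bigr => l _.
  by rewrite -[in LHS](subrK (deg l)%:Z (p1 + d%:Z)) (@hcomp_act _ _ (ker_mod gr) _ _ _ _
      (xh l)).
have wl l : kinc gr (w l) \in gm_comp (p1 + d%:Z - (deg l)%:Z).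
  exact: (hcomp_in (gm_dec (ker_mod gr)) (y l)).
have /choice[cl clP] l : exists cl, lower deg mod_rel d l cl /\
    (x l : A^c) *: kinc gr (w l) = evF d (shift l cl).
  (* A letter of degree above [d] contributes nothing, the free module being zero below [p1]. *)
  have [ld|ld] := leqP (deg l) d; last first.
    exists 0; split; first by left.
    by rewrite shift0 evF0 (free_low (wl l)) ?scaler0//; lia.
  have := wl l; rewrite (_ : _ - _ = p1 + (d - deg l)%:Z); last by lia.
  move=> /evF_span[cl scl wE]; exists cl; split; last first.
    by rewrite wE -evF_shift subnK.
  by right; split=> //; split=> //; rewrite -wE; apply: ker_phi.
(* The remainder is killed by [evF], hence is a trivial relation. *)
exists cl, (c - \sum_l shift l (cl l)); split; last by rewrite addrC subrK.
- by move=> l; case: (clP l).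
apply/free_relP; split.
  apply: (subspaceB (supp_subspace k (terms deg f d)) sc).
  apply: (subspace_sum _ (supp_subspace k (terms deg f d))) => l _; have [[->|[ld [scl _]]]
      _] := clP l; first by rewrite shift0.
  by rewrite -(subnK ld); apply: supp_shift.
rewrite evFB evF_sum -zE zs; apply/eqP; rewrite subr_eq0; apply/eqP.
rewrite raddf_sum; apply: eq_bigr => l _; have [_ <-] := clP l.
exact: (linearZZ (kinc gr)).
Qed.

End Module.

(* The syzygies are the relations of the kernel [K] of the free cover of [M]
   with respect to the generators [kappa] given by the relations [rho], so that
   [mod_rel_dec] applies to them with Tor_1(K, k) = Tor_2(M, k). *)
Section PointSyzygies.
Variables (p1 : int) (G : finType) (f : G -> nat) (M : gMod A) (g : G -> M).
Hypothesis gh : forall i, g i \in gm_comp (shifted_deg p1 f i).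
Local Notation pres := (free_lin (shifted_deg p1 f) g).
Hypothesis pres_surj : forall v, exists z, pres z = v.
Variables (G2 : finType) (f2 : G2 -> nat) (rho : G2 -> G * seq L -> k^o).
Hypothesis rho_rel : forall t, mod_rel p1 f g (f2 t) (rho t).
Variables q s : nat.
Hypotheses (fq : forall i, (f i <= q)%N) (f2q : forall t, (f2 t <= q)%N) (qs : (q <= s)%N).
Hypothesis rho_gen : forall d c, (d <= q)%N -> mod_rel p1 f g d c ->
  exists a : G2 -> k, c = \sum_(t | f2 t == d) a t *: rho t.
Hypothesis tor1 : forall j, p1 + q%:Z < j -> ~ tor_neq0 M 1 j.
Hypothesis tor2 : forall j, p1 + s%:Z < j -> ~ tor_neq0 M 2 j.

Definition point_comb d (a : G2 * seq L -> k^o) : G * seq L -> k^o :=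
  \sum_(p <- terms deg f2 d) a p *: shiftw p.2 (rho p.1).

Definition point_syz d a := supp (terms deg f2 d) a /\ free_rel f d (point_comb d a).

Let gr := free_lin_graded gh.
Let K := ker_mod gr.

Lemma kappa_ex t : exists z : K, kinc gr z = evF p1 f (f2 t) (rho t).
Proof. by apply: ker_ex; case: (rho_rel t). Qed.

Definition kappa t : K := projT1 (cid (kappa_ex t)).

Lemma kappaE t : kinc gr (kappa t) = evF p1 f (f2 t) (rho t).
Proof. by rewrite /kappa; case: cid. Qed.

Lemma kappa_in t : kappa t \in gm_comp (shifted_deg p1 f2 t).
Proof. by rewrite -[_ \in _]/(kinc gr (kappa t) \in _) kappaE; apply: evF_in. Qed.

Local Notation pres2 := (free_lin (shifted_deg p1 f2) kappa).

Lemma evF_shiftw d u c : evF p1 f (d + weight deg u) (shiftw u c)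
  = (monom u : A^c) *: evF p1 f d c.
Proof.
elim: u => [|l u IH]; first by rewrite weight_nil addn0 /= scale1r.
by rewrite weight_cons addnCA addnC /= evF_shift IH -actM.
Qed.

(** Combining relations and then reducing to [A] agrees with reducing the coefficients and then
    applying the cover of [K]; this is why syzygies are relations of [K]. *)
Lemma evF_point_comb d a : evF p1 f d (point_comb d a) = kinc gr (pres2 (evF p1 f2 d a)).
Proof.
rewrite /point_comb evF_sum [evF p1 f2 d a]/evF.
rewrite (linear_sum pres2) (linear_sum (kinc gr)) [LHS]big_seq [RHS]big_seq.
apply: eq_bigr => p; rewrite (mem_terms deg_gt0) => /eqP <-.
rewrite (linearZZ pres2) free_lin_basis (linearZZ (kinc gr)) kappaE.
rewrite -[a p *: _]addr0 evF_lin evF0 addr0 evF_shiftw -actM.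
by rewrite -scalerAr mulr1.
Qed.

Lemma supp_shiftw d u (c : G * seq L -> k^o) : supp (terms deg f d) c ->
  supp (terms deg f (d + weight deg u)) (shiftw u c).
Proof.
move=> sc; elim: u => [|l u IH]; first by rewrite weight_nil addn0.
by rewrite weight_cons addnCA addnC; apply: supp_shift.
Qed.

Lemma point_comb_supp d a : supp (terms deg f d) (point_comb d a).
Proof.
rewrite /point_comb big_seq; apply: (subspace_sum _ (supp_subspace k (terms deg f d))) => p.
rewrite (mem_terms deg_gt0) => /eqP <-; apply: (subspaceZ _ (supp_subspace k _)).
by apply: supp_shiftw; case: (rho_rel p.1).
Qed.

Lemma point_syzP d a : point_syz d a <-> mod_rel p1 f2 kappa d a.
Proof.
split=> [[sa /(free_relP p1)[_ e]]|[sa e]]; split=> //.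
  by apply: (@kinc_inj _ _ _ _ _ gr); rewrite -evF_point_comb e linear0.
apply/(free_relP p1); split; first exact: point_comb_supp.
by rewrite evF_point_comb e linear0.
Qed.

(** A single algebra is a family over a one-point [Omega], so [RelP] applies. *)
Lemma gen_point d c : mod_rel p1 f g d c ->
  exists a n, [/\ supp (terms deg f2 d) a, free_rel f d n & c = point_comb d a + n].
Proof.
have RP := @RelP k unit (fun=> True) L deg deg_gt0 (fun d _ => word_rel d)
  (fun d _ _ => word_rel_subspace d) G f (fun d _ => mod_rel p1 f g d)
  (fun d _ _ => mod_rel_subspace p1 f g d) G2 f2 (fun t _ => rho t) q
  (fun d _ l c _ => @word_rel_shift d l c) (fun t _ _ => rho_rel t)
  (fun d _ c _ => @rho_gen d c)
  (fun d _ c _ => @mod_rel_dec p1 G f M g gh pres_surj q fq tor1 d c)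
  (fun d _ l c _ => @mod_rel_shift p1 G f M g d l c)
  (fun d _ n _ => @mod_rel_free p1 G f M g d n).
by move=> /(RP d tt c Logic.I).1.
Qed.

Lemma pres2_surj v : exists z, pres2 z = v.
Proof.
move: v; apply: (Defs.hom_ind (gm_dec K)).
- by exists 0; rewrite linear0.
- by move=> u v [z <-] [z' <-]; exists (z + z'); rewrite linearD.
move=> j v vj; have vj' : kinc gr v \in gm_comp j by [].
have [jp|jp] := ltP j p1.
  exists 0; rewrite linear0; apply: (@kinc_inj _ _ _ _ _ gr); rewrite linear0.
  by rewrite (free_low vj' jp).
have [d jE] : exists d : nat, j = p1 + d%:Z by exists `|j - p1|%N; lia.
rewrite jE in vj'; have [c sc vE] := evF_span vj'.
have [|a [n [sa /(free_relP p1)[_ n0] cE]]] := @gen_point d c.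
  by split=> //; rewrite -vE; apply: ker_phi.
exists (evF p1 f2 d a); apply: (@kinc_inj _ _ _ _ _ gr).
by rewrite -evF_point_comb vE cE evFD n0 addr0.
Qed.

Lemma point_syz_dec d a : (s < d)%N -> point_syz d a ->
  exists al n, [/\ forall l, lower deg point_syz d l (al l), free_rel f2 d n &
    a = \sum_l shift l (al l) + n].
Proof.
move=> sd /point_syzP Ra.
have [||al [n [alR Nn ->]]] := @mod_rel_dec p1 G2 f2 K kappa kappa_in pres2_surj s _ _ d a
    sd Ra.
- by move=> t; apply: leq_trans qs.
- move=> j sj; apply: contra_not (tor2 sj); apply: tor_shift => //.
  exact: free_graded_free.
exists al, n; split=> // l; have [->|[ld Rl]] := alR l; [by left|right].
by split=> //; apply/point_syzP.
Qed.

Lemma point_syz_free d n : free_rel f2 d n -> point_syz d n.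
Proof. by move=> Nn; apply/point_syzP/mod_rel_free. Qed.

End PointSyzygies.
End Presentation.

(** * Generators in bounded degrees *)

Section HcompProducts.
Variables (k : fieldType) (A : cgAlg k).

(** A substitute for the convolution formula giving the components of a product. *)
Lemma hcompM_ind (a b : A) d (P : A -> Prop) : P 0 -> (forall u v, P u -> P v -> P (u + v)) ->
  (forall i j, (i + j = d)%N -> P (hcomp (cg_dec A) a i * hcomp (cg_dec A) b j)) ->
  P (hcomp (cg_dec A) (a * b) d).
Proof.
move=> P0 PD PM; rewrite (hcomp_seq (cg_dec A) a) (hcomp_seq (cg_dec A) b) mulr_suml.
rewrite hcomp_sum; apply: (big_ind P) => // i _; rewrite mulr_sumr hcomp_sum.
apply: (big_ind P) => // j _.
have ij := cg_mul (hcomp_in (cg_dec A) a i) (hcomp_in (cg_dec A) b j).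
by rewrite (hcomp_hom _ ij); case: eqP => // e; apply: PM.
Qed.

Lemma hcomp_act_ind (M : gMod A) (a : A) (v : M) j (P : M -> Prop) :
  P 0 -> (forall u v, P u -> P v -> P (u + v)) ->
  (forall (n : nat) i, i + n%:Z = j ->
     P ((hcomp (cg_dec A) a n : A^c) *: hcomp (gm_dec M) v i)) ->
  P (hcomp (gm_dec M) ((a : A^c) *: v) j).
Proof.
move=> P0 PD PM; rewrite (hcomp_seq (cg_dec A) a) act_sum hcomp_sum.
apply: (big_ind P) => // n _.
rewrite -[j](subrK n%:Z) (hcomp_act _ _ (hcomp_in (cg_dec A) a n)).
by apply: PM; rewrite subrK.
Qed.

Lemma hcomp_scalar (a : A) : hcomp (cg_dec A) a 0 = (aug a)%:A.
Proof. exact: augP. Qed.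

End HcompProducts.

(** * The augmentation ideal as a right module *)

Section AugmentationIdeal.
Variables (k : fieldType) (A : cgAlg k).

Local Notation F0 := (free_mod A (fun _ : unit => 0%:Z)).

Definition aug_map (z : F0) : triv_mod A := (aug (fval z tt : A) : k).

Lemma aug_map_linear : linear aug_map.
Proof.
move=> a u v; rewrite /aug_map fvalD fvalZ augD augM.
by rewrite -[RHS]/(aug (fval u tt : A) * aug (a : A) + aug (fval v tt : A)).
Qed.

HB.instance Definition _ := GRing.isLinear.Build A^c F0 (triv_mod A) _ aug_map aug_map_linear.

Definition aug_lin : {linear F0 -> triv_mod A} := aug_map.

Lemma aug_lin_graded : graded_map aug_lin.
Proof.
move=> j z /free_compP zj; have := zj tt; rewrite subr0.
rewrite -[_ \in gm_comp _]/((j == 0) || (aug (fval z tt : A) == 0)).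
case: j {zj} => [[|n]|n] //= zn; first by rewrite (aug_pos zn)// eqxx.
by move: zn; rewrite inE => /eqP->; rewrite aug0 eqxx.
Qed.

Lemma cst_in (a : A) : (fun _ : unit => a : (A^c)^o) \in @fin_supp k A unit.
Proof. apply/fin_suppP; exact: finite_finset. Qed.

Definition cst (a : A) : F0 := Free (fun _ : unit => 0%:Z) (cst_in a).

Lemma aug_lin_surj v : exists z, aug_lin z = v.
Proof.
exists (cst ((v : k)%:A)); rewrite -[LHS]/(aug ((v : k)%:A : A)).
by apply: aug_uniq; rewrite (@hcomp_hom _ _ _ _ 0%N)//; apply/cg_conn; exists v.
Qed.

(** Being the kernel of the free cover of the trivial module by [A] itself, it is within the scope
    of dimension shifting. *)
Definition Aplus : gMod A := ker_mod aug_lin_graded.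

Definition aelt (v : Aplus) : A := fval (kinc aug_lin_graded v) tt.

Lemma aelt_inj : injective aelt.
Proof. by move=> u v e; apply: (@kinc_inj _ _ _ _ _ aug_lin_graded); apply: free_ext =>
    -[]. Qed.

Lemma aug_aelt v : aug (aelt v) = 0.
Proof. exact: (ker_phi (gphi := aug_lin_graded)). Qed.

Lemma aelt_ex a : aug a = 0 -> exists v, aelt v = a.
Proof.
move=> a0; have [|v vE] := @ker_ex _ _ _ _ _ aug_lin_graded (cst a); first exact: a0.
by exists v; rewrite /aelt vE.
Qed.

Lemma aeltD u v : aelt (u + v) = aelt u + aelt v.
Proof. by rewrite /aelt linearD fvalD. Qed.

Lemma aelt0 : aelt 0 = 0.
Proof. by rewrite /aelt linear0. Qed.

Lemma aelt_act (a : A) v : aelt ((a : A^c) *: v) = aelt v * a.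
Proof. by rewrite /aelt (linearZZ (kinc aug_lin_graded)) fvalZ. Qed.

Lemma aelt_sum (I : Type) (r : seq I) (P : pred I) (F : I -> Aplus) :
  aelt (\sum_(i <- r | P i) F i) = \sum_(i <- r | P i) aelt (F i).
Proof. exact: (big_morph aelt aeltD aelt0). Qed.

Lemma aelt_comp d v : aelt v \in cg_comp d -> v \in gm_comp d%:Z.
Proof. by move=> vd; apply/free_compP => -[]; rewrite subr0. Qed.

Lemma Aplus_tor0 j : 0 < j -> tor_neq0 Aplus 0 j -> tor_neq0 (triv_mod A) 1 j.
Proof.
move=> j0; apply: tor_shift0; [exact: aug_lin_surj|exact: free_graded_free|].
by move=> z; apply: free_MAplus.
Qed.

Lemma Aplus_torS i j : tor_neq0 Aplus i.+1 j -> tor_neq0 (triv_mod A) i.+2 j.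
Proof. by apply: tor_shift; [exact: aug_lin_surj|exact: free_graded_free]. Qed.

End AugmentationIdeal.

Section AlgebraGeneration.
Variables (k : fieldType) (A : cgAlg k) (n a : nat) (s : seq A).
Hypothesis sn : (size s <= n)%N.
Hypothesis s_gen : forall B : {pred A}, GRing.subalg_closed B -> {subset s <= B} ->
  forall x, x \in B.
Hypothesis tor1 : forall j : int, a%:Z < j -> ~ tor_neq0 (triv_mod A) 1 j.

(** The letters are the components of the generators in degrees 1 to [a], hence the successor in
    [ldeg]. Zero values are allowed, so that all algebras of the family share one alphabet. *)
Definition letter : finType := ('I_n * 'I_a)%type.
Definition ldeg (l : letter) : nat := l.2.+1.
Definition lval (l : letter) : A := hcomp (cg_dec A) s`_(l.1) (ldeg l).

Lemma lval_in l : lval l \in cg_comp (ldeg l).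
Proof. exact: hcomp_in. Qed.

Inductive wspan : nat -> A -> Prop :=
| wspan1 : wspan 0 1
| wspan0 d : wspan d 0
| wspanD d u v : wspan d u -> wspan d v -> wspan d (u + v)
| wspanZ d (c : k) u : wspan d u -> wspan d (c *: u)
| wspanX d l u : wspan d u -> wspan (d + ldeg l) (u * lval l).

Lemma wspanM d e u v : wspan d u -> wspan e v -> wspan (d + e) (u * v).
Proof.
move=> du ev; elim: e v / ev => [|e|e v1 v2 _ IH1 _ IH2|e c v _ IH|e l v _ IH].
- by rewrite mulr1 addn0.
- by rewrite mulr0; apply: wspan0.
- by rewrite mulrDr; apply: wspanD.
- by rewrite -scalerAr; apply: wspanZ.
- by rewrite mulrA addnA; apply: wspanX.
Qed.

(** The elements whose components of degree at most [a] are spanned by words form a subalgebra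
    containing the generators. *)
Lemma wspan_low d x : (d <= a)%N -> wspan d (hcomp (cg_dec A) x d).
Proof.
pose B : {pred A} := fun z => `[< forall e, (e <= a)%N -> wspan e (hcomp (cg_dec A) z e) >].
have scal e (c : k) : wspan e (hcomp (cg_dec A) c%:A e).
  rewrite (@hcomp_hom _ _ _ _ 0%N); last by apply/cg_conn; exists c.
  by case: eqP => [->|_]; [apply: wspanZ; apply: wspan1|apply: wspan0].
have hcompZ e (c : k) u : wspan e (hcomp (cg_dec A) u e) ->
    wspan e (hcomp (cg_dec A) (c *: u) e).
  move=> ud; rewrite -[u]mul1r scalerAl; apply: hcompM_ind; first exact: wspan0.
    exact: wspanD.
  move=> i j ij; rewrite (@hcomp_hom _ _ _ _ 0%N c%:A); last by apply/cg_conn; exists c.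
  case: eqP => [i0|_]; last by rewrite mul0r; apply: wspan0.
  have -> : j = e by lia.
  by rewrite -scalerAl mul1r; apply: wspanZ.
suff /asboolP H : x \in B by apply: H.
apply: s_gen => [|y ys].
  split.
  - by apply/asboolP => e _; rewrite -[1](scale1r 1); apply: scal.
  - move=> c u v /asboolP Bu /asboolP Bv; apply/asboolP => e ea; rewrite hcompD.
    by apply: wspanD; [apply: hcompZ; apply: Bu|apply: Bv].
  - move=> u v /asboolP Bu /asboolP Bv; apply/asboolP => e ea.
    apply: hcompM_ind; [exact: wspan0|exact: wspanD|move=> i j ij].
    by rewrite -ij; apply: wspanM; [apply: Bu|apply: Bv]; lia.
apply/asboolP => -[|e] ea; first by rewrite hcomp_scalar; apply: wspanZ; apply: wspan1.
have iy : (index y s < n)%N by rewrite (leq_trans _ sn)// index_mem.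
have -> : hcomp (cg_dec A) y e.+1 = 1 * lval (Ordinal iy, Ordinal ea).
  by rewrite mul1r /lval /= nth_index.
by rewrite -[e.+1]add0n; apply: (wspanX (Ordinal iy, Ordinal ea)); apply: wspan1.
Qed.

(** Above degree [a] the vanishing of Tor_1 of the trivial module puts [x] in [A_+ A_+], so that it
    is a sum of products of elements of lower degree. *)
Lemma wspan_all d x : x \in @cg_comp _ A d -> wspan d x.
Proof.
elim/ltn_ind: d x => d IH x xd.
have [da|da] := leqP d a.
  by have := wspan_low x da; rewrite (hcomp_hom _ xd) eqxx.
have [v vE] : exists v : Aplus A, aelt v = x by apply: aelt_ex; apply: aug_pos xd _; lia.
have /tor0_MAplus : ~ tor_neq0 (Aplus A) 0 d%:Z.
  by move=> /Aplus_tor0 H; apply: (tor1 (j := d%:Z)); [lia|apply: H; lia].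
move=> /(_ v); rewrite -vE in xd *; move=> /(_ (aelt_comp xd))[m [y [b [b0 vs]]]].
move: xd; rewrite vs aelt_sum => xd.
have <- : hcomp (cg_dec A) (\sum_(i < m) aelt ((b i : A^c) *: y i)) d = \sum_(i < m) aelt
    ((b i : A^c) *: y i).
  by rewrite (hcomp_hom _ xd) eqxx.
rewrite hcomp_sum; apply: (big_ind (wspan d)) => [||i _].
- exact: wspan0.
- by move=> *; apply: wspanD.
rewrite aelt_act; apply: hcompM_ind; [exact: wspan0|by move=> *; apply: wspanD|].
(* Both factors have augmentation 0, so their components of degree 0 vanish and the remaining
   degrees are less than [d]. *)
move=> [|i1] [|i2] ij; rewrite ?hcomp_scalar ?b0 ?aug_aelt ?scale0r ?mulr0 ?mul0r;
  try exact: wspan0.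
rewrite -ij; apply: wspanM; apply: IH; try exact: hcomp_in; lia.
Qed.

Lemma ldeg_gt0 l : (0 < ldeg l)%N.
Proof. by []. Qed.

Lemma words_span d x : x \in @cg_comp _ A d -> exists c, x = evA ldeg lval d c.
Proof.
move=> /wspan_all; elim=> {d x} [|d|d u v _ [c ->] _ [c' ->]|d c u _ [c' ->]|d l u _ [c ->]].
- exists (fun p => (p == (tt, [::]))%:R); rewrite /evA (bigD1_seq (tt, [::])) ?terms_uniq//=.
    rewrite big1 ?addr0 ?scale1r// => p /negPf->.
    by rewrite scale0r.
  by rewrite (mem_terms ldeg_gt0)/= weight_nil.
- by exists 0; rewrite /evA big1// => p _; rewrite scale0r.
- by exists (c + c'); rewrite -{2}[c]scale1r evA_lin scale1r.
- exists (c *: c'); have -> : c *: c' = c *: c' + 0 by rewrite addr0.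
  rewrite evA_lin (_ : evA _ _ _ 0 = 0) ?addr0//.
  by rewrite /evA big1// => p _; rewrite scale0r.
- by exists (shift l c); rewrite (evA_shift _ ldeg_gt0).
Qed.

End AlgebraGeneration.

Section AplusPresentation.
Variables (k : fieldType) (A : cgAlg k) (L : finType) (deg : L -> nat) (x : L -> A).
Hypothesis deg_gt0 : forall l, (0 < deg l)%N.
Hypothesis xh : forall l, x l \in cg_comp (deg l).
Hypothesis Aspan : forall d a, a \in @cg_comp _ A d -> exists c, a = evA deg x d c.

Lemma xgen_ex l : exists v : Aplus A, aelt v = x l.
Proof. by apply: aelt_ex; apply: aug_pos (xh l) _. Qed.

Definition xgen l : Aplus A := projT1 (cid (xgen_ex l)).

Lemma xgenE l : aelt (xgen l) = x l.
Proof. by rewrite /xgen; case: cid. Qed.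

Lemma xgen_in l : xgen l \in gm_comp (shifted_deg 0 deg l).
Proof. by rewrite /shifted_deg add0r; apply: aelt_comp; rewrite xgenE. Qed.

Local Notation pres := (free_lin (shifted_deg 0 deg) xgen).

Lemma Aplus_surj v : exists z, pres z = v.
Proof.
have [b bE] := aug_letters_l deg_gt0 Aspan (aug_aelt v).
exists (\sum_l (b l : A^c) *: (free_basis A (shifted_deg 0 deg) l : free_mod A _)).
rewrite (linear_sum pres); apply: aelt_inj; rewrite bE aelt_sum; apply: eq_bigr => l _.
by rewrite (linearZZ pres) free_lin_basis aelt_act xgenE.
Qed.

(** Identifies the term [e_l u] of the free module on the letters with the word [l u], whose
    leftmost letter is stored last; the empty word gets 0. *)
Definition to_word (c : L * seq L -> k^o) : unit * seq L -> k^o :=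
  fun p => if p.2 is l :: u then c (last l u, belast l u) else 0.

Definition of_word (c : unit * seq L -> k^o) : L * seq L -> k^o :=
  fun p => c (tt, rcons p.2 p.1).

Lemma to_word_rcons c u l : to_word c (tt, rcons u l) = c (l, u).
Proof. by case: u => [|l' u] //; rewrite /to_word /= last_rcons belast_rcons. Qed.

Lemma of_wordK : cancel to_word of_word.
Proof. by move=> c; apply/funext => -[l u]; rewrite /of_word to_word_rcons. Qed.

Lemma to_wordK c : c (tt, [::]) = 0 -> to_word (of_word c) = c.
Proof.
move=> c0; apply/funext => -[[] w]; case/lastP: w => [|u l]; first by rewrite c0.
by rewrite to_word_rcons.
Qed.

Lemma evA_to_word d c : evA deg x d (to_word c) = aelt (pres (evF deg x 0 deg d c)).
Proof.
rewrite /evF (linear_sum pres) aelt_sum /evA.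
pose g (p : L * seq L) := (tt, rcons p.2 p.1).
transitivity (\sum_(p <- [seq g p | p <- terms deg deg d]) (to_word c p : k) *: monom x p.2).
  rewrite [LHS](bigID (fun p => p.2 == [::]))/= big1 ?add0r => [|[[] w] /eqP /= ->].
    rewrite -big_filter; apply: perm_big; apply: uniq_perm.
    - by rewrite filter_uniq// terms_uniq.
    - by rewrite map_inj_uniq ?terms_uniq// => -[l u] [l' u'] [/rcons_inj[-> ->]].
    move=> [[] w]; rewrite mem_filter (mem_terms deg_gt0) /=; apply/andP/mapP.
      move=> [w0 /eqP wd]; case/lastP: w w0 wd => // u l _ wd; exists (l, u) => //.
      by rewrite (mem_terms deg_gt0) /= -wd weight_rcons; apply/eqP; lia.
    move=> [[l u]]; rewrite (mem_terms deg_gt0) /= => /eqP ud [->].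
    by rewrite weight_rcons; split; [case: u {ud}|apply/eqP; lia].
  by rewrite scale0r.
rewrite big_map; apply: eq_bigr => -[l u] _.
rewrite to_word_rcons /= monom_rcons (linearZZ pres) free_lin_basis aelt_act xgenE.
by rewrite scalerAr.
Qed.

Lemma to_word_supp d c : supp (terms deg deg d) c <-> supp (wterms deg d) (to_word c).
Proof.
split=> [sc [[] w]|sc [l u]].
  rewrite (mem_terms deg_gt0) /=; case/lastP: w => [|u l] // H.
  rewrite to_word_rcons; apply: sc; move: H.
  by rewrite (mem_terms deg_gt0) /= weight_rcons add0n addnC.
rewrite (mem_terms deg_gt0) /= => H; rewrite -to_word_rcons; apply: sc.
by rewrite (mem_terms deg_gt0) /= weight_rcons add0n addnC.
Qed.

Lemma to_word_rel d c : mod_rel deg x 0 deg xgen d c <-> word_rel deg x d (to_word c).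
Proof.
split=> -[sc e]; split; try exact/to_word_supp.
  by rewrite evA_to_word e aelt0.
by apply: aelt_inj; rewrite -evA_to_word e aelt0.
Qed.

Lemma of_word_rel d c : (0 < d)%N -> word_rel deg x d c ->
  to_word (of_word c) = c /\ mod_rel deg x 0 deg xgen d (of_word c).
Proof.
move=> d0 Rc; have e : to_word (of_word c) = c.
  by apply: to_wordK; apply: Rc.1; rewrite (mem_terms deg_gt0) /= weight_nil; lia.
by split=> //; apply/to_word_rel; rewrite e.
Qed.

(** The only word of degree 0 is the empty one, and its value is 1. *)
Lemma word_rel0 c : word_rel deg x 0 c -> c = 0.
Proof.
move=> [sc e]; apply/funext => -[[] w]; have [/weight_eq0 ->//|w0] := eqVneq (weight deg w)
    0%N.
  move: e; rewrite /evA (bigD1_seq (tt, [::])) ?terms_uniq//=; last first.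
    by rewrite (mem_terms deg_gt0) /= weight_nil.
  rewrite big1_seq ?addr0 => [|[[] u] /andP[]]; last first.
    rewrite (mem_terms deg_gt0) /= add0n => un /eqP/(weight_eq0 deg_gt0) u0.
    by rewrite u0 eqxx in un.
  by move=> /eqP; rewrite scaler_eq0 oner_eq0 orbF => /eqP.
by apply: sc; rewrite (mem_terms deg_gt0).
Qed.

End AplusPresentation.

Section ModuleGeneration.
Variables (k : fieldType) (A : cgAlg k) (M : gMod A) (m P : nat) (p1 : int) (s : seq M).
Hypothesis sm : (size s <= m)%N.
Hypothesis s_gen : forall N : {pred M}, GRing.submod_closed N -> {subset s <= N} ->
  forall v, v \in N.
Hypothesis M_low : forall j v, j < p1 -> v \in @gm_comp _ _ M j -> v = 0.
Hypothesis tor0 : forall j, p1 + P%:Z < j -> ~ tor_neq0 M 0 j.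

(** Components of the generators in degrees [p1] to [p1 + P]; the index set is again common to the
    whole family. *)
Definition mgen : finType := ('I_m * 'I_P.+1)%type.
Definition mdeg (i : mgen) : nat := i.2.
Definition mval (i : mgen) : M := hcomp (gm_dec M) s`_(i.1) (p1 + (mdeg i)%:Z).

Lemma mval_in i : mval i \in gm_comp (shifted_deg p1 mdeg i).
Proof. exact: hcomp_in. Qed.

Local Notation pres := (free_lin (shifted_deg p1 mdeg) mval).
Let R v := exists z, pres z = v.

Let R0 : R 0. Proof. by exists 0; rewrite linear0. Qed.
Let RD u v : R u -> R v -> R (u + v).
Proof. by move=> [z <-] [z' <-]; exists (z + z'); rewrite linearD. Qed.
Let RZ (a : A^c) u : R u -> R (a *: u).
Proof. by move=> [z <-]; exists (a *: z); rewrite (linearZZ pres). Qed.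

Lemma mgen_low j v : j <= p1 + P%:Z -> R (hcomp (gm_dec M) v j).
Proof.
pose N : {pred M} := fun u => `[< forall i, i <= p1 + P%:Z -> R (hcomp (gm_dec M) u i) >].
suff /asboolP H : v \in N by apply: H.
apply: s_gen => [|u us].
  split; first by apply/asboolP => i _; rewrite hcomp0.
  move=> a u w /asboolP Nu /asboolP Nw; apply/asboolP => i iP; rewrite hcompD.
  apply: RD; last exact: Nw.
  apply: hcomp_act_ind => [||n i' e] //; apply: RZ; apply: Nu.
  by lia.
apply/asboolP => i iP; have [ip|ip] := ltP i p1.
  by rewrite (M_low ip (hcomp_in _ _ _)).
have [e iE] : exists e : nat, i = p1 + e%:Z by exists `|i - p1|%N; lia.
have eP : (e < P.+1)%N by lia.
have iu : (index u s < m)%N by rewrite (leq_trans _ sm)// index_mem.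
exists (free_basis A (shifted_deg p1 mdeg) (Ordinal iu, Ordinal eP)).
by rewrite free_lin_basis /mval /mdeg /= nth_index// iE.
Qed.

(** Graded Nakayama: above degree [p1 + P] an element lies in [M A_+], hence comes from lower
    degrees, and below [p1] everything vanishes. *)
Lemma mgen_surj v : exists z, pres z = v.
Proof.
suff Rh d u : u \in gm_comp (p1 + d%:Z) -> R u.
  rewrite -/(R v) (hcomp_seq (gm_dec M) v); apply: (big_ind R) => // j _.
  have [jp|jp] := ltP j p1; first by rewrite (M_low jp (hcomp_in _ _ _)).
  apply: (Rh `|j - p1|%N); rewrite (_ : _ + _ = j); last by lia.
  exact: hcomp_in.
elim/ltn_ind: d u => d IH u ud; have [dP|dP] := leP (p1 + d%:Z) (p1 + P%:Z).
  by have := mgen_low u dP; rewrite (hcomp_hom _ ud) eqxx.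
have [n [w [a [a0 uE]]]] := tor0_MAplus (tor0 dP) ud.
have <- : hcomp (gm_dec M) u (p1 + d%:Z) = u by rewrite (hcomp_hom _ ud) eqxx.
rewrite uE hcomp_sum; apply: (big_ind R) => // i _.
apply: hcomp_act_ind => // -[|e] j je.
  by rewrite hcomp_scalar a0 scale0r act0.
apply: RZ; have [jp|jp] := ltP j p1; first by rewrite (M_low jp (hcomp_in _ _ _)).
apply: (IH `|j - p1|%N); first by lia.
rewrite (_ : _ + _ = j); last by lia.
exact: hcomp_in.
Qed.

End ModuleGeneration.

(** * Families of algebras and modules *)

Section ModuleFamily.
Variables (k : fieldType) (Omega : Type) (C : finType) (y : Omega -> C -> k).
Variable T : Omega -> Prop.
Hypothesis irr : irreducible y T.
Variables (L : finType) (deg : L -> nat).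
Hypothesis deg_gt0 : forall l, (0 < deg l)%N.
Variables (A : Omega -> cgAlg k) (x : forall w, L -> A w).
Hypothesis xh : forall w l, x w l \in cg_comp (deg l).
Hypothesis Aspan : forall w d a, a \in @cg_comp _ (A w) d -> exists c, a = evA deg (x w) d c.
Variables (p1 : int) (G : finType) (f : G -> nat).
Variables (M : forall w, gMod (A w)) (g : forall w, G -> M w).
Hypothesis gh : forall w i, g w i \in gm_comp (shifted_deg p1 f i).
Hypothesis pres_surj : forall w v, exists z, free_lin (shifted_deg p1 f) (g w) z = v.
Variables m0 q s : nat.
Hypotheses (f_ge : forall i, (m0 <= f i)%N) (fq : forall i, (f i <= q)%N) (qs : (q <= s)%N).
Hypothesis tor1 : forall w j, p1 + q%:Z < j -> ~ tor_neq0 (M w) 1 j.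
Hypothesis tor2 : forall w j, p1 + s%:Z < j -> ~ tor_neq0 (M w) 2 j.

Definition fam_words d w := word_rel deg (x w) d.
Definition fam_rel d w := mod_rel deg (x w) p1 f (g w) d.

(** One coordinate for each entry of the square matrices whose rows span the relations of degree at
    most [q]. The rows are not reduced to a basis because the rank depends on the point. *)
Definition rel_index : finType :=
  {e : 'I_q.+1 & ('I_(size (terms deg f e)) * 'I_(size (terms deg f e)))%type}.
Definition rel_coord w (t : rel_index) : k :=
  mx_of (terms deg f (tag t)) (fam_rel (tag t) w) (tagged t).1 (tagged t).2.

Hypothesis rel_coord_regular : forall t, regular y (fun w => rel_coord w t).

Definition rel_gen : finType := {e : 'I_q.+1 & 'I_(size (terms deg f e))}.
Definition rel_deg (t : rel_gen) : nat := tag t.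
Definition rho (t : rel_gen) w : G * seq L -> k^o :=
  unvec (row (tagged t) (mx_of (terms deg f (tag t)) (fam_rel (tag t) w))).

Lemma fam_rel_subspace d w : subspace (fam_rel d w).
Proof. exact: mod_rel_subspace. Qed.

Lemma rel_deg_le t : (rel_deg t <= q)%N.
Proof. by rewrite -ltnS; apply: ltn_ord. Qed.

(** The rows in one degree are as many as its terms, and a term has degree at least [m0]. *)
Lemma rel_deg_ge t : (m0 <= rel_deg t)%N.
Proof.
case: t => e j; rewrite /rel_deg /=; have := mem_tnth j (in_tuple (terms deg f e)).
by rewrite (mem_terms deg_gt0) => /eqP <-; apply: leq_trans (f_ge _) (leq_addr _ _).
Qed.

Lemma rho_regular t : regular_fun y (rho t).
Proof.
case: t => e j p; apply: regular_sum => i; apply: regularM; last exact: regular_cst.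
under eq_fun do rewrite mxE.
exact: (rel_coord_regular (Tagged (fun e : 'I_q.+1 => ('I_(size (terms deg f e)) * 'I_(size
    (terms deg f e)))%type) (j, i))).
Qed.

Lemma rho_supp t w : supp (terms deg f (rel_deg t)) (rho t w).
Proof. exact: unvec_supp. Qed.

Lemma rho_rel t w : fam_rel (rel_deg t) w (rho t w).
Proof. by apply: mx_of_row; apply: fam_rel_subspace. Qed.

Lemma rho_gen d w c : (d <= q)%N -> fam_rel d w c ->
  exists a : rel_gen -> k, c = \sum_(t | rel_deg t == d) a t *: rho t w.
Proof.
rewrite -ltnS => dq; pose e := Ordinal dq; rewrite -[d]/(nat_of_ord e).
move=> Rc; have [a ->] := mx_of_span (terms_uniq _ _ _) (fam_rel_subspace e w) Rc.1 Rc.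
pose t i : rel_gen := Tagged (fun e : 'I_q.+1 => 'I_(size (terms deg f e))) (i : 'I_(size
    (terms deg f e))).
pose P c := exists a : rel_gen -> k, c = \sum_(t | rel_deg t == e) a t *: rho t w.
have sP : subspace P.
  split; first by exists (fun=> 0); rewrite big1// => i _; rewrite scale0r.
  move=> b _ _ [a1 ->] [a2 ->]; exists (fun i => b * a1 i + a2 i).
  rewrite scaler_sumr -big_split; apply: eq_bigr => i _ /=.
  by rewrite scalerDl scalerA.
apply: (subspace_sum _ sP) => i _; apply: subspaceZ => //.
exists (fun t' => (t' == t i)%:R); rewrite (bigD1 (t i))//= eqxx scale1r big1 ?addr0//.
by move=> t' /andP[_ /negPf->]; rewrite scale0r.
Qed.

Let shiftI d w l c (_ : T w) := @word_rel_shift k (A w) L deg (x w) deg_gt0 d l c.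
Let sI d w (_ : T w) := @word_rel_subspace k (A w) L deg (x w) d.
Let Is d w c (_ : T w) (H : word_rel deg (x w) d c) := H.1.
Let sR d w (_ : T w) := fam_rel_subspace d w.
Let Rs d w c (_ : T w) (H : fam_rel d w c) := H.1.
Let R_rho t w (_ : T w) := rho_rel t w.
Let R_gen d w c (_ : T w) := @rho_gen d w c.
Let R_shift d w l c (_ : T w) := @mod_rel_shift k (A w) L deg (x w) deg_gt0 p1 G f (M w) (g
    w) d l c.
Let R_slots d w n (_ : T w) :=
  @mod_rel_free k (A w) L deg (x w) deg_gt0 p1 G f (M w) (g w) d n.
Let R_dec d w c (_ : T w) := @mod_rel_dec k (A w) L deg (x w) deg_gt0 (xh w) (@Aspan w)
  p1 G f (M w) (g w) (gh w) (@pres_surj w) q fq (@tor1 w) d c.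
Let Z_dec d w a (_ : T w) := @point_syz_dec k (A w) L deg (x w) deg_gt0 (xh w) (@Aspan w)
  p1 G f (M w) (g w) (gh w) (@pres_surj w) rel_gen rel_deg (rho^~ w) (rho_rel^~ w) q s fq
  rel_deg_le qs (fun d c => @rho_gen d w c) (@tor1 w) (@tor2 w) d a.
Let Z_slots d w n (_ : T w) := @point_syz_free k (A w) L deg (x w) deg_gt0
  p1 G f (M w) (g w) (gh w) rel_gen rel_deg (rho^~ w) (rho_rel^~ w) d n.

Lemma liftable_fam_rel w0 d : T w0 ->
  (forall e, (e + m0 <= d)%N -> liftable y T w0 (fam_words e)) ->
  liftable y T w0 (fam_rel d).
Proof.
exact: (liftable_Rel deg_gt0 sI Is sR rho_regular f_ge R_rho R_gen R_dec R_shift R_slots).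
Qed.

Lemma max_fam_rel w0 d : T w0 ->
  (forall e, (e <= s)%N -> max_at T (terms deg f e) (fam_rel e) w0) ->
  (forall e w, T w -> (e + m0 <= d)%N -> liftable y T w (fam_words e)) ->
  (forall e, (e + m0 <= d)%N -> max_at T (wterms deg e) (fam_words e) w0) ->
  max_at T (terms deg f d) (fam_rel d) w0.
Proof.
exact: (max_Rel irr deg_gt0 sI Is sR Rs rho_regular rho_supp f_ge rel_deg_ge shiftI R_rho
  R_gen R_dec R_shift R_slots Z_dec Z_slots).
Qed.

End ModuleFamily.

(** * Hilbert series *)

Section Dimension.
Variables (k : fieldType) (V : zmodType) (sc : k -> V -> V).
Hypothesis scDr : forall a u v, sc a (u + v) = sc a u + sc a v.
Hypothesis scDl : forall a b v, sc (a + b) v = sc a v + sc b v.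
Hypothesis scA : forall a b v, sc a (sc b v) = sc (a * b) v.
Hypothesis sc1 : forall v, sc 1 v = v.
Variables (W : {pred V}) (n : nat) (Phi : 'rV[k]_n -> V) (B : 'M[k]_n).
Hypothesis PhiL : forall a u v, Phi (a *: u + v) = sc a (Phi u) + Phi v.
Hypothesis PhiW : forall u, Phi u \in W.
Hypothesis PhiS : forall v, v \in W -> exists u, v = Phi u.
Hypothesis PhiB : forall u, (u <= B)%MS <-> Phi u = 0.

Let sc0 v : sc 0 v = 0.
Proof. by apply: (addrI (sc 0 v)); rewrite -scDl !addr0. Qed.
Let scr0 a : sc a 0 = 0.
Proof. by apply: (addrI (sc a 0)); rewrite -scDr !addr0. Qed.
Let Phi0 : Phi 0 = 0.
Proof. by have := PhiL 1 0 0; rewrite scaler0 addr0 sc1 => /eqP; rewrite -subr_eq subrr =>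
    /eqP<-. Qed.
Let Phi_sum m (c : 'I_m -> k) (F : 'I_m -> 'rV_n) :
  Phi (\sum_i c i *: F i) = \sum_i sc (c i) (Phi (F i)).
Proof.
apply: (big_rec2 (fun u v => Phi u = v)); first exact: Phi0.
by move=> i u v _ <-; rewrite PhiL.
Qed.
Let Phi_inj u v : Phi u = Phi v -> (v - u <= B)%MS.
Proof.
move=> e; apply/PhiB; rewrite addrC -scaleN1r PhiL -e -PhiL.
by rewrite scaleN1r addNr Phi0.
Qed.
Let sc_sum a m (F : 'I_m -> V) : sc a (\sum_i F i) = \sum_i sc a (F i).
Proof. by apply: (big_morph (sc a)). Qed.

(** The images of a basis of a complement of the kernel [B] form a basis of [W]. *)
Lemma has_dim_image : has_dim sc W (n - \rank B).
Proof.
rewrite -mxrank_compl; set C := row_base B^C%MS.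
exists (fun i => Phi (row i C)); split=> // v /PhiS[u ->].
have [u2 u2E] : exists u2, Phi u = Phi (u2 *m C).
  have : (u <= B + B^C)%MS by apply: submx_full; apply: addsmx_compl_full.
  move=> /sub_addsmxP[[u1 u2] /= uE]; have /submxP[u3 u3E] : (u2 *m B^C <= C)%MS.
    by rewrite eq_row_base submxMl.
  exists u3; rewrite -u3E uE -[u1 *m B]scale1r PhiL sc1.
  by have /PhiB-> := submxMl u1 B; rewrite add0r.
exists (fun i => u2 0 i); split.
  by rewrite u2E mulmx_sum_row Phi_sum.
move=> c; rewrite -Phi_sum => uc; apply/funext => i.
have e : Phi (u2 *m C) = Phi ((\row_j c j) *m C).
  by rewrite -u2E uc mulmx_sum_row; congr Phi; apply: eq_bigr => j _; rewrite mxE.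
have := Phi_inj e; rewrite -mulmxBl => cB.
have : (((\row_j c j) - u2) *m C <= B :&: B^C)%MS.
  by rewrite sub_capmx cB (submx_trans (submxMl _ _))// eq_row_base.
rewrite capmx_compl submx0 => /eqP c0.
have /eqP : (\row_j c j) - u2 = 0.
  by apply: (row_free_inj (row_base_free B^C%MS)); rewrite -/C c0 mul0mx.
by rewrite subr_eq0 => /eqP <-; rewrite mxE.
Qed.

(** [Q] is the matrix of [Phi] in the given basis: it has rank [d], and its kernel is the row space
    of [B]. *)
Lemma has_dim_uniq d : has_dim sc W d -> d = (n - \rank B)%N.
Proof.
move=> [b [bW bU]].
have /choice[P PE] u : exists c : 'I_d -> k, Phi u = \sum_i sc (c i) (b i).
  by have [c [cE _]] := bU _ (PhiW u); exists c.
pose Q := \matrix_(j < n) \row_i P (delta_mx 0 j) i.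
have PhiQ u : Phi u = \sum_i sc ((u *m Q) 0 i) (b i).
  rewrite {1}[u]row_sum_delta Phi_sum.
  under eq_bigr do rewrite PE sc_sum.
  rewrite exchange_big /=; apply: eq_bigr => i _.
  under eq_bigr do rewrite scA.
  rewrite mxE -(big_morph (sc^~ (b i)) (fun a a' => scDl a a' _) (sc0 _)).
  by congr sc; apply: eq_bigr => j _; rewrite !mxE.
have coord0 u : \sum_i sc (u i) (b i) = 0 -> u = fun=> 0.
  move=> u0; have W0 : 0 \in W by rewrite -Phi0.
  have [c [_ cU]] := bU _ W0; rewrite -(cU u) // -(cU (fun=> 0))//.
  by rewrite big1// => i _; rewrite sc0.
have BQ : \rank B = \rank (kermx Q).
  apply/eqP; rewrite eqn_leq; apply/andP; split; apply: mxrankS; apply/row_subP => i.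
    rewrite sub_kermx; apply/eqP/rowP => j; rewrite [RHS]mxE.
    have /PhiB : (row i B <= B)%MS by apply: row_sub.
    by rewrite PhiQ => /coord0 /(congr1 (fun f => f j)).
  apply/PhiB; rewrite PhiQ big1// => j _.
  have /sub_kermxP-> := row_sub i (kermx Q).
  by rewrite mxE sc0.
have QR : \rank Q = d.
  have /choice[u uE] i : exists u, b i = Phi u by apply: PhiS.
  have : (\matrix_i u i) *m Q = 1%:M.
    apply/row_matrixP => i; rewrite row_mul rowK; apply/rowP => j.
    have [c [_ cU]] := bU _ (bW i).
    have c1 : c = fun j => (i == j)%:R.
      apply: cU; rewrite (bigD1 i)//= eqxx sc1 big1 ?addr0// => j' /negPf ij.
      by rewrite eq_sym ij sc0.
    have c2 : c = fun j => (u i *m Q) 0 j by apply: cU; rewrite -PhiQ.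
    by rewrite !mxE -[RHS](congr1 (@^~ j) c1) c2 mxE.
  move=> e; apply/eqP; rewrite eqn_leq rank_leq_col /=.
  by rewrite -{1}(mxrank1 k d) -e mxrankM_maxr.
by rewrite BQ mxrank_ker QR subKn// -QR rank_leq_row.
Qed.

End Dimension.

Section Finiteness.
Variables (k : fieldType) (Omega : Type) (C : finType) (y : Omega -> C -> k).
Variables (H : Type) (hs : Omega -> H) (J : finType) (ds : J -> Omega -> nat) (b : J -> nat).
Hypothesis ds_le : forall j w, (ds j w <= b j)%N.
Hypothesis ds_near : forall (T : Omega -> Prop) j w0, T w0 -> near y T w0 (fun w => (ds j
    w0 <= ds j w)%N).
Hypothesis ds_hs : forall (T : Omega -> Prop) w0 w1, irreducible y T -> T w0 -> T w1 ->
  (forall j w, T w -> (ds j w <= ds j w0)%N /\ (ds j w <= ds j w1)%N) -> hs w0 = hs w1.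

Theorem finite_generic : finite_set (values hs (fun=> True)).
Proof.
apply: contrapT => /(generic_infinite y)[T [_ infT genT]].
(* Otherwise the values on [T] would be covered by those on two zero loci, both finite in number. *)
have irr : irreducible y T.
  move=> f g rf rg nf ng; apply: contrapT => nfg; apply: infT.
  apply: (@sub_finite_set _ _ ((values hs (fun w => T w /\ f w = 0)) `|`
    (values hs (fun w => T w /\ g w = 0)))); last first.
    by rewrite finite_setU; split; apply: genT.
  move=> _ [w Tw <-]; case: (eqVneq (f w) 0) => [fw|fw]; first by left; exists w.
  case: (eqVneq (g w) 0) => [gw|gw]; first by right; exists w.
  by case: nfg; exists w.
have [w00 T00] : exists w, T w.
  apply: contrapT => nT; apply: infT; apply: (@sub_finite_set _ _ set0) => //.
  by move=> h [w Tw _]; case: nT; exists w.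
have /choice[f fP] j : exists f, [/\ regular y f, exists2 w, T w & f w != 0 &
    forall w, T w -> f w != 0 -> forall w', T w' -> (ds j w' <= ds j w)%N].
  (* The bounded function [ds j] attains its maximum on [T], and by semicontinuity attains it on a
     nonempty principal open set. *)
  pose Q n := `[< exists2 w, T w & ds j w = n >].
  have exQ : exists n, Q n by exists (ds j w00); apply/asboolP; exists w00.
  have Qb n : Q n -> (n <= b j)%N by move=> /asboolP[w _ <-]; apply: ds_le.
  case: (ex_maxnP exQ Qb) => n /asboolP[w0 T0 <-] nmax.
  have [f [rf f0 fP]] := ds_near j T0; exists f; split=> //; first by exists w0.
  move=> w Tw fw w' Tw'; apply: leq_trans (fP w Tw fw); apply: nmax.
  by apply/asboolP; exists w'.
(* Off the zero loci of the [f j], each with finitely many values, all [ds j] are maximal and [hs]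
   is constant. *)
case: (pselect (exists2 w1, T w1 & forall j, f j w1 != 0)) => [[w1 T1 f1]|nw1].
  apply: infT; apply: (@sub_finite_set _ _ (hs w1 |`
    (\bigcup_(j in [set: J]) (values hs (fun w => T w /\ f j w = 0))))); last first.
    rewrite finite_setU; split; first exact: finite_set1.
    apply: bigcup_finite => [|j _]; first exact: finite_finset.
    by apply: genT; case: (fP j).
  move=> _ [w Tw <-]; case: (pselect (exists j, f j w = 0)) => [[j fj]|nf].
    by right; exists j => //; exists w.
  left; apply: (@ds_hs T) => // j w' Tw'; have [_ _ fj] := fP j.
  by split; apply: fj => //; apply/eqP => fj0; apply: nf; exists j.
apply: infT; apply: (@sub_finite_set _ _
  (\bigcup_(j in [set: J]) (values hs (fun w => T w /\ f j w = 0)))).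
  move=> _ [w Tw <-]; apply: contrapT => nb; apply: nw1; exists w => // j.
  by apply/eqP => fj; apply: nb; exists j => //; exists w.
apply: bigcup_finite => [|j _]; first exact: finite_finset.
by apply: genT; case: (fP j).
Qed.

End Finiteness.

Lemma pdim_le (k : fieldType) (X : choiceType) (s : seq X) (U : (X -> k^o) -> Prop) :
  (pdim s U <= size s)%N.
Proof. exact: rank_leq_row. Qed.

(* The relations of degree d > 0 of A are those of the right module A_+, whose
   trivial relations only involve the relations of A in degrees < d. *)
Section AlgebraFamily.
Variables (k : fieldType) (Omega : Type) (C : finType) (y : Omega -> C -> k).
Variables (L : finType) (deg : L -> nat).
Hypothesis deg_gt0 : forall l, (0 < deg l)%N.
Variables (A : Omega -> cgAlg k) (x : forall w, L -> A w).
Hypothesis xh : forall w l, x w l \in cg_comp (deg l).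
Hypothesis Aspan : forall w d a, a \in @cg_comp _ (A w) d -> exists c, a = evA deg (x w) d c.
Variables q s : nat.
Hypotheses (degq : forall l, (deg l <= q)%N) (qs : (q <= s)%N).
Hypothesis tor2 : forall w (j : int), q%:Z < j -> ~ tor_neq0 (triv_mod (A w)) 2 j.
Hypothesis tor3 : forall w (j : int), s%:Z < j -> ~ tor_neq0 (triv_mod (A w)) 3 j.

Definition plus_gen w : L -> Aplus (A w) := xgen deg_gt0 (@xh w).
Definition plus_rel d w := fam_rel deg x 0 deg plus_gen d w.
Definition plus_coord w (t : rel_index deg deg q) := rel_coord x 0 plus_gen w t.
Hypothesis coord_regular : forall t, regular y (fun w => plus_coord w t).

Local Notation words_rel := (fam_words deg x).

Let plus_surj w v := Aplus_surj deg_gt0 (@xh w) (@Aspan w) v.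
Let plus_in w := xgen_in deg_gt0 (@xh w).
Let t1 w (j : int) : 0 + q%:Z < j -> ~ tor_neq0 (Aplus (A w)) 1 j.
Proof. by rewrite add0r => /tor2 H /Aplus_torS /H. Qed.
Let t2 w (j : int) : 0 + s%:Z < j -> ~ tor_neq0 (Aplus (A w)) 2 j.
Proof. by rewrite add0r => /tor3 H /Aplus_torS /H. Qed.

Lemma liftable_words (T : Omega -> Prop) w0 d : T w0 -> liftable y T w0 (words_rel d).
Proof.
move=> Tw0; elim/ltn_ind: d => -[|d] IH c Rc.
  rewrite (word_rel0 deg_gt0 Rc); exists (fun=> 0); split=> //.
    exact: regular_fun_cst.
  by apply: nearT => w _; case: (word_rel_subspace deg (x w) 0).
have [e Ro] := of_word_rel deg_gt0 (@xh w0) (ltn0Sn d) Rc; rewrite -e.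
apply: (lifts_map (U := plus_rel d.+1)).
- move=> v rv [[] [|l u]] /=; first exact: regular_cst.
  exact: rv.
- by move=> w c' Tw; apply: (to_word_rel deg_gt0 (@xh w) _ _).1.
apply: (liftable_fam_rel deg_gt0 xh Aspan plus_in plus_surj (m0 := 1) deg_gt0 degq t1
    coord_regular) => //.
by move=> e' e'd; apply: IH; lia.
Qed.

Lemma max_words (T : Omega -> Prop) w0 d : irreducible y T -> T w0 ->
  (forall e, (e <= s)%N -> max_at T (terms deg deg e) (plus_rel e) w0) ->
  max_at T (wterms deg d) (words_rel d) w0.
Proof.
move=> irr Tw0 maxR; elim/ltn_ind: d => -[|d] IH w Tw.
  apply: (pdim_le_inj (terms_uniq _ _ _) (terms_uniq _ _ _) (h := id)) => //.
  - exact: word_rel_subspace.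
  - exact: word_rel_subspace.
  - by move=> c [].
  - by move=> c [].
  - move=> c /(word_rel0 deg_gt0) ->.
    by case: (word_rel_subspace deg (x w0) 0).
have maxd : max_at T (terms deg deg d.+1) (plus_rel d.+1) w0.
  apply: (max_fam_rel irr deg_gt0 xh Aspan plus_in plus_surj (m0 := 1) deg_gt0 degq qs t1 t2
    coord_regular) => //.
    by move=> e w' Tw' _; apply: liftable_words.
  by move=> e ed; apply: IH; lia.
(* The bound for [A_+] is transported to words by the injections [of_word] at [w] and [to_word] at
   [w0]. *)
apply: (@leq_trans (pdim (terms deg deg d.+1) (plus_rel d.+1 w))).
  apply: (pdim_le_inj (terms_uniq _ _ _) (terms_uniq _ _ _) (h := @of_word k L)).
  - exact: word_rel_subspace.
  - exact: mod_rel_subspace.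
  - by move=> c [].
  - by move=> c [].
  - by [].
  - by move=> c Rc; have [] := of_word_rel deg_gt0 (@xh w) (ltn0Sn d) Rc.
  - move=> c Rc c0; have [<- _] := of_word_rel deg_gt0 (@xh w) (ltn0Sn d) Rc.
    by rewrite c0; apply/funext => -[[] [|l u]].
apply: (leq_trans (maxd w Tw)).
apply: (pdim_le_inj (terms_uniq _ _ _) (terms_uniq _ _ _) (h := @to_word k L)).
- exact: mod_rel_subspace.
- exact: word_rel_subspace.
- by move=> c [].
- by move=> c [].
- move=> a u v; apply/funext => -[[] [|l u']]; rewrite [RHS]fun_linE //=.
  by rewrite mulr0 addr0.
- by move=> c; apply: (to_word_rel deg_gt0 (@xh w0) _ _).1.
- by move=> c Rc c0; rewrite -[c]of_wordK c0; apply/funext.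
Qed.

Lemma near_plus_rel (T : Omega -> Prop) w0 e : T w0 ->
  near y T w0 (fun w => (pdim (terms deg deg e) (plus_rel e w0) <=
                         pdim (terms deg deg e) (plus_rel e w))%N).
Proof.
move=> Tw0; apply: near_dim => //; first exact: terms_uniq.
- by move=> w _; apply: mod_rel_subspace.
- by move=> w c _ [].
apply: (liftable_fam_rel deg_gt0 xh Aspan plus_in plus_surj (m0 := 1) deg_gt0 degq t1
    coord_regular) => //.
by move=> e' _; apply: liftable_words.
Qed.

End AlgebraFamily.

Section Hilbert.
Variables (k : fieldType) (A : cgAlg k) (L : finType) (deg : L -> nat) (x : L -> A).
Hypothesis deg_gt0 : forall l, (0 < deg l)%N.
Hypothesis xh : forall l, x l \in cg_comp (deg l).
Hypothesis Aspan : forall d a, a \in @cg_comp _ A d -> exists c, a = evA deg x d c.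

Definition alg_series d := (size (wterms deg d) - pdim (wterms deg d) (word_rel deg x d))%N.

Let unvec_evA d (u : 'rV[k]_(size (wterms deg d))) :
  (u <= mx_of (wterms deg d) (word_rel deg x d))%MS <-> evA deg x d (unvec u) = 0.
Proof.
rewrite (mx_ofP (word_rel_subspace deg x d)); split=> [[]//|e].
by split=> //; apply: unvec_supp.
Qed.

Let evA_surj d v : v \in @cg_comp _ A d -> exists u : 'rV[k]_(size (wterms deg d)), v = evA
    deg x d (unvec u).
Proof.
move=> /Aspan[c0 ->]; have [c sc <-] := evA_supp deg x d c0.
by exists (vec (wterms deg d) c); rewrite vecK// terms_uniq.
Qed.

Let evA_unvec_lin d a (u v : 'rV[k]_(size (wterms deg d))) :
  evA deg x d (unvec (a *: u + v)) = a *: evA deg x d (unvec u) + evA deg x d (unvec v).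
Proof. by rewrite unvecD evA_lin. Qed.

Let evA_unvec_in d (u : 'rV[k]_(size (wterms deg d))) :
  evA deg x d (unvec u) \in @cg_comp _ A d.
Proof. exact: evA_in. Qed.

Lemma alg_seriesP : is_hilb_alg A alg_series.
Proof.
move=> d; exact: (has_dim_image (@scale1r k A) (@evA_unvec_lin d) (@evA_unvec_in d)
  (@evA_surj d) (@unvec_evA d)).
Qed.

Lemma alg_series_uniq h : is_hilb_alg A h -> h = alg_series.
Proof.
move=> hP; apply/funext => d.
exact: (has_dim_uniq (@scalerDr k A) (fun a b v => @scalerDl k A v a b) (@scalerA k A)
  (@scale1r k A) (@evA_unvec_lin d) (@evA_unvec_in d) (@evA_surj d) (@unvec_evA d) (hP d)).
Qed.

Variables (p1 : int) (G : finType) (f : G -> nat) (M : gMod A) (g : G -> M).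
Hypothesis gh : forall i, g i \in gm_comp (shifted_deg p1 f i).
Local Notation pres := (free_lin (shifted_deg p1 f) g).
Hypothesis pres_surj : forall v, exists z, pres z = v.
Hypothesis M_low : forall j v, j < p1 -> v \in @gm_comp _ _ M j -> v = 0.

Definition mod_series (j : int) := if j < p1 then 0%N else
  (size (terms deg f `|j - p1|) - pdim (terms deg f `|j - p1|) (mod_rel deg x p1 f g `|j -
      p1|))%N.

Let sc (c : k) (v : M) := (c%:A : A^c) *: v.

Let scDr a u v : sc a (u + v) = sc a u + sc a v.
Proof. exact: scalerDr. Qed.
Let scDl a b v : sc (a + b) v = sc a v + sc b v.
Proof. by rewrite /sc scalerDl actDl. Qed.
Let scA a b v : sc a (sc b v) = sc (a * b) v.
Proof. by rewrite /sc -actM -scalerAl mul1r scalerA mulrC. Qed.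
Let sc1 v : sc 1 v = v.
Proof. by rewrite /sc !scale1r. Qed.

Let Phi d (u : 'rV[k]_(size (terms deg f d))) : M := pres (evF deg x p1 f d (unvec u)).

Let PhiL d a u v : @Phi d (a *: u + v) = sc a (Phi u) + Phi v.
Proof. by rewrite /Phi unvecD evF_lin linearD (linearZZ pres). Qed.

Let PhiB d u : (u <= mx_of (terms deg f d) (mod_rel deg x p1 f g d))%MS <-> @Phi d u = 0.
Proof.
rewrite (mx_ofP (mod_rel_subspace deg x p1 f g d)); split=> [[]//|e].
by split=> //; apply: unvec_supp.
Qed.

Let PhiW d u : @Phi d u \in gm_comp (p1 + d%:Z).
Proof. by apply: (free_lin_graded gh); apply: evF_in. Qed.

Let PhiS d v : v \in @gm_comp _ _ M (p1 + d%:Z) -> exists u, v = @Phi d u.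
Proof.
move=> vd; have [z zE] := pres_surj v.
pose z' := hcomp (gm_dec (free_mod A (shifted_deg p1 f))) z (p1 + d%:Z).
have : pres z' = v.
  by rewrite (graded_hcomp (free_lin_graded gh)) zE (hcomp_hom _ vd) eqxx.
have [c sc' ->] := evF_span deg_gt0 Aspan (hcomp_in _ _ _ : z' \in gm_comp (p1 + d%:Z)).
by move=> <-; exists (vec (terms deg f d) c); rewrite /Phi vecK// terms_uniq.
Qed.

(** Below [p1] the dimension lemmas are applied with a source of dimension 0. *)
Let low_in j (u : 'rV[k]_0) : (0 : M) \in gm_comp j.
Proof. exact: gm_comp0. Qed.
Let low_lin (a : k) (u v : 'rV[k]_0) : (0 : M) = sc a 0 + 0.
Proof. by rewrite /sc scaler0 addr0. Qed.
Let low_surj j v : j < p1 -> v \in gm_comp j -> exists u : 'rV[k]_0, v = (0 : M).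
Proof. by move=> jp /(M_low jp) ->; exists 0. Qed.
Let low_ker (u : 'rV[k]_0) : (u <= (0 : 'M[k]_0))%MS <-> (0 : M) = 0.
Proof. by rewrite [u]thinmx0 sub0mx. Qed.

Lemma mod_seriesP : is_hilb_mod M mod_series.
Proof.
move=> j; rewrite /mod_series; case: ltP => jp.
  by have := has_dim_image sc1 low_lin (@low_in j) (fun v => low_surj jp) low_ker; rewrite
      mxrank0.
have [d jE] : exists d : nat, j = p1 + d%:Z by exists `|j - p1|%N; lia.
rewrite (_ : `|j - p1|%N = d); last by lia.
rewrite jE; exact: (has_dim_image sc1 (@PhiL d) (@PhiW d) (@PhiS d) (@PhiB d)).
Qed.

Lemma mod_series_uniq h : is_hilb_mod M h -> h = mod_series.
Proof.
move=> hP; apply/funext => j; have := hP j; rewrite /mod_series; case: ltP => jp hj.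
  by have := has_dim_uniq scDr scDl scA sc1 low_lin (@low_in j) (fun v => low_surj jp)
      low_ker hj.
have [d jE] : exists d : nat, j = p1 + d%:Z by exists `|j - p1|%N; lia.
rewrite (_ : `|j - p1|%N = d); last by lia.
rewrite jE in hj *.
exact: (has_dim_uniq scDr scDl scA sc1 (@PhiL d) (@PhiW d) (@PhiS d) (@PhiB d) hj).
Qed.

End Hilbert.

(** * Finiteness over the families [D] and [DM] *)

Section MainTheorem.
Variables (k : fieldType) (n a b c : int).

Local Notation Lt := (letter `|n| `|a|).
Local Notation Ld := (@ldeg `|n| `|a|).

(** Relations are listed up to a degree that bounds the letter degrees as well as [b]. Absolute
    values make the bounds natural numbers and, for negative ones, only enlarge the range. *)
Definition alg_q := maxn `|a| `|b|.
Definition alg_s := maxn alg_q `|c|.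

Lemma Ld_gt0 (l : Lt) : (0 < Ld l)%N.
Proof. by []. Qed.

Lemma Ld_le (l : Lt) : (Ld l <= alg_q)%N.
Proof. by rewrite leq_max; apply/orP; left; apply: ltn_ord. Qed.

Lemma alg_qs : (alg_q <= alg_s)%N.
Proof. exact: leq_maxl. Qed.

Section FixedAlgebra.
Variables (A : cgAlg k) (DA : D n a b c A).

Lemma D_gens_ex : exists s : seq A, (size s <= `|n|)%N /\
  forall B : {pred A}, GRing.subalg_closed B -> {subset s <= B} -> forall x, x \in B.
Proof. by case: DA => -[s [sn sg]] _ _ _; exists s; split=> //; lia. Qed.

Definition D_gens := projT1 (cid D_gens_ex).

Definition D_letter (l : Lt) : A := lval D_gens l.

Lemma D_letter_in l : D_letter l \in cg_comp (Ld l).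
Proof. exact: lval_in. Qed.

Lemma D_span d x : x \in @cg_comp _ A d -> exists c, x = evA Ld D_letter d c.
Proof.
rewrite /D_letter /D_gens; case: cid => s /= [sn sg].
apply: (words_span sn sg) => j aj; case: DA => _ m1 _ _.
by apply: (m_modP m1); lia.
Qed.

Lemma D_tor2 (j : int) : alg_q%:Z < j -> ~ tor_neq0 (triv_mod A) 2 j.
Proof. by move=> qj; case: DA => _ _ m2 _; apply: (m_modP m2); rewrite /alg_q in qj; lia. Qed.

Lemma D_tor3 (j : int) : alg_s%:Z < j -> ~ tor_neq0 (triv_mod A) 3 j.
Proof. by move=> qj; case: DA => _ _ _ m3; apply: (m_modP m3); rewrite /alg_s in qj; lia. Qed.

End FixedAlgebra.

Section AlgebraPoints.
Variables (Omega : Type) (A : Omega -> cgAlg k).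
Hypothesis DA : forall w, D n a b c (A w).

Let x w := D_letter (DA w).
Let xh w l := D_letter_in (DA w) l.
Let xs w d z := @D_span (A w) (DA w) d z.

Lemma alg_series_eq (C : finType) (y : Omega -> C -> k) (T : Omega -> Prop) w0 w1 :
  (forall t, regular y (fun w => plus_coord Ld_gt0 xh (q := alg_q) w t)) ->
  irreducible y T -> T w0 -> T w1 ->
  (forall e, (e <= alg_s)%N -> max_at T (terms Ld Ld e) (plus_rel Ld_gt0 xh e) w0) ->
  (forall e, (e <= alg_s)%N -> max_at T (terms Ld Ld e) (plus_rel Ld_gt0 xh e) w1) ->
  forall d, pdim (wterms Ld d) (word_rel Ld (x w0) d) = pdim (wterms Ld d) (word_rel Ld (x
      w1) d).
Proof.
move=> ry irr T0 T1 max0 max1 d; apply/eqP; rewrite eqn_leq.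
have mw := max_words xs Ld_le alg_qs (fun w => D_tor2 (DA w)) (fun w => D_tor3 (DA w)) ry d
    irr.
by rewrite (mw w1 T1 max1 w0 T0) (mw w0 T0 max0 w1 T1).
Qed.

End AlgebraPoints.

Lemma finite_alg_series : finite_set [set h : nat -> nat |
  exists A : cgAlg k, D n a b c A /\ is_hilb_alg A h].
Proof.
pose Omega := {A : cgAlg k | D n a b c A}.
pose A (w : Omega) : cgAlg k := projT1 w.
pose DA (w : Omega) : D n a b c (A w) := projT2 w.
pose xh w l := D_letter_in (DA w) l.
pose xs w d z := @D_span (A w) (DA w) d z.
pose y (w : Omega) t := plus_coord Ld_gt0 xh (q := alg_q) w t.
pose hs w := alg_series Ld (D_letter (DA w)).
pose ds (j : 'I_alg_s.+1) w := pdim (terms Ld Ld j) (plus_rel Ld_gt0 xh j w).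
have ry t : regular y (fun w => plus_coord Ld_gt0 xh (q := alg_q) w t).
  exact: regular_coord.
apply: (@sub_finite_set _ _ (values hs (fun=> True))).
  move=> h [A0 [DA0 hP]]; exists (exist _ A0 DA0) => //=.
  by rewrite (alg_series_uniq Ld_gt0 (xh _) (@xs (exist _ A0 DA0)) hP).
apply: (finite_generic (y := y) (ds := ds) (b := fun j => size (terms Ld Ld j))).
- by move=> j w; apply: pdim_le.
- by move=> T j w0 T0; exact: (near_plus_rel xs Ld_le alg_qs (fun w => D_tor2 (DA w)) ry j T0).
move=> T w0 w1 irr T0 T1 maxds; rewrite /hs /alg_series; apply/funext => d.
rewrite (alg_series_eq ry irr T0 T1)// => e; rewrite -ltnS => es w Tw.
  by have [] := maxds (Ordinal es) w Tw.
by have [] := maxds (Ordinal es) w Tw.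
Qed.

Variables (m p1 p2 q r : int).

Local Notation Gt := (mgen `|m| `|p2 - p1|).
Local Notation Gd := (@mdeg `|m| `|p2 - p1|).

(** Degrees are counted from [p1]; then [p1 + mod_q] is at least [p2] and [q], even if a difference
    is negative. *)
Definition mod_q := maxn `|p2 - p1| `|q - p1|.
Definition mod_s := maxn mod_q `|r - p1|.

Lemma Gd_le i : (Gd i <= mod_q)%N.
Proof. by rewrite leq_max -ltnS ltn_ord. Qed.

Section FixedModule.
Variables (A : cgAlg k) (M : gMod A) (HM : DM n a b c m p1 p2 q r M).

Lemma DM_alg : D n a b c A.
Proof. by case: HM. Qed.

Lemma DM_gens_ex : exists s : seq M, (size s <= `|m|)%N /\
  forall N : {pred M}, GRing.submod_closed N -> {subset s <= N} -> forall v, v \in N.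
Proof. by case: HM => _ [s [sn sg]] _ _; exists s; split=> //; lia. Qed.

Definition DM_gens := projT1 (cid DM_gens_ex).

Definition DM_gen (i : Gt) : M := mval p1 DM_gens i.

Lemma DM_gen_in i : DM_gen i \in gm_comp (shifted_deg p1 Gd i).
Proof. exact: mval_in. Qed.

Lemma DM_low j v : j < p1 -> v \in @gm_comp _ _ M j -> v = 0.
Proof. by case: HM => _ _ low _; apply: low. Qed.

Lemma DM_surj v : exists z, free_lin (shifted_deg p1 Gd) DM_gen z = v.
Proof.
rewrite /DM_gen /DM_gens; case: cid => s /= [sn sg].
apply: (mgen_surj sn sg DM_low) => j pj; case: HM => _ _ _ [t0 _ _].
by apply: (m_modP t0); lia.
Qed.

Lemma DM_tor1 (j : int) : p1 + mod_q%:Z < j -> ~ tor_neq0 M 1 j.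
Proof. by move=> qj; case: HM => _ _ _ [_ t1 _]; apply: (m_modP t1); rewrite /mod_q in qj;
    lia. Qed.

Lemma DM_tor2 (j : int) : p1 + mod_s%:Z < j -> ~ tor_neq0 M 2 j.
Proof. by move=> qj; case: HM => _ _ _ [_ _ t2]; apply: (m_modP t2); rewrite /mod_s in qj;
    lia. Qed.

End FixedModule.

Lemma finite_mod_series : finite_set [set h : int -> nat |
  exists (A : cgAlg k) (M : gMod A), DM n a b c m p1 p2 q r M /\ is_hilb_mod M h].
Proof.
pose Omega := {w : {A : cgAlg k & gMod A} | DM n a b c m p1 p2 q r (projT2 w)}.
pose A (w : Omega) : cgAlg k := projT1 (projT1 w).
pose M (w : Omega) : gMod (A w) := projT2 (projT1 w).
pose HM (w : Omega) : DM n a b c m p1 p2 q r (M w) := projT2 w.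
pose DA (w : Omega) : D n a b c (A w) := DM_alg (HM w).
pose xh w l := D_letter_in (DA w) l.
pose xs w d z := @D_span (A w) (DA w) d z.
pose x w := D_letter (DA w).
pose g w := DM_gen (HM w).
pose gh w i := DM_gen_in (HM w) i.
pose gs w v := DM_surj (HM w) v.
pose y (w : Omega) (t : rel_index Ld Ld alg_q + rel_index Ld Gd mod_q) := match t with
  | inl t => plus_coord Ld_gt0 xh w t
  | inr t => rel_coord x p1 g w t
  end.
pose hs w := mod_series Ld (x w) p1 Gd (g w).
pose mrel d w := fam_rel Ld x p1 Gd g d w.
(* The relations of the algebra are made maximal too: a module may have generators in degree [p1],
   so [m0] is 0 and trivial relations of degree [d] involve relations of the algebra of degree [d]
   itself. *)
pose ds (j : 'I_alg_s.+1 + 'I_mod_s.+1) w := match j with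
  | inl j => pdim (terms Ld Ld j) (plus_rel Ld_gt0 xh j w)
  | inr j => pdim (terms Ld Gd j) (mrel j w)
  end.
pose bd (j : 'I_alg_s.+1 + 'I_mod_s.+1) := match j with
  | inl j => size (terms Ld Ld j) | inr j => size (terms Ld Gd j) end.
have ry t : regular y (fun w => plus_coord Ld_gt0 xh (q := alg_q) w t).
  exact: (@regular_coord _ _ _ y (inl t)).
have rz (t : rel_index Ld Gd mod_q) : regular y (fun w => rel_coord x p1 g w t).
  exact: (@regular_coord _ _ _ y (inr t)).
have lw (T : Omega -> Prop) w0 d : T w0 -> liftable y T w0 (fam_words Ld x d).
  exact: (liftable_words xs Ld_le alg_qs (fun w => D_tor2 (DA w)) ry).
apply: (@sub_finite_set _ _ (values hs (fun=> True))).
  move=> h [A0 [M0 [HM0 hP]]]; pose w : Omega := exist _ (existT _ A0 M0) HM0.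
  exists w => //; apply/esym.
  exact: (mod_series_uniq Ld_gt0 (xh w) (@xs w) (gh w) (gs w) (DM_low HM0) hP).
apply: (finite_generic (y := y) (ds := ds) (b := bd)).
- by move=> [j|j] w; apply: pdim_le.
- move=> T [j|j] w0 T0.
    exact: (near_plus_rel xs Ld_le alg_qs (fun w => D_tor2 (DA w)) ry j T0).
  apply: near_dim => //; first exact: terms_uniq.
  + by move=> w _; apply: mod_rel_subspace.
  + by move=> w c' _ [].
  apply: (liftable_fam_rel Ld_gt0 xh xs gh gs (m0 := 0) _ Gd_le (fun w => DM_tor1 (HM w))
      rz) => //.
  by move=> e _; apply: lw.
move=> T w0 w1 irr T0 T1 maxds; rewrite /hs /mod_series; apply/funext => j.
case: ifP => // _; congr (_ - _)%N.
have maxA w' : (forall j w, T w -> (ds j w <= ds j w')%N) ->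
    forall e, (e <= alg_s)%N -> max_at T (terms Ld Ld e) (plus_rel Ld_gt0 xh e) w'.
  by move=> H e; rewrite -ltnS => es w Tw; apply: (H (inl (Ordinal es)) w Tw).
have maxM w' : T w' -> (forall j w, T w -> (ds j w <= ds j w')%N) ->
    forall d, max_at T (terms Ld Gd d) (mrel d) w'.
  move=> T' H d; apply: (max_fam_rel irr Ld_gt0 xh xs gh gs (m0 := 0) _ Gd_le _
    (fun w => DM_tor1 (HM w)) (fun w => DM_tor2 (HM w)) rz T') => //.
  - exact: leq_maxl.
  - by move=> e; rewrite -ltnS => es w Tw; apply: (H (inr (Ordinal es)) w Tw).
  - by move=> e w Tw _; apply: lw.
  move=> e _; apply: (max_words xs Ld_le alg_qs (fun w => D_tor2 (DA w))
    (fun w => D_tor3 (DA w)) ry e irr T').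
  exact: maxA.
have m0 i w : T w -> (ds i w <= ds i w0)%N by move=> /(maxds i)[].
have m1 i w : T w -> (ds i w <= ds i w1)%N by move=> /(maxds i)[].
by apply/eqP; rewrite eqn_leq (maxM w1 T1 m1 _ w0 T0) (maxM w0 T0 m0 _ w1 T1).
Qed.

End MainTheorem.

(* In each part the first conjunct says that the Hilbert series are defined. *)
Theorem theorem2p4 (k : fieldType) (n a b c m p1 p2 q r : int) :
  ((forall A : cgAlg k, D n a b c A -> exists h, is_hilb_alg A h) /\
   finite_set [set h : nat -> nat |
     exists A : cgAlg k, D n a b c A /\ is_hilb_alg A h]) /\
  ((forall (A : cgAlg k) (M : gMod A), DM n a b c m p1 p2 q r M ->
      exists h, is_hilb_mod M h) /\
   finite_set [set h : int -> nat |
     exists (A : cgAlg k) (M : gMod A),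
       DM n a b c m p1 p2 q r M /\ is_hilb_mod M h]).
Proof.
split; split; [|exact: finite_alg_series| |exact: finite_mod_series].
  move=> A DA; exists (alg_series (@ldeg `|n| `|a|) (D_letter DA)).
  exact: (alg_seriesP (@Ld_gt0 n a) (D_letter_in DA) (@D_span _ _ _ _ _ _ DA)).
move=> A M HM; have DA := DM_alg HM.
exists (mod_series (@ldeg `|n| `|a|) (D_letter DA) p1 (@mdeg `|m| `|p2 - p1|) (DM_gen HM)).
exact: (mod_seriesP (@Ld_gt0 n a) (D_letter_in DA) (@D_span _ _ _ _ _ _ DA)
  (DM_gen_in HM) (DM_surj HM) (DM_low HM)).
Qed.
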